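(* Let $N_0>1$, $1<b<2$, $\nu>0$, and $N_n=N_0^{b^n}$ for $n\ge 0$. Consider the system $$\dot u_n+\nu N_n^{2\alpha}u_n=N_{n-1}u_{n-1}^2-N_nu_nu_{n+1}\quad(n\ge0),\qquad u_n(0)=h_n,$$ with the incoming term $N_{n-1}u_{n-1}^2$ defined to be $0$ for $n=0$. (1) If $\alpha\ge \frac{1}{b+2}$, then every non-negative $h\in H_N^\infty$ generates a unique global (i.e. on $[0,\infty)$) non-negative finite-energy solution of the system, and this solution is globally smooth. (2) If $0\le\alpha<\frac1{b+2}$, then there exist non-negative finitely supported initial data $h$ for which the maximal smooth existence time $T_{\max}$ is finite. Thus $\alpha_c=1/(b+2)$ is the sharp threshold for global regularity of all non-negative smooth data, and the endpoint $\alpha=\alpha_c$ belongs to the regular regime.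
   Context: For $s\in\mathbb R$, $H_N^s$ is the space of real sequences $u=(u_n)_{n\ge0}$ with $\|u\|_{H_N^s}^2=\sum_{n\ge0}N_n^{2s}|u_n|^2<\infty$, and $H_N^\infty=\bigcap_{s>0}H_N^s$. A sequence $h$ is called smooth if $h\in H_N^\infty$. ''Non-negative'' means all coordinates are $\ge0$ (at all times, for a solution). A finite-energy solution on an interval $I\subset[0,\infty)$ is an $\ell^2$-valued map $u$ on $I$ whose coordinates $u_n$ belong to $C^1(I)$ and satisfy the equations for every $n\ge0$ (one-sided derivatives at included endpoints), with $u_n(0)=h_n$ for all $n$ if $0\in I$. It is smooth on $I$ if $\sup_{t\in J}\|u(t)\|_{H_N^s}<\infty$ for every compact interval $J\subset I$ and every $s>0$; it is globally smooth if it is smooth on $[0,\infty)$. For non-negative $h\in H_N^\infty$ there is a local non-negative smooth solution, and non-negative smooth solutions on a common interval with the same datum coincide; the maximal smooth existence time $T_{\max}\in(0,\infty]$ is the supremum of the $T>0$ for which a non-negative smooth solution with datum $h$ exists on $[0,T)$. *)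

(* Defs.v *)
From Stdlib Require Import Reals.
From Coquelicot Require Import Coquelicot.

Open Scope R_scope.

Definition freq (N0 b : R) (n : nat) : R := Rpower N0 (b ^ n).

Definition in_l2 (u : nat -> R) : Prop := ex_series (fun n => u n ^ 2).

Definition in_Hs (N : nat -> R) (s : R) (u : nat -> R) : Prop :=
  ex_series (fun n => Rpower (N n) (2 * s) * u n ^ 2).

(* Meaningful only under [in_Hs N s u]: [Series] is a junk value otherwise. *)
Definition Hs_norm (N : nat -> R) (s : R) (u : nat -> R) : R :=
  sqrt (Series (fun n => Rpower (N n) (2 * s) * u n ^ 2)).

Definition in_Hinf (N : nat -> R) (u : nat -> R) : Prop :=
  forall s, 0 < s -> in_Hs N s u.

Definition nonneg_seq (u : nat -> R) : Prop := forall n, 0 <= u n.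

Definition finitely_supported (u : nat -> R) : Prop :=
  exists M : nat, forall n, (M <= n)%nat -> u n = 0.

(* The interval [0, T), with [T = p_infty] giving [0, +oo). *)
Definition Ico0 (T : Rbar) (t : R) : Prop := 0 <= t /\ Rbar_lt t T.

Definition incoming (N u : nat -> R) (n : nat) : R :=
  match n with
  | O => 0
  | S m => N m * u m ^ 2
  end.

(* [u] is a total map, but only its values at times in the (non-degenerate) interval
   [I] of [0, +oo) matter. [D_in] and [continue_in] take limits inside [I], hence are one-sided at the
   endpoints belonging to [I]. *)
Record finite_energy_solution (N : nat -> R) (nu alpha : R) (h : nat -> R)
    (I : R -> Prop) (u : R -> nat -> R) : Prop := {
  fes_l2 : forall t, I t -> in_l2 (u t);
  fes_eq : forall n, exists du : R -> R, forall t, I t ->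
    D_in (fun r => u r n) du I t /\
    continue_in du I t /\
    du t + nu * Rpower (N n) (2 * alpha) * u t n
      = incoming N (u t) n - N n * u t n * u t (S n);
  fes_init : I 0 -> forall n, u 0 n = h n
}.

Definition nonneg_on (I : R -> Prop) (u : R -> nat -> R) : Prop :=
  forall t, I t -> nonneg_seq (u t).

Definition smooth_on (N : nat -> R) (I : R -> Prop) (u : R -> nat -> R) : Prop :=
  forall t0 t1, t0 <= t1 -> (forall t, t0 <= t <= t1 -> I t) ->
  forall s, 0 < s ->
  exists K : R, forall t, t0 <= t <= t1 -> in_Hs N s (u t) /\ Hs_norm N s (u t) <= K.

Definition nonneg_smooth_solution (N : nat -> R) (nu alpha : R) (h : nat -> R)
    (I : R -> Prop) (u : R -> nat -> R) : Prop :=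
  finite_energy_solution N nu alpha h I u /\ nonneg_on I u /\ smooth_on N I u.

(* [Lub_Rbar] is the supremum in the extended reals: [p_infty] for an unbounded
   set of times, and [m_infty] (hence not finite) for an empty one. *)
Definition Tmax (N : nat -> R) (nu alpha : R) (h : nat -> R) : Rbar :=
  Lub_Rbar (fun T => 0 < T /\ exists u, nonneg_smooth_solution N nu alpha h (Ico0 T) u).

Definition global_regularity (N : nat -> R) (nu alpha : R) : Prop :=
  forall h, nonneg_seq h -> in_Hinf N h ->
  exists u, nonneg_smooth_solution N nu alpha h (Ico0 p_infty) u.

(* Main.v *)
Require Import Defs.
From Stdlib Require Import Reals Lra Lia Psatz Compare_dec ClassicalEpsilon FunctionalExtensionality.
From Coquelicot Require Import Coquelicot.

Open Scope R_scope.

(** In the critical variables [a_n = N_n^gamma u_n], [gamma = 1/(b+2)], the system reads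
    [a_n' = N_n^(2 gamma) (a_(n-1)^2 - a_n a_(n+1) - kappa_n a_n)] with
    [kappa_n = nu N_n^(2 (alpha - gamma))], so inertia and dissipation balance exactly at
    [alpha = gamma].

    Regularity.  Consecutive modes live on widely separated time scales, so a mode [a_n] close to its
    maximal amplitude [A_n] has already filled [a_(n+1)], which then drains it: the region
    [a_n < A_n], [a_(n+1) > B_n - 4 (A_n - a_n)] is invariant under the Galerkin truncations.
    As [kappa_n] is bounded below for [alpha >= gamma], the amplitudes [A_n] can be brought below the
    effective viscosity, after which [a_(n+1) <= max (a_(n+1)(0), a_n^2 / kappa)] makes the tail decay doubly
    exponentially; as [b < 2] this beats every power of [N_n].  These bounds are uniform in the
    truncation, and the truncations converge by the [l^2] estimate that also yields weak-strong
    uniqueness.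

    Blow-up.  For [alpha < gamma] the functional [L = sum_n 2^n N_n^(- gamma) u_n] of a smooth
    solution satisfies [L' >= c L^2 - C], because the outgoing terms are absorbed by the incoming ones
    and [sum_n 2^n N_n^(4 (alpha - gamma))] converges. *)

(** * Differentiation inside [[0, T)] *)

(** The exponent [gamma] is forced by [N_n = e_n^2 e_(n+1)] with [e_n = N_n^gamma], that is by
    [(2 + b) gamma = 1]. The obstacle to regularity is that upper bounds alone do not close: at
    [a_n = A_n] the inflow [A_(n-1)^2] must be beaten by the outflow [A_n a_(n+1)], which calls for
    a lower bound [B_n] on [a_(n+1)]. That bound sustains itself only if
    [B_n (A_(n+2) + kappa_(n+1)) < A_n^2]. Eliminating [B_n] leaves a condition on the amplitudes
    alone, [A_(n-1)^2 < A_n (A_n^2 / (A_(n+2) + kappa_(n+1)) + kappa_n)]. Constant amplitudes give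
    equality when [kappa = 0]; for constant [kappa = nu], clearing the denominator shows a surplus
    [nu^2], and this surplus is what lets [A_n] decrease at the endpoint [alpha = gamma]. The last
    mode of a Galerkin system has no drain, so the argument by lower bounds stops at a level [n2]
    below the truncation; above it damping alone suffices. *)

Definition has_deriv (T : Rbar) (f : R -> R) (t l : R) : Prop :=
  D_in f (fun _ => l) (Ico0 T) t.

Lemma has_deriv_eq (T : Rbar) (f : R -> R) (t l l' : R) : l = l' -> has_deriv T f t l -> has_deriv T f t l'.
Proof. now intros <-. Qed.

Lemma has_deriv_plus (T : Rbar) (f g : R -> R) (t a c : R) :
  has_deriv T f t a -> has_deriv T g t c -> has_deriv T (fun s => f s + g s) t (a + c).
Proof. intros Hf Hg. exact (Dadd _ _ _ _ _ _ Hf Hg). Qed.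

Lemma has_deriv_mult (T : Rbar) (f g : R -> R) (t a c : R) :
  has_deriv T f t a -> has_deriv T g t c -> has_deriv T (fun s => f s * g s) t (a * g t + f t * c).
Proof. intros Hf Hg. exact (Dmult _ _ _ _ _ _ Hf Hg). Qed.

Lemma has_deriv_const (T : Rbar) (k t : R) : has_deriv T (fun _ => k) t 0.
Proof. exact (Dconst _ k t). Qed.

Lemma has_deriv_scal (T : Rbar) (f : R -> R) (k t a : R) :
  has_deriv T f t a -> has_deriv T (fun s => k * f s) t (k * a).
Proof. intros Hf. exact (Dmult_const _ _ _ _ k Hf). Qed.

Lemma has_deriv_minus (T : Rbar) (f g : R -> R) (t a c : R) :
  has_deriv T f t a -> has_deriv T g t c -> has_deriv T (fun s => f s - g s) t (a - c).
Proof. intros Hf Hg. exact (Dminus _ _ _ _ _ _ Hf Hg). Qed.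

Lemma has_deriv_derivable (T : Rbar) (f : R -> R) (t l : R) :
  derivable_pt_lim f t l -> has_deriv T f t l.
Proof.
  intros H. apply (limit1_imp _ (D_x no_cond t)).
  - intros x [_ Hx]. split; [exact I|exact Hx].
  - exact (proj2 (derivable_pt_lim_D_in f (fun _ => l) t) H).
Qed.

Lemma has_deriv_sqr (T : Rbar) (f : R -> R) (t a : R) :
  has_deriv T f t a -> has_deriv T (fun s => f s ^ 2) t (2 * f t * a).
Proof.
  intros Hf.
  assert (H := has_deriv_mult _ _ _ _ _ _ Hf Hf).
  intros eps Heps. destruct (H eps Heps) as [d [Hd H1]].
  exists d; split; [exact Hd|]. intros x Hx. specialize (H1 x Hx).
  replace ((f x ^ 2 - f t ^ 2) / (x - t)) with ((f x * f x - f t * f t) / (x - t))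
    by (unfold Rdiv; ring).
  now replace (2 * f t * a) with (a * f t + f t * a) by ring.
Qed.

Lemma has_deriv_sum (T : Rbar) (f : nat -> R -> R) (a : nat -> R) (t : R) (M : nat) :
  (forall n, (n <= M)%nat -> has_deriv T (f n) t (a n)) ->
  has_deriv T (fun s => sum_f_R0 (fun n => f n s) M) t (sum_f_R0 a M).
Proof.
  induction M as [|M IH]; intros H; simpl.
  - apply H; lia.
  - apply has_deriv_plus; [apply IH; intros; apply H; lia | apply H; lia].
Qed.

Lemma has_deriv_sub (T T' : Rbar) (f : R -> R) (t l : R) :
  (forall s, Ico0 T' s -> Ico0 T s) -> has_deriv T f t l -> has_deriv T' f t l.
Proof.
  intros HT H. apply (limit1_imp _ (D_x (Ico0 T) t)); [|exact H].
  intros x [Hx Hne]; split; auto.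
Qed.

Lemma Ico0_le (T : Rbar) (s t : R) : Ico0 T t -> 0 <= s <= t -> Ico0 T s.
Proof.
  intros [H0 H1] Hs. split; [lra|].
  apply (Rbar_le_lt_trans _ t); [simpl; lra|exact H1].
Qed.

Lemma Ico0_room (T : Rbar) (t : R) :
  Ico0 T t -> exists d, 0 < d /\ forall s, 0 <= s -> s < t + d -> Ico0 T s.
Proof.
  intros [H0 H1]. destruct T as [T| |]; simpl in H1; try contradiction.
  - exists (T - t). split; [lra|]. intros s Hs Hst. split; simpl; lra.
  - exists 1. split; [lra|]. intros s Hs _. split; simpl; auto.
Qed.

Lemma has_deriv_derivable_pt_lim (T : Rbar) (f : R -> R) (t l : R) :
  0 < t -> Ico0 T t -> has_deriv T f t l -> derivable_pt_lim f t l.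
Proof.
  intros Ht HI H eps Heps.
  destruct (H eps Heps) as [d [Hd H1]].
  destruct (Ico0_room T t HI) as [d2 [Hd2 Hr]].
  assert (Hm : 0 < Rmin (Rmin d d2) t) by (repeat apply Rmin_pos; lra).
  exists (mkposreal _ Hm). intros k Hk Hkd. simpl in Hkd.
  assert (Hk1 : Rabs k < d) by (eapply Rlt_le_trans; [exact Hkd|];
    eapply Rle_trans; [apply Rmin_l|apply Rmin_l]).
  assert (Hk2 : Rabs k < d2) by (eapply Rlt_le_trans; [exact Hkd|];
    eapply Rle_trans; [apply Rmin_l|apply Rmin_r]).
  assert (Hk3 : Rabs k < t) by (eapply Rlt_le_trans; [exact Hkd|apply Rmin_r]).
  apply Rabs_def2 in Hk2. apply Rabs_def2 in Hk3.
  specialize (H1 (t + k)). simpl in H1. unfold Rdist in H1.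
  replace (t + k - t) with k in H1 by ring.
  apply H1. split; [|exact Hk1]. split; [apply Hr; lra|lra].
Qed.

Lemma has_deriv_continuous (T : Rbar) (f : R -> R) (t l : R) :
  Ico0 T t -> has_deriv T f t l ->
  forall eps, 0 < eps ->
  exists d, 0 < d /\ forall s, Ico0 T s -> Rabs (s - t) < d -> Rabs (f s - f t) < eps.
Proof.
  intros HI H eps Heps.
  destruct (cont_deriv _ _ _ _ H eps Heps) as [d [Hd H1]].
  exists d; split; [exact Hd|]. intros s Hs Hst.
  destruct (Req_dec t s) as [<-|Hne].
  - replace (f t - f t) with 0 by ring. now rewrite Rabs_R0.
  - apply (H1 s). split; [split; assumption|exact Hst].
Qed.

Lemma has_deriv_MVT (T : Rbar) (f g : R -> R) (a c : R) :
  (forall t, Ico0 T t -> has_deriv T f t (g t)) -> 0 <= a <= c -> Ico0 T c ->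
  exists x, a <= x <= c /\ f c - f a = g x * (c - a).
Proof.
  intros H Hac Hc.
  (* [MVT_gen] wants two-sided continuity on the closed interval, while [f] is controlled only
     inside [[0, T)]; so [f] is extended to negative times by its value at [0]. *)
  destruct (MVT_gen (fun t => f (Rmax 0 t)) a c g) as [x [Hx Hfx]].
  - rewrite Rmin_left, Rmax_right by lra. intros x Hx.
    assert (HIx : Ico0 T x) by (apply (Ico0_le T x c Hc); lra).
    apply (is_derive_ext_loc f).
    + assert (Hp : 0 < x) by lra. exists (mkposreal x Hp). intros y Hy.
      unfold ball in Hy; simpl in Hy; unfold AbsRing_ball, abs, minus, plus, opp in Hy; simpl in Hy.
      apply Rabs_def2 in Hy. rewrite Rmax_right by lra. reflexivity.
    + apply is_derive_Reals. apply (has_deriv_derivable_pt_lim T); auto; lra.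
  - rewrite Rmin_left, Rmax_right by lra. intros x Hx eps Heps.
    assert (HIx : Ico0 T x) by (apply (Ico0_le T x c Hc); lra).
    destruct (has_deriv_continuous T f x _ HIx (H x HIx) eps Heps) as [d [Hd H1]].
    destruct (Ico0_room T x HIx) as [d2 [Hd2 Hr]].
    exists (Rmin d d2). split; [apply Rmin_pos; lra|].
    intros y [_ Hy]. simpl in Hy |- *. unfold Rdist in *.
    assert (Rabs (y - x) < d) by (eapply Rlt_le_trans; [exact Hy|apply Rmin_l]).
    assert (Rabs (y - x) < d2) by (eapply Rlt_le_trans; [exact Hy|apply Rmin_r]).
    apply Rabs_def2 in H2. rewrite (Rmax_right 0 x) by lra.
    apply H1.
    + apply Hr; [apply Rmax_l|]. apply Rmax_lub_lt; lra.
    + apply Rabs_def2 in H0. apply Rabs_def1; unfold Rmax; destruct (Rle_dec 0 y); lra.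
  - rewrite Rmin_left, Rmax_right in Hx by lra.
    exists x. split; [exact Hx|]. rewrite !Rmax_right in Hfx by lra. exact Hfx.
Qed.

Lemma has_deriv_nonincreasing (T : Rbar) (f g : R -> R) (a c : R) :
  (forall t, Ico0 T t -> has_deriv T f t (g t)) -> 0 <= a <= c -> Ico0 T c ->
  (forall t, a <= t <= c -> g t <= 0) -> f c <= f a.
Proof.
  intros H Hac Hc Hg. destruct (has_deriv_MVT T f g a c H Hac Hc) as [x [Hx He]].
  specialize (Hg x Hx). assert (0 <= c - a) by lra. nra.
Qed.

Lemma has_deriv_exp (T : Rbar) (k t : R) : has_deriv T (fun s => exp (k * s)) t (k * exp (k * t)).
Proof.
  apply has_deriv_derivable. apply is_derive_Reals. auto_derive; [exact I|ring].
Qed.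

Lemma has_deriv_id (T : Rbar) (t : R) : has_deriv T (fun s => s) t 1.
Proof. apply has_deriv_derivable. apply derivable_pt_lim_id. Qed.

(** The function [exp (- K s) * f s - e * s] is nonincreasing, its derivative being at most
    [e * (exp (- K s) - 1)]. The crude [e * t] in place of an integral avoids dividing by [K], which
    may be [0]. *)
Lemma gronwall (T : Rbar) (f g : R -> R) (K e t : R) :
  0 <= K -> 0 <= e -> Ico0 T t ->
  (forall s, Ico0 T s -> has_deriv T f s (g s)) -> f 0 = 0 ->
  (forall s, 0 <= s <= t -> g s <= K * f s + e) ->
  f t <= e * t * exp (K * t).
Proof.
  intros HK He HI H H0 Hg.
  assert (Ht : 0 <= t) by apply HI.
  assert (Hm := has_deriv_nonincreasing T (fun s => exp (- K * s) * f s - e * s)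
    (fun s => (- K * exp (- K * s)) * f s + exp (- K * s) * g s - e * 1) 0 t).
  assert (Hm' : exp (- K * t) * f t - e * t <= exp (- K * 0) * f 0 - e * 0).
  { apply Hm; [|lra|exact HI|].
    - intros s Hs. apply (has_deriv_minus T (fun s => exp (- K * s) * f s) (fun s => e * s)).
      + apply (has_deriv_mult T (fun s => exp (- K * s)) f); [apply has_deriv_exp|auto].
      + apply (has_deriv_scal T (fun s => s)), has_deriv_id.
    - intros s Hs. specialize (Hg s Hs).
      assert (0 < exp (- K * s)) by apply exp_pos.
      assert (exp (- K * s) <= 1).
      { rewrite <- exp_0. destruct (Req_dec (K * s) 0) as [E|E].
        - replace (- K * s) with 0 by lra. lra.
        - left. apply exp_increasing. assert (0 <= K * s) by (apply Rmult_le_pos; lra). lra. }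
      replace (- K * exp (- K * s) * f s + exp (- K * s) * g s - e * 1)
        with (exp (- K * s) * (g s - K * f s) - e) by ring.
      assert (exp (- K * s) * (g s - K * f s) <= exp (- K * s) * e)
        by (apply Rmult_le_compat_l; lra).
      nra. }
  rewrite H0 in Hm'. replace (exp (- K * 0) * 0 - e * 0) with 0 in Hm' by ring.
  assert (He1 : exp (K * t) * exp (- K * t) = 1).
  { rewrite <- exp_plus. replace (K * t + - K * t) with 0 by ring. apply exp_0. }
  replace (f t) with ((exp (- K * t) * f t) * exp (K * t)).
  - apply Rmult_le_compat_r; [left; apply exp_pos|lra].
  - replace (exp (- K * t) * f t * exp (K * t)) with (f t * (exp (K * t) * exp (- K * t))) by ring.
    rewrite He1; ring.
Qed.

(* The first time at which a constraint fails is a time where all hold weakly and one is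
   tight; a positive derivative there contradicts positivity just before. *)
Lemma strict_invariance (T : Rbar) (g g' : nat -> R -> R) (K : nat) :
  (forall i t, (i <= K)%nat -> Ico0 T t -> has_deriv T (g i) t (g' i t)) ->
  (forall i, (i <= K)%nat -> 0 < g i 0) ->
  (forall t, Ico0 T t -> (forall i, (i <= K)%nat -> 0 <= g i t) ->
     forall j, (j <= K)%nat -> g j t = 0 -> 0 < g' j t) ->
  forall t i, Ico0 T t -> (i <= K)%nat -> 0 < g i t.
Proof.
  intros HD H0 Hb t1 i1 Ht1 Hi1.
  set (S := fun s => 0 <= s <= t1 /\ forall r, 0 <= r <= s -> forall i, (i <= K)%nat -> 0 < g i r).
  assert (HS0 : S 0).
  { split; [split; [lra|apply Ht1]|]. intros r Hr. replace r with 0 by lra. exact H0. }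
  destruct (completeness S) as [m [Hub Hlub]].
  { exists t1. intros s [Hs _]. lra. }
  { exists 0. exact HS0. }
  assert (Hm0 : 0 <= m) by (apply Hub, HS0).
  assert (Hm1 : m <= t1) by (apply Hlub; intros s [Hs _]; lra).
  assert (Hbefore : forall r, 0 <= r < m -> forall i, (i <= K)%nat -> 0 < g i r).
  { intros r Hr i Hi. destruct (Classical_Prop.classic (exists s, S s /\ r < s)) as [[s [[Hs1 Hs2] Hrs]]|Hn].
    - apply Hs2; [lra|exact Hi].
    - exfalso. assert (m <= r); [|lra]. apply Hlub. intros s Hs.
      destruct (Rle_lt_dec s r); [assumption|]. exfalso; apply Hn; exists s; auto. }
  assert (HIm : Ico0 T m) by (apply (Ico0_le T m t1 Ht1); lra).
  assert (Hweak : forall i, (i <= K)%nat -> 0 <= g i m).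
  { intros i Hi. destruct (Rle_lt_dec 0 (g i m)) as [|Hneg]; [assumption|exfalso].
    assert (Hmpos : 0 < m).
    { destruct (Req_dec m 0) as [E|E]; [|lra]. rewrite E in Hneg. specialize (H0 i Hi). lra. }
    destruct (has_deriv_continuous T (g i) m _ HIm (HD i m Hi HIm) (- g i m)) as [d [Hd Hc]]; [lra|].
    set (r := Rmax (m / 2) (m - d / 2)).
    assert (Hr : 0 <= r < m) by (unfold r, Rmax; destruct (Rle_dec (m/2) (m - d/2)); lra).
    assert (HIr : Ico0 T r) by (apply (Ico0_le T r t1 Ht1); lra).
    assert (Hrd : Rabs (r - m) < d).
    { apply Rabs_def1; unfold r, Rmax; destruct (Rle_dec (m/2) (m - d/2)); lra. }
    specialize (Hc r HIr Hrd). apply Rabs_def2 in Hc.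
    specialize (Hbefore r Hr i Hi). lra. }
  assert (Hstrict : forall i, (i <= K)%nat -> 0 < g i m).
  { intros j Hj. destruct (Rle_lt_or_eq_dec 0 (g j m) (Hweak j Hj)) as [|E]; [assumption|exfalso].
    symmetry in E. assert (Hp := Hb m HIm Hweak j Hj E).
    assert (Hmpos : 0 < m).
    { destruct (Req_dec m 0) as [E0|E0]; [|lra]. rewrite E0 in E. specialize (H0 j Hj). lra. }
    destruct (has_deriv_derivable_pt_lim T _ m _ Hmpos HIm (HD j m Hj HIm) _ Hp) as [[d Hd] Hq].
    simpl in Hq.
    set (k := - Rmin (m / 2) (d / 2)).
    assert (Hk : - m < k < 0 /\ - d < k) by (unfold k, Rmin; destruct (Rle_dec (m/2) (d/2)); lra).
    assert (Hkd : Rabs k < d) by (apply Rabs_def1; lra).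
    assert (Hk0 : k <> 0) by lra.
    specialize (Hq k Hk0 Hkd). apply Rabs_def2 in Hq. rewrite E in Hq.
    assert (0 < g j (m + k)) by (apply Hbefore; [lra|exact Hj]).
    assert ((g j (m + k) - 0) / k < 0).
    { unfold Rdiv. rewrite Rminus_0_r. apply Rmult_pos_neg; [assumption|].
      apply Rinv_lt_0_compat; lra. }
    lra. }
  destruct (Rle_lt_or_eq_dec m t1 Hm1) as [Hlt|E].
  2:{ rewrite <- E. apply Hstrict, Hi1. }
  exfalso.
  (* There are finitely many constraints, so their intervals of positivity to the right of [m] have
     a common part. *)
  assert (Hext : forall k, (k <= K)%nat -> exists d, 0 < d /\ forall r, m <= r < m + d -> Ico0 T r ->
            forall i, (i <= k)%nat -> 0 < g i r).
  { assert (H1 : forall i, (i <= K)%nat -> exists d, 0 < d /\ forall r, m <= r < m + d -> Ico0 T r -> 0 < g i r).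
    { intros i Hi. destruct (has_deriv_continuous T (g i) m _ HIm (HD i m Hi HIm) (g i m)) as [d [Hd Hc]];
        [apply Hstrict, Hi|].
      exists d; split; [exact Hd|]. intros r Hr HIr.
      assert (Hrd : Rabs (r - m) < d) by (apply Rabs_def1; lra).
      specialize (Hc r HIr Hrd). apply Rabs_def2 in Hc. lra. }
    induction k as [|k IH]; intros Hk.
    - destruct (H1 0%nat Hk) as [d [Hd Hc]]. exists d; split; [exact Hd|].
      intros r Hr HIr i Hi. replace i with 0%nat by lia. auto.
    - destruct IH as [d [Hd Hc]]; [lia|]. destruct (H1 (Datatypes.S k) Hk) as [d2 [Hd2 Hc2]].
      exists (Rmin d d2). split; [apply Rmin_pos; lra|].
      intros r Hr HIr i Hi.
      assert (Rmin d d2 <= d) by apply Rmin_l. assert (Rmin d d2 <= d2) by apply Rmin_r.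
      destruct (Nat.eq_dec i (Datatypes.S k)) as [->|Hne].
      + apply Hc2; [lra|assumption].
      + apply Hc; [lra|assumption|lia]. }
  destruct (Hext K (le_n K)) as [d [Hd Hc]].
  set (s := Rmin t1 (m + d / 2)).
  assert (Hs : m < s /\ s <= t1 /\ s < m + d) by (unfold s, Rmin; destruct (Rle_dec t1 (m + d/2)); lra).
  assert (HSs : S s).
  { split; [lra|]. intros r Hr i Hi. destruct (Rlt_le_dec r m).
    - apply Hbefore; [lra|exact Hi].
    - apply Hc; [lra| |exact Hi]. apply (Ico0_le T r t1 Ht1); lra. }
  assert (s <= m) by (apply Hub, HSs). lra.
Qed.

(** The two families are glued into one with indices up to [2 K + 1], so that at a tight face of
    either family the constraints of both are available. *)
Lemma strict_invariance2 (T : Rbar) (g g' h h' : nat -> R -> R) (K : nat) :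
  (forall i t, (i <= K)%nat -> Ico0 T t -> has_deriv T (g i) t (g' i t)) ->
  (forall i t, (i <= K)%nat -> Ico0 T t -> has_deriv T (h i) t (h' i t)) ->
  (forall i, (i <= K)%nat -> 0 < g i 0) ->
  (forall i, (i <= K)%nat -> 0 < h i 0) ->
  (forall t, Ico0 T t -> (forall i, (i <= K)%nat -> 0 <= g i t) ->
     (forall i, (i <= K)%nat -> 0 <= h i t) ->
     forall j, (j <= K)%nat -> (g j t = 0 -> 0 < g' j t) /\ (h j t = 0 -> 0 < h' j t)) ->
  forall t i, Ico0 T t -> (i <= K)%nat -> 0 < g i t.
Proof.
  intros HD HD' H0 H0' Hb t i Ht Hi.
  set (sel := fun (p q : nat -> R -> R) j => if le_lt_dec j K then p j else q (j - S K)%nat).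
  assert (Hsel : forall p q, sel p q i = p i) by (intros; unfold sel; destruct (le_lt_dec i K); [reflexivity|lia]).
  rewrite <- (Hsel g h).
  apply (strict_invariance T (sel g h) (sel g' h') (K + S K)%nat); [| | |exact Ht|lia].
  - intros j s Hj Hs. unfold sel. destruct (le_lt_dec j K); [auto|apply HD'; [lia|auto]].
  - intros j Hj. unfold sel. destruct (le_lt_dec j K); [auto|apply H0'; lia].
  - intros s Hs Hall j Hj.
    assert (Hg : forall k, (k <= K)%nat -> 0 <= g k s).
    { intros k Hk. specialize (Hall k). unfold sel in Hall.
      destruct (le_lt_dec k K); [apply Hall; lia|lia]. }
    assert (Hh : forall k, (k <= K)%nat -> 0 <= h k s).
    { intros k Hk. specialize (Hall (k + S K)%nat). unfold sel in Hall.
      destruct (le_lt_dec (k + S K) K); [lia|].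
      replace (k + S K - S K)%nat with k in Hall by lia. apply Hall; lia. }
    unfold sel. destruct (le_lt_dec j K) as [Hl|Hl].
    + apply (Hb s Hs Hg Hh j Hl).
    + apply (Hb s Hs Hg Hh (j - S K)%nat); lia.
Qed.

(** The mean value theorem bounds the deviation of each approximant's increment from slope [g t] by
    [eps / 2 * |s - t|], uniformly in large [k]; this bound survives the merely pointwise
    convergence of [fk]. *)
Lemma has_deriv_uniform_limit (T : Rbar) (fk gk : nat -> R -> R) (f g : R -> R) (t : R) :
  Ico0 T t ->
  (exists k0, forall k s, (k0 <= k)%nat -> Ico0 T s -> has_deriv T (fk k) s (gk k s)) ->
  (forall s, Ico0 T s -> is_lim_seq (fun k => fk k s) (f s)) ->
  (forall t1 eps, Ico0 T t1 -> 0 < eps ->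
     exists k0, forall k s, (k0 <= k)%nat -> 0 <= s <= t1 -> Rabs (gk k s - g s) <= eps) ->
  (forall eps, 0 < eps -> exists d, 0 < d /\ forall s, Ico0 T s -> Rabs (s - t) < d -> Rabs (g s - g t) <= eps) ->
  has_deriv T f t (g t).
Proof.
  intros HI [k0 HD] Hlim Hu Hc eps Heps.
  destruct (Hc (eps / 4)) as [d [Hd Hcd]]; [lra|].
  destruct (Ico0_room T t HI) as [d2 [Hd2 Hr]].
  exists (Rmin d (d2 / 2)). split; [apply Rmin_pos; lra|].
  intros s [[Hs Hne] Hdist]. simpl in Hdist |- *. unfold Rdist in *.
  assert (Hsd : Rabs (s - t) < d) by (eapply Rlt_le_trans; [exact Hdist|apply Rmin_l]).
  assert (Hsd2 : Rabs (s - t) < d2 / 2) by (eapply Rlt_le_trans; [exact Hdist|apply Rmin_r]).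
  apply Rabs_def2 in Hsd2.
  (* The mean value point may lie to the right of [t]; this fixed time inside [[0, T)] provides one
     compact interval for the uniform convergence of [gk]. *)
  assert (HIt1 : Ico0 T (t + d2 / 2)) by (apply Hr; [destruct HI; lra|lra]).
  destruct (Hu (t + d2 / 2) (eps / 4) HIt1) as [k1 Hk1]; [lra|].
  assert (Hk : forall k, (k0 <= k)%nat -> (k1 <= k)%nat ->
     Rabs ((fk k s - fk k t) - g t * (s - t)) <= eps / 2 * Rabs (s - t)).
  { intros k Hk0 Hkk1.
    assert (Hx : exists x, Rabs (x - t) <= Rabs (s - t) /\ 0 <= x <= t + d2 / 2 /\
              fk k s - fk k t = gk k x * (s - t)).
    { destruct (Rle_lt_dec t s) as [Hts|Hts].
      - destruct (has_deriv_MVT T (fk k) (gk k) t s) as [x [Hx He]]; [auto|destruct HI; lra|auto|].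
        exists x. split; [|split; [destruct HI; lra|exact He]].
        rewrite !Rabs_right; lra.
      - destruct (has_deriv_MVT T (fk k) (gk k) s t) as [x [Hx He]]; [auto|destruct Hs; lra|auto|].
        exists x. split; [|split; [destruct Hs; lra|lra]].
        rewrite (Rabs_left (s - t)) by lra. apply Rabs_le; lra. }
    destruct Hx as [x [Hx1 [Hx2 ->]]].
    replace (gk k x * (s - t) - g t * (s - t)) with ((gk k x - g t) * (s - t)) by ring.
    rewrite Rabs_mult. apply Rmult_le_compat_r; [apply Rabs_pos|].
    assert (HIx : Ico0 T x) by (apply (Ico0_le T x _ HIt1 Hx2)).
    assert (E1 := Hk1 k x Hkk1 Hx2). assert (E2 := Hcd x HIx ltac:(lra)).
    replace (gk k x - g t) with ((gk k x - g x) + (g x - g t)) by ring.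
    eapply Rle_trans; [apply Rabs_triang|]. lra. }
  assert (Hl : Rabs ((f s - f t) - g t * (s - t)) <= eps / 2 * Rabs (s - t)).
  { assert (HL : is_lim_seq (fun k => Rabs ((fk k s - fk k t) - g t * (s - t)))
                  (Rabs ((f s - f t) - g t * (s - t)))).
    { apply (is_lim_seq_abs _ (Finite ((f s - f t) - g t * (s - t)))).
      apply is_lim_seq_minus'; [|apply is_lim_seq_const].
      apply is_lim_seq_minus'; auto. }
    assert (HC := is_lim_seq_const (eps / 2 * Rabs (s - t))).
    refine (is_lim_seq_le_loc _ _ _ _ _ HL HC). exists (max k0 k1). intros k Hkk. apply Hk; lia. }
  assert (Hst0 : s - t <> 0) by lra.
  assert (Hpos : 0 < Rabs (s - t)) by (apply Rabs_pos_lt; exact Hst0).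
  replace ((f s - f t) / (s - t) - g t) with (((f s - f t) - g t * (s - t)) / (s - t)) by (field; exact Hst0).
  unfold Rdiv at 1. rewrite Rabs_mult, Rabs_inv.
  apply (Rmult_lt_reg_r (Rabs (s - t))); [exact Hpos|].
  rewrite Rmult_assoc, Rinv_l, Rmult_1_r by lra. nra.
Qed.

Lemma cauchy_rate_limit (f : nat -> R) (e : nat -> R) (k0 : nat) :
  is_lim_seq e 0 ->
  (forall j k, (k0 <= k <= j)%nat -> Rabs (f j - f k) <= e k) ->
  is_lim_seq f (real (Lim_seq f)) /\
  forall k, (k0 <= k)%nat -> Rabs (real (Lim_seq f) - f k) <= e k.
Proof.
  intros He Hf.
  assert (Hex : ex_finite_lim_seq f).
  { apply ex_lim_seq_cauchy_corr. intros eps.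
    apply is_lim_seq_Reals in He. destruct (He (eps / 2)) as [k1 Hk1].
    { destruct eps as [p Hp]; simpl; lra. }
    assert (HN : forall n, (max k0 k1 <= n)%nat -> Rabs (f n - f (max k0 k1)) < eps / 2).
    { intros n Hn. eapply Rle_lt_trans; [apply Hf; lia|].
      specialize (Hk1 (max k0 k1) ltac:(lia)). unfold Rdist in Hk1. rewrite Rminus_0_r in Hk1.
      eapply Rle_lt_trans; [apply Rle_abs|exact Hk1]. }
    exists (max k0 k1). intros n m Hn Hm.
    assert (E1 := HN n Hn). assert (E2 := HN m Hm).
    apply Rabs_def2 in E1. apply Rabs_def2 in E2. apply Rabs_def1; lra. }
  assert (HL : is_lim_seq f (real (Lim_seq f))) by (apply Lim_seq_correct', Hex).
  split; [exact HL|]. intros k Hk.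
  assert (H1 : is_lim_seq (fun j => Rabs (f j - f k)) (Rabs (real (Lim_seq f) - f k))).
  { apply (is_lim_seq_abs _ (Finite (real (Lim_seq f) - f k))).
    apply is_lim_seq_minus'; [exact HL|apply is_lim_seq_const]. }
  refine (is_lim_seq_le_loc _ _ _ _ _ H1 (is_lim_seq_const (e k))).
  exists k. intros j Hj. apply Hf; lia.
Qed.

(** * Picard iteration for bounded Lipschitz fields *)

(** The iterates live on all real times, negative ones included, and so have ordinary two-sided
    derivatives. *)
Fixpoint picard_iter (G : (nat -> R) -> nat -> R) (h : nat -> R) (k : nat) : R -> nat -> R :=
  match k with
  | O => fun _ n => h n
  | S k => fun t n => h n + RInt (fun s => G (picard_iter G h k s) n) 0 t
  end.

Lemma Ico0_infty (t : R) : Ico0 p_infty t <-> 0 <= t.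
Proof. unfold Ico0; simpl; tauto. Qed.

Lemma lipschitz_continuous (f : R -> R) (C : R) :
  (forall s t, Rabs (f t - f s) <= C * Rabs (t - s)) -> forall t, continuous f t.
Proof.
  intros H t. apply continuity_pt_filterlim. intros eps Heps.
  assert (HC : 0 <= C).
  { specialize (H 0 1). assert (0 <= Rabs (f 1 - f 0)) by apply Rabs_pos.
    replace (1 - 0) with 1 in H by ring. rewrite Rabs_R1 in H. lra. }
  exists (eps / (C + 1)). split; [apply Rdiv_lt_0_compat; lra|].
  intros s [_ Hs]. simpl in *. unfold Rdist in *.
  eapply Rle_lt_trans; [apply H|].
  apply (Rmult_lt_compat_r (C + 1)) in Hs; [|lra].
  replace (eps / (C + 1) * (C + 1)) with eps in Hs by (field; lra).
  assert (0 <= Rabs (s - t)) by apply Rabs_pos. nra.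
Qed.

Section Picard.
Variables (G : (nat -> R) -> nat -> R) (h : nat -> R) (C L : R).
Hypothesis HL : 0 < L.
Hypothesis HGb : forall x n, Rabs (G x n) <= C.
Hypothesis HGl : forall x y r, (forall k, Rabs (x k - y k) <= r) ->
  forall n, Rabs (G x n - G y n) <= L * r.

Let X := picard_iter G h.

Lemma picard_field_continuous (k : nat) (n : nat) :
  (forall m s t, Rabs (X k t m - X k s m) <= C * Rabs (t - s)) ->
  forall t, continuous (fun s => G (X k s) n) t.
Proof.
  intros H. apply (lipschitz_continuous _ (L * C)). intros s t.
  rewrite Rmult_assoc. apply HGl. intros m. apply H.
Qed.

Lemma picard_iter_derive (k : nat) (n : nat) (t : R) :
  (forall m s t, Rabs (X k t m - X k s m) <= C * Rabs (t - s)) ->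
  is_derive (fun s => X (S k) s n) t (G (X k t) n).
Proof.
  intros H. assert (Hc := picard_field_continuous k n H).
  unfold X; simpl. fold X.
  replace (G (X k t) n) with (plus 0 (G (X k t) n)) by (unfold plus; simpl; ring).
  apply (is_derive_plus (fun _ => h n)); [exact (is_derive_const (h n) t)|].
  apply (is_derive_RInt (fun s => G (X k s) n) _ 0 t); [|apply Hc].
  apply filter_forall. intros s. apply (@RInt_correct R_CompleteNormedModule).
  apply (@ex_RInt_continuous R_CompleteNormedModule). intros z _. apply Hc.
Qed.

Lemma picard_iter_lipschitz (k : nat) :
  forall m s t, Rabs (X k t m - X k s m) <= C * Rabs (t - s).
Proof.
  assert (HC : 0 <= C) by (eapply Rle_trans; [apply Rabs_pos|apply (HGb h 0%nat)]).
  induction k as [|k IH]; intros m s t.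
  - unfold X; simpl. rewrite Rminus_diag, Rabs_R0. apply Rmult_le_pos; [exact HC|apply Rabs_pos].
  - destruct (MVT_gen (fun r => X (S k) r m) s t (fun r => G (X k r) m)) as [c [_ Hc]].
    + intros x _. apply picard_iter_derive, IH.
    + intros x _. apply derivable_continuous_pt.
      exists (G (X k x) m). apply is_derive_Reals, picard_iter_derive, IH.
    + rewrite Hc, Rabs_mult. apply Rmult_le_compat_r; [apply Rabs_pos|apply HGb].
Qed.

Lemma picard_iter_has_deriv (k : nat) (n : nat) (t : R) :
  has_deriv p_infty (fun s => X (S k) s n) t (G (X k t) n).
Proof.
  apply has_deriv_derivable, is_derive_Reals, picard_iter_derive, picard_iter_lipschitz.
Qed.

Lemma picard_iter_init (k n : nat) : X k 0 n = h n.
Proof.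
  destruct k; unfold X; simpl; [reflexivity|].
  rewrite (@RInt_point R_CompleteNormedModule). unfold zero; simpl. ring.
Qed.

(* In the weight [exp (2 L t)] the Picard map halves distances, on every bounded time interval
   at once. *)
Lemma picard_iter_step (k : nat) :
  forall n t, 0 <= t ->
  Rabs (X (S k) t n - X k t n) <= C / L * (/ 2) ^ k * exp (2 * L * t).
Proof.
  assert (HC : 0 <= C) by (eapply Rle_trans; [apply Rabs_pos|apply (HGb h 0%nat)]).
  assert (HCL : 0 <= C / L) by (apply Rmult_le_pos; [lra|left; apply Rinv_0_lt_compat; lra]).
  induction k as [|k IH]; intros n t Ht.
  (* The first increment is at most [C t = (C / L) (L t)], and [L t <= exp (2 L t)]. *)
  - change (X 0 t n) with (h n). rewrite <- (picard_iter_init 1 n).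
    eapply Rle_trans; [apply picard_iter_lipschitz|]. rewrite Rminus_0_r, Rabs_right by lra.
    simpl pow. rewrite Rmult_1_r.
    assert (2 * L * t + 1 <= exp (2 * L * t)).
    { destruct (Req_dec t 0) as [->|Hne].
      - rewrite Rmult_0_r, exp_0. lra.
      - assert (0 < 2 * L * t) by (apply Rmult_lt_0_compat; lra).
        assert (1 + 2 * L * t < exp (2 * L * t)) by (apply exp_ineq1; lra). lra. }
    replace (C * t) with (C / L * (L * t)) by (field; lra).
    apply Rmult_le_compat_l; [exact HCL|]. assert (0 <= L * t) by (apply Rmult_le_pos; lra). lra.
  - set (B := C / L * (/ 2) ^ S k).
    assert (HB : 0 <= B) by (apply Rmult_le_pos; [exact HCL|apply pow_le; lra]).
    (* With [sg] equal to [1] and to [-1], one monotonicity argument bounds the absolute value from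
       both sides. *)
    assert (Hside : forall sg, Rabs sg = 1 ->
      sg * (X (S (S k)) t n - X (S k) t n) - B * exp (2 * L * t) <=
      sg * (X (S (S k)) 0 n - X (S k) 0 n) - B * exp (2 * L * 0)).
    { intros sg Hsg.
      apply (has_deriv_nonincreasing p_infty
        (fun s => sg * (X (S (S k)) s n - X (S k) s n) - B * exp (2 * L * s))
        (fun s => sg * (G (X (S k) s) n - G (X k s) n) - B * (2 * L * exp (2 * L * s))) 0 t);
        [| lra | apply Ico0_infty; lra |].
      - intros s _. apply (has_deriv_minus _ (fun s => sg * _) (fun s => B * _)).
        + apply (has_deriv_scal _ (fun s => X (S (S k)) s n - X (S k) s n)).
          apply (has_deriv_minus _ (fun s => X (S (S k)) s n) (fun s => X (S k) s n)); apply picard_iter_has_deriv.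
        + apply (has_deriv_scal _ (fun s => exp (2 * L * s))), has_deriv_exp.
      - intros s Hs.
        assert (Hg : Rabs (G (X (S k) s) n - G (X k s) n) <= L * (C / L * (/ 2) ^ k * exp (2 * L * s))).
        { apply HGl. intros m. apply IH. lra. }
        assert (sg * (G (X (S k) s) n - G (X k s) n) <= Rabs (G (X (S k) s) n - G (X k s) n)).
        { eapply Rle_trans; [apply Rle_abs|]. rewrite Rabs_mult, Hsg. lra. }
        unfold B. simpl pow. lra. }
    rewrite !picard_iter_init, !Rminus_diag in Hside.
    rewrite Rmult_0_r, exp_0 in Hside.
    assert (H1 := Hside 1 Rabs_R1).
    assert (H2 := Hside (-1) ltac:(rewrite Rabs_left; lra)).
    apply Rabs_le. fold B. lra.
Qed.

Lemma picard_iter_cauchy (k j : nat) :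
  forall n t, 0 <= t -> (k <= j)%nat ->
  Rabs (X j t n - X k t n) <= 2 * (C / L) * (/ 2) ^ k * exp (2 * L * t).
Proof.
  intros n t Ht Hkj.
  assert (HC : 0 <= C) by (eapply Rle_trans; [apply Rabs_pos|apply (HGb h 0%nat)]).
  assert (HCL : 0 <= C / L) by (apply Rmult_le_pos; [lra|left; apply Rinv_0_lt_compat; lra]).
  assert (HE : 0 < exp (2 * L * t)) by apply exp_pos.
  (* The factor [(/ 2)^k - (/ 2)^j] is the exact geometric partial sum; the bound without [(/ 2)^j]
     would not be inductive. *)
  assert (H : Rabs (X j t n - X k t n) <= 2 * (C / L) * ((/ 2) ^ k - (/ 2) ^ j) * exp (2 * L * t)).
  { induction Hkj as [|j Hkj IH].
    - rewrite !Rminus_diag, Rabs_R0. lra.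
    - assert (Hs := picard_iter_step j n t Ht).
      replace (X (S j) t n - X k t n) with ((X (S j) t n - X j t n) + (X j t n - X k t n)) by ring.
      eapply Rle_trans; [apply Rabs_triang|]. simpl pow. lra. }
  eapply Rle_trans; [exact H|]. apply Rmult_le_compat_r; [lra|].
  apply Rmult_le_compat_l; [lra|]. assert (0 <= (/ 2) ^ j) by (apply pow_le; lra). lra.
Qed.

(** The Lipschitz condition is that of the sup norm over modes, phrased through an arbitrary bound
    [r] so that no supremum is formed. The iterates, hence their fields, converge uniformly on
    bounded time intervals, and the derivatives pass to the limit. *)
Theorem picard_lindelof :
  exists x : R -> nat -> R,
    (forall n, x 0 n = h n) /\
    (forall n t, 0 <= t -> has_deriv p_infty (fun s => x s n) t (G (x t) n)).
Proof.
  assert (HC : 0 <= C) by (eapply Rle_trans; [apply Rabs_pos|apply (HGb h 0%nat)]).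
  assert (HCL : 0 <= C / L) by (apply Rmult_le_pos; [lra|left; apply Rinv_0_lt_compat; lra]).
  set (x := fun t n => real (Lim_seq (fun k => X k t n))).
  assert (Hgeom : forall A, is_lim_seq (fun k => A * (/ 2) ^ k) 0).
  { intros A. replace (Finite 0) with (Rbar_mult A 0) by (simpl; f_equal; ring).
    apply is_lim_seq_scal_l, is_lim_seq_geom. rewrite Rabs_right; lra. }
  assert (Hx : forall t n, 0 <= t -> is_lim_seq (fun k => X k t n) (x t n) /\
     forall k, Rabs (x t n - X k t n) <= 2 * (C / L) * (/ 2) ^ k * exp (2 * L * t)).
  { intros t n Ht.
    destruct (cauchy_rate_limit (fun k => X k t n)
       (fun k => 2 * (C / L) * (/ 2) ^ k * exp (2 * L * t)) 0) as [H1 H2].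
    - apply (is_lim_seq_ext (fun k => 2 * (C / L) * exp (2 * L * t) * (/ 2) ^ k));
        [intros; ring|apply Hgeom].
    - intros j k Hjk. apply picard_iter_cauchy; [exact Ht|lia].
    - split; [exact H1|]. intros k. apply H2; lia. }
  assert (Hxl : forall n s t, 0 <= s -> 0 <= t -> Rabs (x t n - x s n) <= C * Rabs (t - s)).
  { intros n s t Hs Ht.
    assert (HL1 : is_lim_seq (fun k => Rabs (X k t n - X k s n)) (Rabs (x t n - x s n))).
    { apply (is_lim_seq_abs _ (Finite (x t n - x s n))). apply is_lim_seq_minus'; apply Hx; assumption. }
    refine (is_lim_seq_le _ _ _ _ _ HL1 (is_lim_seq_const (C * Rabs (t - s)))).
    intros k. apply picard_iter_lipschitz. }
  exists x. split.
  - intros n. unfold x. rewrite (Lim_seq_ext _ (fun _ => h n)), Lim_seq_const; [reflexivity|].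
    intros k. apply picard_iter_init.
  - intros n t Ht.
    apply (has_deriv_uniform_limit p_infty (fun k s => X (S k) s n) (fun k s => G (X k s) n)
             (fun s => x s n) (fun s => G (x s) n)).
    + apply Ico0_infty, Ht.
    + exists 0%nat. intros k s _ _. apply picard_iter_has_deriv.
    + intros s Hs. apply Ico0_infty in Hs.
      apply (is_lim_seq_incr_1 (fun k => X k s n)), Hx, Hs.
    + intros t1 eps Ht1 Heps.
      assert (Hlim := Hgeom (L * (2 * (C / L) * exp (2 * L * t1)))).
      apply is_lim_seq_Reals in Hlim. destruct (Hlim eps Heps) as [k0 Hk0].
      exists k0. intros k s Hk Hs.
      specialize (Hk0 k Hk). unfold Rdist in Hk0. rewrite Rminus_0_r in Hk0.
      eapply Rle_trans; [apply (HGl _ _ (2 * (C / L) * (/ 2) ^ k * exp (2 * L * t1)))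
        |left; eapply Rle_lt_trans; [|exact Hk0]].
      * intros m. rewrite <- Rabs_Ropp, Ropp_minus_distr. eapply Rle_trans; [apply Hx; lra|].
        apply Rmult_le_compat_l; [apply Rmult_le_pos; [lra|apply pow_le; lra]|].
        destruct (Req_dec s t1) as [->|Hne]; [apply Rle_refl|].
        assert (Hlt : s < t1) by (destruct (proj2 Hs); [assumption|contradiction]).
        left. apply exp_increasing. apply Rmult_lt_compat_l; [lra|exact Hlt].
      * eapply Rle_trans; [|apply Rle_abs]. right. ring.
    + intros eps Heps. exists (eps / (L * C + 1)).
      assert (HLC : 0 <= L * C) by (apply Rmult_le_pos; lra).
      split; [apply Rdiv_lt_0_compat; lra|].
      intros s Hs Hst. apply Ico0_infty in Hs.
      eapply Rle_trans; [apply HGl; intros m; apply Hxl; assumption|].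
      apply (Rmult_lt_compat_r (L * C + 1)) in Hst; [|lra].
      replace (eps / (L * C + 1) * (L * C + 1)) with eps in Hst by (field; lra).
      assert (0 <= Rabs (s - t)) by apply Rabs_pos. nra.
Qed.
End Picard.

(** * Galerkin truncations: energy and stability *)

Definition rhs (N d x : nat -> R) (n : nat) : R :=
  incoming N x n - N n * x n * x (S n) - d n * x n.

Definition solves_upto (N d : nat -> R) (T : Rbar) (M : nat) (u : R -> nat -> R) : Prop :=
  forall n t, (n <= M)%nat -> Ico0 T t -> has_deriv T (fun s => u s n) t (rhs N d (u t) n).

(** Since mode [M + 1] vanishes, no energy leaves through mode [M], and the truncation keeps the
    energy balance of the full system. *)
Record galerkin (N d h : nat -> R) (M : nat) (u : R -> nat -> R) : Prop := {
  gal_init : forall n, (n <= M)%nat -> u 0 n = h n;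
  gal_zero : forall t n, 0 <= t -> (M < n)%nat -> u t n = 0;
  gal_nonneg : forall t n, 0 <= t -> 0 <= u t n;
  gal_solves : solves_upto N d p_infty M u
}.

(** Only [0 <= g] is known where [f < 0]. Adding [eps * (1 + t)] makes the derivative strictly
    positive at a zero of the perturbed function; [eps] is then tuned to a hypothetical negative
    value. *)
Lemma has_deriv_nonneg (T : Rbar) (f g : R -> R) :
  (forall t, Ico0 T t -> has_deriv T f t (g t)) -> 0 <= f 0 ->
  (forall t, Ico0 T t -> f t < 0 -> 0 <= g t) ->
  forall t, Ico0 T t -> 0 <= f t.
Proof.
  intros HD H0 Hg t Ht.
  assert (Heps : forall eps, 0 < eps -> 0 < f t + eps * (1 + t)).
  { intros eps Heps.
    apply (strict_invariance T (fun _ s => f s + eps * (1 + s)) (fun _ s => g s + eps * (0 + 1)) 0 ) with (i := 0%nat);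
      [| | |exact Ht|lia].
    - intros _ s _ Hs. apply has_deriv_plus; [auto|]. apply (has_deriv_scal _ (fun s => 1 + s)).
      apply (has_deriv_plus _ (fun _ => 1) (fun s => s)); [apply has_deriv_const|apply has_deriv_id].
    - intros _ _. lra.
    - intros s Hs _ _ _ E. assert (0 <= s) by apply Hs.
      assert (0 < eps * (1 + s)) by (apply Rmult_lt_0_compat; lra).
      assert (0 <= g s) by (apply Hg; [exact Hs|lra]). lra. }
  assert (Ht0 : 0 <= t) by apply Ht.
  destruct (Rle_lt_dec 0 (f t)) as [|Hn]; [assumption|exfalso].
  specialize (Heps (- f t / (1 + t))).
  assert (Hp : 0 < - f t / (1 + t)) by (apply Rdiv_lt_0_compat; lra).
  specialize (Heps Hp). replace (- f t / (1 + t) * (1 + t)) with (- f t) in Heps by (field; lra). lra.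
Qed.

(** The nonlinear flux telescopes: the loss [2 N_n x_n^2 x_(n+1)] of mode [n] is the gain of mode
    [n + 1], so only the flux out of mode [M] remains. *)
Lemma energy_identity (N d x : nat -> R) (M : nat) :
  sum_f_R0 (fun n => 2 * x n * rhs N d x n) M
  = - 2 * sum_f_R0 (fun n => d n * x n ^ 2) M - 2 * N M * x M ^ 2 * x (S M).
Proof.
  induction M as [|M IH].
  - unfold sum_f_R0, rhs, incoming. ring.
  - rewrite !tech5, IH. unfold rhs at 1, incoming. ring.
Qed.

Lemma sum_nonneg (a : nat -> R) (M : nat) :
  (forall n, (n <= M)%nat -> 0 <= a n) -> 0 <= sum_f_R0 a M.
Proof.
  intros H. induction M as [|M IH]; simpl.
  - apply H; lia.
  - apply Rplus_le_le_0_compat; [apply IH; intros; apply H; lia|apply H; lia].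
Qed.

Lemma sum_ge_term (a : nat -> R) (M n : nat) :
  (forall k, (k <= M)%nat -> 0 <= a k) -> (n <= M)%nat -> a n <= sum_f_R0 a M.
Proof.
  intros H Hn. induction M as [|M IH]; simpl.
  - replace n with 0%nat by lia. lra.
  - assert (0 <= a (S M)) by (apply H; lia).
    destruct (Nat.eq_dec n (S M)) as [->|Hne].
    + assert (0 <= sum_f_R0 a M) by (apply sum_nonneg; intros; apply H; lia). lra.
    + assert (a n <= sum_f_R0 a M) by (apply IH; [intros; apply H; lia|lia]). lra.
Qed.

Lemma has_deriv_energy (N d : nat -> R) (T : Rbar) (M : nat) (u : R -> nat -> R) (t : R) :
  solves_upto N d T M u -> Ico0 T t ->
  has_deriv T (fun s => sum_f_R0 (fun n => u s n ^ 2) M) t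
    (- 2 * sum_f_R0 (fun n => d n * u t n ^ 2) M - 2 * N M * u t M ^ 2 * u t (S M)).
Proof.
  intros Hs Ht. rewrite <- energy_identity.
  apply (has_deriv_sum T (fun n s => u s n ^ 2)). intros n Hn. apply has_deriv_sqr, Hs; assumption.
Qed.

Lemma energy_bound (N d : nat -> R) (T : Rbar) (M : nat) (u : R -> nat -> R) (t : R) :
  (forall n, 0 <= N n) -> (forall n, 0 <= d n) ->
  solves_upto N d T M u -> (forall s n, Ico0 T s -> 0 <= u s n) -> Ico0 T t ->
  sum_f_R0 (fun n => u t n ^ 2) M <= sum_f_R0 (fun n => u 0 n ^ 2) M.
Proof.
  intros HN Hd Hs Hu Ht.
  apply (has_deriv_nonincreasing T _ _ 0 t (fun s Hs' => has_deriv_energy N d T M u s Hs Hs'));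
    [split; [lra|apply Ht]|exact Ht|].
  intros s Hst. assert (HIs := Ico0_le T s t Ht Hst).
  assert (0 <= sum_f_R0 (fun n => d n * u s n ^ 2) M).
  { apply sum_nonneg. intros n _. apply Rmult_le_pos; [apply Hd|apply pow2_ge_0]. }
  assert (0 <= N M * u s M ^ 2 * u s (S M)).
  { apply Rmult_le_pos; [apply Rmult_le_pos; [apply HN|apply pow2_ge_0]|apply Hu, HIs]. }
  lra.
Qed.

(* The cubic terms in [w] cancel up to [- 2 N_n w_n^2 u_{n+1} <= 0], so only [N_n u_n] and the flux
   through the last mode have to be controlled. *)
Lemma difference_inequality (N d u v : nat -> R) (K : R) (M : nat) :
  (forall n, 0 <= N n) -> (forall n, 0 <= d n) -> (forall n, 0 <= u n) ->
  (forall n, (n <= M)%nat -> N n * u n <= K) ->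
  sum_f_R0 (fun n => 2 * (v n - u n) * (rhs N d v n - rhs N d u n)) M
  <= 2 * K * sum_f_R0 (fun n => (v n - u n) ^ 2) M - K * (v M - u M) ^ 2
     - 2 * N M * (v M - u M) ^ 2 * v (S M)
     - 2 * N M * u M * (v M - u M) * (v (S M) - u (S M)).
Proof.
  intros HN Hd Hu. induction M as [|M IH]; intros HK.
  - unfold sum_f_R0, rhs, incoming.
    assert (0 <= d 0%nat * (v 0%nat - u 0%nat) ^ 2) by (apply Rmult_le_pos; [apply Hd|apply pow2_ge_0]).
    assert (0 <= K * (v 0%nat - u 0%nat) ^ 2).
    { apply Rmult_le_pos; [|apply pow2_ge_0].
      eapply Rle_trans; [|apply (HK 0%nat); lia]. apply Rmult_le_pos; auto. }
    nra.
  - assert (HKM : forall n, (n <= M)%nat -> N n * u n <= K) by (intros; apply HK; lia).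
    specialize (IH HKM). rewrite !tech5.
    unfold rhs at 3 4. unfold incoming.
    set (S1 := sum_f_R0 _ M) in *. set (S2 := sum_f_R0 _ M) in *.
    set (w := v M - u M) in *. set (w' := v (S M) - u (S M)) in *.
    assert (E : v M = w + u M) by (unfold w; ring).
    assert (E' : v (S M) = w' + u (S M)) by (unfold w'; ring).
    rewrite E, E' in *. clearbody w w'.
    assert (H1 : 0 <= d (S M) * w' ^ 2) by (apply Rmult_le_pos; [apply Hd|apply pow2_ge_0]).
    assert (H2 : 0 <= N M * w ^ 2 * u (S M)).
    { apply Rmult_le_pos; [apply Rmult_le_pos; [apply HN|apply pow2_ge_0]|apply Hu]. }
    (* Young's inequality. The share [K * w ^ 2] is paid by the reserve [- K * (v M - u M) ^ 2]
       carried in the statement; the share [K * w' ^ 2] leaves the same reserve for the next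
       mode. *)
    assert (H3 : 2 * N M * u M * w * w' <= K * (w ^ 2 + w' ^ 2)).
    { assert (0 <= N M * u M) by (apply Rmult_le_pos; auto).
      assert (N M * u M <= K) by (apply HK; lia).
      assert (2 * (w * w') <= w ^ 2 + w' ^ 2) by (assert (0 <= (w - w') ^ 2) by apply pow2_ge_0; nra).
      assert (0 <= w ^ 2 + w' ^ 2) by (assert (0 <= w ^ 2) by apply pow2_ge_0; assert (0 <= w' ^ 2) by apply pow2_ge_0; lra).
      apply Rle_trans with (N M * u M * (w ^ 2 + w' ^ 2)).
      - replace (2 * N M * u M * w * w') with (N M * u M * (2 * (w * w'))) by ring.
        apply Rmult_le_compat_l; assumption.
      - apply Rmult_le_compat_r; assumption. }
    nra.
Qed.

(** Both functions solve the equations up to mode [M] only; everything beyond enters through the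
    flux error [e]. The bound therefore compares truncations of different levels as well as two full
    solutions. *)
Lemma difference_bound (N d : nat -> R) (T : Rbar) (M : nat) (u v : R -> nat -> R) (K e t : R) :
  (forall n, 0 <= N n) -> (forall n, 0 <= d n) -> 0 <= K -> 0 <= e ->
  solves_upto N d T M u -> solves_upto N d T M v -> Ico0 T t ->
  (forall s n, Ico0 T s -> 0 <= u s n) -> (forall s n, Ico0 T s -> 0 <= v s n) ->
  (forall n, (n <= M)%nat -> v 0 n = u 0 n) ->
  (forall s n, 0 <= s <= t -> (n <= M)%nat -> N n * u s n <= K) ->
  (forall s, 0 <= s <= t ->
     2 * N M * u s M * Rabs (v s M - u s M) * Rabs (v s (S M) - u s (S M)) <= e) ->
  sum_f_R0 (fun n => (v t n - u t n) ^ 2) M <= e * t * exp (2 * K * t).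
Proof.
  intros HN Hd HK He Hu Hv HI Hu0 Hv0 Hin HKu Hee.
  apply (gronwall T (fun s => sum_f_R0 (fun n => (v s n - u s n) ^ 2) M)
    (fun s => sum_f_R0 (fun n => 2 * (v s n - u s n) * (rhs N d (v s) n - rhs N d (u s) n)) M));
    [lra|exact He|exact HI| | |].
  - intros s Hs. apply (has_deriv_sum T (fun n s => (v s n - u s n) ^ 2)).
    intros n Hn. apply (has_deriv_sqr T (fun s => v s n - u s n)).
    apply (has_deriv_minus T (fun s => v s n) (fun s => u s n)); auto.
  - transitivity (sum_f_R0 (fun _ => 0) M); [|rewrite sum_cte; ring].
    apply sum_eq. intros n Hn. rewrite Hin by exact Hn. ring.
  - intros s Hs. assert (HIs := Ico0_le T s t HI Hs).
    eapply Rle_trans; [apply (difference_inequality N d (u s) (v s) K M); auto|].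
    specialize (Hee s Hs).
    set (w := v s M - u s M) in *. set (w' := v s (S M) - u s (S M)) in *.
    assert (0 <= K * w ^ 2) by (apply Rmult_le_pos; [exact HK|apply pow2_ge_0]).
    assert (0 <= N M * w ^ 2 * v s (S M)).
    { apply Rmult_le_pos; [apply Rmult_le_pos; [apply HN|apply pow2_ge_0]|apply Hv0, HIs]. }
    assert (- (2 * N M * u s M * w * w') <= 2 * N M * u s M * Rabs w * Rabs w').
    { assert (0 <= 2 * N M * u s M) by (apply Rmult_le_pos; [specialize (HN M); lra|apply Hu0, HIs]).
      rewrite !(Rmult_assoc (2 * N M * u s M)). rewrite <- Rabs_mult.
      assert (- (w * w') <= Rabs (w * w')) by (rewrite <- Rabs_Ropp; apply Rle_abs).
      replace (- (2 * N M * u s M * (w * w'))) with (2 * N M * u s M * (- (w * w'))) by ring.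
      apply Rmult_le_compat_l; assumption. }
    lra.
Qed.

Definition clamp (K x : R) : R := Rmax 0 (Rmin x K).

Lemma clamp_bounds (K x : R) : 0 <= K -> 0 <= clamp K x <= K.
Proof. intros HK. unfold clamp, Rmax, Rmin. repeat destruct Rle_dec; lra. Qed.

Lemma clamp_lipschitz (K x y : R) : Rabs (clamp K x - clamp K y) <= Rabs (x - y).
Proof.
  unfold clamp, Rmax, Rmin. repeat destruct Rle_dec;
  unfold Rabs; repeat destruct Rcase_abs; lra.
Qed.

Lemma clamp_id (K x : R) : 0 <= x <= K -> clamp K x = x.
Proof. intros Hx. unfold clamp, Rmax, Rmin. repeat destruct Rle_dec; lra. Qed.

Lemma clamp_neg (K x : R) : 0 <= K -> x < 0 -> clamp K x = 0.
Proof. intros HK Hx. unfold clamp, Rmax, Rmin. repeat destruct Rle_dec; lra. Qed.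

(** Clamping to [[0, K]] makes the quadratic field bounded and Lipschitz, and it reads a negative
    coordinate as [0], which leaves only the non-negative inflow there. *)
Definition clamped_field (N d : nat -> R) (M : nat) (K : R) (x : nat -> R) (n : nat) : R :=
  if le_dec n M then rhs N d (fun k => clamp K (x k)) n else 0.

Lemma finite_upper_bound (a : nat -> R) (M : nat) :
  exists D, 0 <= D /\ forall n, (n <= M)%nat -> a n <= D.
Proof.
  exists (sum_f_R0 (fun n => Rabs (a n)) M). split.
  - apply sum_nonneg. intros; apply Rabs_pos.
  - intros n Hn. eapply Rle_trans; [apply Rle_abs|].
    apply (sum_ge_term (fun n => Rabs (a n))); [intros; apply Rabs_pos|exact Hn].
Qed.

Lemma product_lipschitz (K r a b a' b' : R) :
  0 <= a <= K -> 0 <= b' <= K -> Rabs (a - a') <= r -> Rabs (b - b') <= r ->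
  Rabs (a * b - a' * b') <= 2 * K * r.
Proof.
  intros Ha Hb Ha' Hb'.
  replace (a * b - a' * b') with (a * (b - b') + b' * (a - a')) by ring.
  eapply Rle_trans; [apply Rabs_triang|]. rewrite !Rabs_mult, (Rabs_right a), (Rabs_right b') by lra.
  assert (0 <= Rabs (a - a')) by apply Rabs_pos. assert (0 <= Rabs (b - b')) by apply Rabs_pos.
  assert (a * Rabs (b - b') <= K * r) by (apply Rmult_le_compat; lra).
  assert (b' * Rabs (a - a') <= K * r) by (apply Rmult_le_compat; lra). lra.
Qed.

Lemma rhs_bound (N d x : nat -> R) (n : nat) (B D1 D2 : R) :
  (forall k, (k <= n)%nat -> 0 <= N k <= D1) -> 0 <= d n <= D2 ->
  (forall k, 0 <= x k <= B) ->
  Rabs (rhs N d x n) <= 2 * (D1 * (B * B)) + D2 * B.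
Proof.
  intros HN Hd Hx.
  assert (Hprod : forall k i j, (k <= n)%nat -> 0 <= N k * (x i * x j) <= D1 * (B * B)).
  { intros k i j Hk. assert (E1 := Hx i). assert (E2 := Hx j). specialize (HN k Hk).
    assert (0 <= x i * x j <= B * B)
      by (split; [apply Rmult_le_pos; lra|apply Rmult_le_compat; lra]).
    split; [apply Rmult_le_pos; lra|apply Rmult_le_compat; lra]. }
  assert (Hin : 0 <= incoming N x n <= D1 * (B * B)).
  { destruct n as [|n]; unfold incoming.
    - specialize (Hprod 0%nat 0%nat 0%nat ltac:(lia)). lra.
    - specialize (Hprod n n n ltac:(lia)).
      replace (x n ^ 2) with (x n * x n) by ring. exact Hprod. }
  assert (H1 := Hprod n n (S n) (le_n n)).
  assert (H2 : 0 <= d n * x n <= D2 * B).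
  { specialize (Hx n). split; [apply Rmult_le_pos; lra|apply Rmult_le_compat; lra]. }
  apply Rabs_le. unfold rhs. lra.
Qed.

Lemma rhs_lipschitz (N d x y : nat -> R) (n : nat) (B D1 D2 r : R) :
  (forall k, (k <= n)%nat -> 0 <= N k <= D1) -> 0 <= d n <= D2 ->
  (forall k, 0 <= x k <= B) -> (forall k, 0 <= y k <= B) ->
  (forall k, (k <= S n)%nat -> Rabs (x k - y k) <= r) ->
  Rabs (rhs N d x n - rhs N d y n) <= (4 * (D1 * B) + D2) * r.
Proof.
  intros HN Hd Hx Hy Hr.
  assert (Hr0 : 0 <= r) by (eapply Rle_trans; [apply Rabs_pos|apply (Hr 0%nat); lia]).
  assert (HB : 0 <= B) by (specialize (Hx 0%nat); lra).
  assert (HD1 : 0 <= D1) by (specialize (HN n (le_n n)); lra).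
  assert (Hprod : forall k i j, (k <= n)%nat -> (i <= S n)%nat -> (j <= S n)%nat ->
            Rabs (N k * (x i * x j - y i * y j)) <= D1 * (2 * B * r)).
  { intros k i j Hk Hi Hj. specialize (HN k Hk). rewrite Rabs_mult, (Rabs_right (N k)) by lra.
    apply Rmult_le_compat; [lra|apply Rabs_pos|lra|]. apply product_lipschitz; auto. }
  assert (Hin : Rabs (incoming N x n - incoming N y n) <= D1 * (2 * B * r)).
  { destruct n as [|n]; unfold incoming.
    - rewrite Rminus_diag, Rabs_R0. apply Rmult_le_pos; [lra|apply Rmult_le_pos; lra].
    - replace (N n * x n ^ 2 - N n * y n ^ 2) with (N n * (x n * x n - y n * y n)) by ring.
      apply Hprod; lia. }
  assert (H1 := Hprod n n (S n) (le_n n) ltac:(lia) (le_n (S n))).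
  assert (H2 : Rabs (d n * (x n - y n)) <= D2 * r).
  { rewrite Rabs_mult, (Rabs_right (d n)) by lra.
    apply Rmult_le_compat; [lra|apply Rabs_pos|lra|apply Hr; lia]. }
  apply Rabs_le_between in Hin. apply Rabs_le_between in H1. apply Rabs_le_between in H2.
  apply Rabs_le. unfold rhs. nra.
Qed.

Lemma clamped_field_bounds (N d : nat -> R) (M : nat) (K : R) :
  0 <= K -> (forall n, 0 <= N n) -> (forall n, 0 <= d n) ->
  exists C L, 0 < L /\ (forall x n, Rabs (clamped_field N d M K x n) <= C) /\
    (forall x y r, (forall k, Rabs (x k - y k) <= r) ->
       forall n, Rabs (clamped_field N d M K x n - clamped_field N d M K y n) <= L * r).
Proof.
  intros HK HN Hd.
  destruct (finite_upper_bound N M) as [D1 [HD1 HN1]].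
  destruct (finite_upper_bound d M) as [D2 [HD2 Hd2]].
  assert (HDK : 0 <= D1 * K) by (apply Rmult_le_pos; lra).
  exists (2 * (D1 * (K * K)) + D2 * K), (4 * (D1 * K) + D2 + 1).
  split; [lra|]. split.
  - intros x n. unfold clamped_field. destruct (le_dec n M) as [Hn|Hn].
    + apply rhs_bound; [|split; auto|intros k; apply clamp_bounds, HK].
      intros k Hk. split; [apply HN|apply HN1; lia].
    + rewrite Rabs_R0. assert (0 <= D1 * (K * K)) by (apply Rmult_le_pos; [lra|nra]).
      assert (0 <= D2 * K) by (apply Rmult_le_pos; lra). lra.
  - intros x y r Hr n.
    assert (Hr0 : 0 <= r) by (eapply Rle_trans; [apply Rabs_pos|apply (Hr 0%nat)]).
    unfold clamped_field. destruct (le_dec n M) as [Hn|Hn].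
    + apply Rle_trans with ((4 * (D1 * K) + D2) * r); [|apply Rmult_le_compat_r; lra].
      apply rhs_lipschitz; [|split; auto|intros k; apply clamp_bounds, HK|intros k; apply clamp_bounds, HK|].
      * intros k Hk. split; [apply HN|apply HN1; lia].
      * intros k _. eapply Rle_trans; [apply clamp_lipschitz|apply Hr].
    + rewrite Rminus_diag, Rabs_R0. apply Rmult_le_pos; lra.
Qed.

(** Picard iteration solves the clamped system. The clamp then turns out to be inactive: coordinates
    cannot become negative, and the energy stays below [K], which bounds each coordinate by [K]. *)
Lemma galerkin_exists (N d h : nat -> R) (M : nat) :
  (forall n, 0 <= N n) -> (forall n, 0 < d n) -> nonneg_seq h ->
  exists u, galerkin N d h M u.
Proof.
  intros HN Hd Hh.
  set (h' := fun n => if le_dec n M then h n else 0).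
  assert (Hh' : forall n, 0 <= h' n) by (intros n; unfold h'; destruct (le_dec n M); [apply Hh|lra]).
  (* The summand [1] serves twice: the energy starts strictly below [K], and [K >= 1] turns
     [x ^ 2 <= K] into [x <= K]. *)
  set (K := 1 + sum_f_R0 (fun n => h n ^ 2) M).
  assert (HK : 1 <= K).
  { unfold K. assert (0 <= sum_f_R0 (fun n => h n ^ 2) M) by (apply sum_nonneg; intros; apply pow2_ge_0). lra. }
  destruct (clamped_field_bounds N d M K) as [C [L [HL [HGb HGl]]]];
    [lra|exact HN|intros n; left; apply Hd|].
  destruct (picard_lindelof _ h' C L HL HGb HGl) as [u [Hu0 HuD]].
  assert (Hzero : forall t n, 0 <= t -> (M < n)%nat -> u t n = 0).
  { intros t n Ht Hn.
    assert (HG0 : forall s, clamped_field N d M K (u s) n = 0).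
    { intros s. unfold clamped_field. destruct (le_dec n M); [lia|reflexivity]. }
    destruct (has_deriv_MVT p_infty (fun s => u s n) (fun s => clamped_field N d M K (u s) n) 0 t) as [x [_ Hx]].
    - intros s Hs. apply HuD, Hs.
    - lra.
    - apply Ico0_infty, Ht.
    - rewrite Hu0, HG0 in Hx. unfold h' in Hx. destruct (le_dec n M); [lia|lra]. }
  assert (Hnn : forall t n, 0 <= t -> 0 <= u t n).
  { intros t n Ht.
    apply (has_deriv_nonneg p_infty (fun s => u s n) (fun s => clamped_field N d M K (u s) n)).
    - intros s Hs. apply HuD, Hs.
    - rewrite Hu0. apply Hh'.
    - intros s Hs Hneg. unfold clamped_field. destruct (le_dec n M); [|lra].
      unfold rhs. rewrite (clamp_neg K (u s n)) by lra.
      assert (0 <= incoming N (fun k => clamp K (u s k)) n).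
      { destruct n; simpl; [lra|]. apply Rmult_le_pos; [apply HN|apply pow2_ge_0]. }
      lra.
    - apply Ico0_infty, Ht. }
  assert (Hunclamp : forall t, 0 <= t -> sum_f_R0 (fun n => u t n ^ 2) M <= K ->
            forall n, (n <= M)%nat -> clamped_field N d M K (u t) n = rhs N d (u t) n).
  { intros t Ht Hsum.
    assert (Hid : forall n, clamp K (u t n) = u t n).
    { intros n. apply clamp_id. split; [apply Hnn, Ht|].
      destruct (le_lt_dec n M) as [Hn|Hn]; [|rewrite Hzero by auto; lra].
      assert (u t n ^ 2 <= K).
      { eapply Rle_trans; [|exact Hsum]. apply (sum_ge_term (fun n => u t n ^ 2));
          [intros; apply pow2_ge_0|exact Hn]. }
      destruct (Rle_lt_dec (u t n) K); [assumption|exfalso]. nra. }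
    intros n Hn. unfold clamped_field. destruct (le_dec n M); [|lia].
    unfold rhs. rewrite !Hid. destruct n; simpl; rewrite ?Hid; reflexivity. }
  assert (Hpos : forall (x : nat -> R) m, 0 < sum_f_R0 (fun n => x n ^ 2) m ->
            0 < sum_f_R0 (fun n => d n * x n ^ 2) m).
  { intros x m. induction m as [|m IH]; intros Hp.
    - apply Rmult_lt_0_compat; [apply Hd|exact Hp].
    - rewrite !tech5 in *.
      assert (0 <= sum_f_R0 (fun n => d n * x n ^ 2) m)
        by (apply sum_nonneg; intros; apply Rmult_le_pos; [left; apply Hd|apply pow2_ge_0]).
      assert (0 <= x (S m) ^ 2) by apply pow2_ge_0.
      assert (0 <= d (S m) * x (S m) ^ 2) by (apply Rmult_le_pos; [left; apply Hd|assumption]).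
      destruct (Rlt_le_dec 0 (x (S m) ^ 2)).
      + assert (0 < d (S m) * x (S m) ^ 2) by (apply Rmult_lt_0_compat; [apply Hd|assumption]). lra.
      + assert (0 < sum_f_R0 (fun n => d n * x n ^ 2) m) by (apply IH; lra). lra. }
  (* Where the energy equals [K > 0] the clamp is still inactive and some mode is nonzero, so the
     damping, positive on every mode, makes the energy strictly decrease. *)
  assert (Hen : forall t, 0 <= t -> 0 < K - sum_f_R0 (fun n => u t n ^ 2) M).
  { intros t Ht.
    apply (strict_invariance p_infty (fun _ s => K - sum_f_R0 (fun n => u s n ^ 2) M)
      (fun _ s => 0 - sum_f_R0 (fun n => 2 * u s n * clamped_field N d M K (u s) n) M) 0)
      with (i := 0%nat); [| | |apply Ico0_infty, Ht|lia].
    - intros _ s _ Hs. apply (has_deriv_minus _ (fun _ => K)); [apply has_deriv_const|].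
      apply (has_deriv_sum _ (fun n s => u s n ^ 2)). intros n Hn.
      apply (has_deriv_sqr _ (fun s => u s n)), HuD, Hs.
    - intros _ _. unfold K.
      replace (sum_f_R0 (fun n => u 0 n ^ 2) M) with (sum_f_R0 (fun n => h n ^ 2) M); [lra|].
      apply sum_eq. intros n Hn. rewrite Hu0. unfold h'. destruct (le_dec n M); [reflexivity|lia].
    - intros s Hs _ _ _ E. assert (Hs0 : 0 <= s) by apply Hs.
      rewrite (sum_eq _ (fun n => 2 * u s n * rhs N d (u s) n)).
      + rewrite energy_identity, (Hzero s (S M)) by (auto; lia).
        assert (0 < sum_f_R0 (fun n => d n * u s n ^ 2) M) by (apply Hpos; lra). lra.
      + intros n Hn. rewrite Hunclamp by (auto; lra). reflexivity. }
  exists u. split.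
  - intros n Hn. rewrite Hu0. unfold h'. destruct (le_dec n M); [reflexivity|lia].
  - exact Hzero.
  - exact Hnn.
  - intros n t Hn Ht. assert (Ht0 : 0 <= t) by apply Ht.
    rewrite <- Hunclamp; [apply HuD, Ht0|exact Ht0| |exact Hn]. specialize (Hen t Ht0). lra.
Qed.

(** * From Galerkin bounds to smooth solutions *)

Lemma freq_exp (N0 b : R) (n : nat) : freq N0 b n = exp (b ^ n * ln N0).
Proof. reflexivity. Qed.

Lemma Rpower_freq (N0 b s : R) (n : nat) :
  Rpower (freq N0 b n) s = exp (s * (b ^ n * ln N0)).
Proof. unfold Rpower at 1. rewrite freq_exp, ln_exp. reflexivity. Qed.

Lemma freq_pos (N0 b : R) (n : nat) : 0 < freq N0 b n.
Proof. apply exp_pos. Qed.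

Lemma exp_le (x y : R) : x <= y -> exp x <= exp y.
Proof. intros [H|<-]; [left; apply exp_increasing, H|right; reflexivity]. Qed.

(** Bernoulli's inequality for the cube root of [b] gives [b^n >= (n e)^3], which exceeds [A n^2]
    once [n >= |A| / e^3]; the constant [C] pays for smaller [n]. *)
Lemma pow_dominates_square (b : R) : 1 < b ->
  forall A, exists C, 0 <= C /\ forall n, A * INR n ^ 2 <= b ^ n + C.
Proof.
  intros Hb A.
  set (r := Rpower b (/ 3)).
  assert (Hr3 : r ^ 3 = b).
  { unfold r. rewrite <- Rpower_pow by apply exp_pos. rewrite Rpower_mult.
    replace (/ 3 * INR 3) with 1 by (simpl; field). apply Rpower_1; lra. }
  assert (Hr : 1 < r).
  { unfold r. rewrite <- (Rpower_O b) at 1 by lra. apply Rpower_lt; lra. }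
  set (e := r - 1). assert (He : 0 < e) by (unfold e; lra).
  assert (He3 : 0 < e ^ 3) by (apply pow_lt, He).
  exists (Rabs A * (Rabs A / e ^ 3) ^ 2). split.
  { apply Rmult_le_pos; [apply Rabs_pos|apply pow2_ge_0]. }
  intros n. assert (Hn : 0 <= INR n) by apply pos_INR.
  assert (H1 : INR n * e <= r ^ n).
  { assert (H := poly n e He). replace (1 + e) with r in H by (unfold e; ring). lra. }
  assert (H3 : (INR n * e) ^ 3 <= b ^ n).
  { rewrite <- Hr3, <- pow_mult, Nat.mul_comm, pow_mult. apply pow_incr. split; [|exact H1].
    apply Rmult_le_pos; lra. }
  assert (HA : A <= Rabs A) by apply Rle_abs. assert (HA0 : 0 <= Rabs A) by apply Rabs_pos.
  apply Rle_trans with (Rabs A * INR n ^ 2); [apply Rmult_le_compat_r; [apply pow2_ge_0|exact HA]|].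
  destruct (Rle_lt_dec (Rabs A / e ^ 3) (INR n)) as [Hle|Hlt].
  - assert (Rabs A <= INR n * e ^ 3).
    { apply (Rmult_le_compat_r (e ^ 3)) in Hle; [|lra].
      replace (Rabs A / e ^ 3 * e ^ 3) with (Rabs A) in Hle by (field; lra). exact Hle. }
    assert (0 <= Rabs A * (Rabs A / e ^ 3) ^ 2) by (apply Rmult_le_pos; [lra|apply pow2_ge_0]).
    assert (Rabs A * INR n ^ 2 <= (INR n * e) ^ 3).
    { replace ((INR n * e) ^ 3) with (INR n * e ^ 3 * INR n ^ 2) by ring.
      apply Rmult_le_compat_r; [apply pow2_ge_0|assumption]. }
    lra.
  - assert (0 <= b ^ n) by (apply pow_le; lra).
    assert (Rabs A * INR n ^ 2 <= Rabs A * (Rabs A / e ^ 3) ^ 2).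
    { apply Rmult_le_compat_l; [lra|]. apply pow_incr; lra. }
    lra.
Qed.

(** On the logarithmic scale [n ln K] is compared with [s ln N0 b^n]. *)
Lemma geometric_le_Rpower_freq (N0 b K s : R) : 1 < N0 -> 1 < b -> 0 < K -> 0 < s ->
  exists C, 0 < C /\ forall n, K ^ n <= C * Rpower (freq N0 b n) s.
Proof.
  intros HN0 Hb HK Hs.
  assert (Hl : 0 < ln N0) by (rewrite <- ln_1; apply ln_increasing; lra).
  assert (Hsl : 0 < s * ln N0) by (apply Rmult_lt_0_compat; assumption).
  destruct (pow_dominates_square b Hb (Rabs (ln K) / (s * ln N0))) as [C [HC HCn]].
  exists (exp (s * ln N0 * C)). split; [apply exp_pos|]. intros n.
  rewrite Rpower_freq, <- exp_plus, <- Rpower_pow by exact HK.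
  unfold Rpower. apply exp_le. specialize (HCn n).
  apply (Rmult_le_compat_l (s * ln N0)) in HCn; [|lra].
  replace (s * ln N0 * (Rabs (ln K) / (s * ln N0) * INR n ^ 2)) with (Rabs (ln K) * INR n ^ 2) in HCn
    by (field; split; apply Rgt_not_eq; assumption).
  assert (INR n * ln K <= Rabs (ln K) * INR n ^ 2).
  { apply Rle_trans with (INR n * Rabs (ln K)).
    - apply Rmult_le_compat_l; [apply pos_INR|apply Rle_abs].
    - rewrite Rmult_comm. apply Rmult_le_compat_l; [apply Rabs_pos|].
      destruct n as [|n]; [simpl; lra|]. rewrite S_INR. assert (0 <= INR n) by apply pos_INR. nra. }
  lra.
Qed.

Lemma freq_ge_1 (N0 b : R) (n : nat) : 1 < N0 -> 1 < b -> 1 <= freq N0 b n.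
Proof.
  intros HN0 Hb. rewrite freq_exp, <- exp_0. apply exp_le.
  apply Rmult_le_pos; [apply pow_le; lra|].
  rewrite <- ln_1. left. apply ln_increasing; lra.
Qed.

Lemma one_le_Rpower_freq (N0 b s : R) (n : nat) :
  1 < N0 -> 1 < b -> 0 <= s -> 1 <= Rpower (freq N0 b n) s.
Proof.
  intros HN0 Hb Hs. rewrite Rpower_freq, <- exp_0. apply exp_le.
  repeat apply Rmult_le_pos; [lra|apply pow_le; lra|].
  rewrite <- ln_1. left. apply ln_increasing; lra.
Qed.

Lemma inv_freq_le_geometric (N0 b : R) : 1 < N0 -> 1 < b ->
  exists C, 0 < C /\ forall n, / freq N0 b n <= C * (/ 2) ^ n.
Proof.
  intros HN0 Hb. destruct (geometric_le_Rpower_freq N0 b 2 1 HN0 Hb) as [C [HC H]]; [lra|lra|].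
  exists C. split; [exact HC|]. intros n. specialize (H n).
  rewrite Rpower_1 in H by apply freq_pos.
  assert (HN := freq_pos N0 b n). assert (H2 : 0 < 2 ^ n) by (apply pow_lt; lra).
  rewrite pow_inv.
  apply (Rmult_le_reg_r (freq N0 b n)); [exact HN|].
  apply (Rmult_le_reg_r (2 ^ n)); [exact H2|].
  rewrite Rinv_l by lra.
  replace (C * / 2 ^ n * freq N0 b n * 2 ^ n) with (C * freq N0 b n) by (field; lra). lra.
Qed.

Lemma inv_freq_lim (N0 b : R) : 1 < N0 -> 1 < b -> is_lim_seq (fun n => / freq N0 b n) 0.
Proof.
  intros HN0 Hb. destruct (inv_freq_le_geometric N0 b HN0 Hb) as [C [HC H]].
  apply (is_lim_seq_le_le (fun _ => 0) _ (fun n => C * (/ 2) ^ n)).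
  - intros n. split; [left; apply Rinv_0_lt_compat, freq_pos|apply H].
  - apply is_lim_seq_const.
  - replace (Finite 0) with (Rbar_mult C 0) by (simpl; f_equal; ring).
    apply is_lim_seq_scal_l, is_lim_seq_geom. rewrite Rabs_right; lra.
Qed.

Lemma ex_series_inv_freq (N0 b : R) : 1 < N0 -> 1 < b -> ex_series (fun n => / freq N0 b n).
Proof.
  intros HN0 Hb. destruct (inv_freq_le_geometric N0 b HN0 Hb) as [C [HC H]].
  apply (@ex_series_le R_AbsRing R_CompleteNormedModule _ (fun n => C * (/ 2) ^ n)).
  - intros n. unfold norm; simpl; unfold abs; simpl.
    rewrite Rabs_right; [apply H|]. left. apply Rinv_0_lt_compat, freq_pos.
  - apply (@ex_series_scal_l R_AbsRing), ex_series_geom. rewrite Rabs_right; lra.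
Qed.

(** A pointwise form of membership in [in_Hinf]. It loses nothing for non-negative sequences, since
    [1 / N_n] is summable, and a mode-by-mode majorant is easier to propagate than norms. *)
Definition rapidly_decaying (N U : nat -> R) : Prop :=
  forall s, 0 < s -> exists C, 0 <= C /\ forall n, U n * Rpower (N n) s <= C.

Lemma rapidly_decaying_Hs (N0 b s : R) (U : nat -> R) :
  1 < N0 -> 1 < b -> 0 <= s -> rapidly_decaying (freq N0 b) U ->
  exists K, forall u : nat -> R, (forall n, 0 <= u n <= U n) ->
    in_Hs (freq N0 b) s u /\ Hs_norm (freq N0 b) s u <= K.
Proof.
  (* The extra power yields [N^(2 s) u^2 <= C^2 / N^2 <= C^2 / N], a summable bound independent of
     [u]. *)
  intros HN0 Hb Hs HU. destruct (HU (s + 1)) as [C [HC HCn]]; [lra|].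
  exists (sqrt (Series (fun n => C ^ 2 * / freq N0 b n))). intros u Hu.
  assert (Hle : forall n, 0 <= Rpower (freq N0 b n) (2 * s) * u n ^ 2 <= C ^ 2 * / freq N0 b n).
  { intros n. assert (HN := freq_pos N0 b n). assert (HN1 := freq_ge_1 N0 b n HN0 Hb).
    split; [apply Rmult_le_pos; [left; apply exp_pos|apply pow2_ge_0]|].
    apply Rle_trans with ((u n * Rpower (freq N0 b n) (s + 1)) ^ 2 * / freq N0 b n).
    - rewrite Rpower_plus, Rpower_1 by exact HN.
      replace (2 * s) with (s + s) by ring. rewrite Rpower_plus.
      set (P := Rpower (freq N0 b n) s). set (F := freq N0 b n) in *.
      replace ((u n * (P * F)) ^ 2 * / F) with (P * P * u n ^ 2 * F) by (field; lra).
      rewrite <- (Rmult_1_r (P * P * u n ^ 2)) at 1. apply Rmult_le_compat_l; [|exact HN1].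
      apply Rmult_le_pos; [|apply pow2_ge_0]. assert (0 < P) by apply exp_pos. nra.
    - apply Rmult_le_compat_r; [left; apply Rinv_0_lt_compat, HN|].
      apply pow_incr. split; [apply Rmult_le_pos; [apply Hu|left; apply exp_pos]|].
      eapply Rle_trans; [|apply HCn]. apply Rmult_le_compat_r; [left; apply exp_pos|apply Hu]. }
  assert (Hex : ex_series (fun n => C ^ 2 * / freq N0 b n))
    by (apply (@ex_series_scal_l R_AbsRing), ex_series_inv_freq; assumption).
  split.
  - apply (@ex_series_le R_AbsRing R_CompleteNormedModule _ _) with (2 := Hex).
    intros n. unfold norm; simpl; unfold abs; simpl.
    rewrite Rabs_right; [apply Hle|apply Rle_ge, Hle].
  - apply sqrt_le_1_alt, Series_le; assumption.
Qed.

Lemma rapidly_decaying_bounded (N0 b : R) (U : nat -> R) :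
  1 < N0 -> 1 < b -> rapidly_decaying (freq N0 b) U -> (forall n, 0 <= U n) ->
  forall k : nat, exists C, 0 <= C /\ forall n, U n * freq N0 b n ^ k <= C.
Proof.
  intros HN0 Hb HU HU0 k. destruct (HU (INR (S k))) as [C [HC H]].
  { rewrite S_INR. assert (0 <= INR k) by apply pos_INR. lra. }
  exists C. split; [exact HC|]. intros n. eapply Rle_trans; [|apply (H n)].
  apply Rmult_le_compat_l; [apply HU0|].
  rewrite Rpower_pow by apply freq_pos.
  apply Rle_pow; [apply freq_ge_1; assumption|lia].
Qed.

Lemma in_Hinf_rapidly_decaying (N0 b : R) (h : nat -> R) :
  nonneg_seq h -> in_Hinf (freq N0 b) h -> rapidly_decaying (freq N0 b) h.
Proof.
  intros Hh Hinf s Hs. specialize (Hinf s Hs).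
  assert (H0 : forall n, 0 <= Rpower (freq N0 b n) (2 * s) * h n ^ 2)
    by (intros n; apply Rmult_le_pos; [left; apply exp_pos|apply pow2_ge_0]).
  destruct Hinf as [l Hl].
  assert (Hb : exists B, forall n, sum_n (fun n => Rpower (freq N0 b n) (2 * s) * h n ^ 2) n <= B).
  { exists l. intros n. apply (is_lim_seq_incr_compare (sum_n _) l Hl).
    intros m. rewrite sum_Sn. unfold plus; simpl. specialize (H0 (S m)). simpl in H0. lra. }
  destruct Hb as [B HB].
  assert (Hterm : forall n, (h n * Rpower (freq N0 b n) s) ^ 2 <= B).
  { intros n. eapply Rle_trans; [|apply (HB n)]. rewrite sum_n_Reals.
    eapply Rle_trans; [|apply (sum_ge_term _ n n); [intros; apply H0|lia]].
    simpl (fun _ => _). replace (2 * s) with (s + s) by ring. rewrite Rpower_plus. right. ring. }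
  exists (1 + Rabs B). split; [assert (0 <= Rabs B) by apply Rabs_pos; lra|].
  intros n. specialize (Hterm n). set (z := h n * Rpower (freq N0 b n) s) in *.
  assert (B <= Rabs B) by apply Rle_abs. assert (0 <= Rabs B) by apply Rabs_pos.
  destruct (Rle_lt_dec z (1 + Rabs B)); [assumption|exfalso]. nra.
Qed.

Definition dissip (N : nat -> R) (nu alpha : R) (n : nat) : R := nu * Rpower (N n) (2 * alpha).

(** A majorant [U] independent of the truncation makes the flux through mode [M] small, so
    [difference_bound] shows the truncations to be Cauchy in each mode at rate [1 / N_M]; the limit
    inherits [U], hence smoothness. *)
Lemma smooth_solution_of_galerkin_bounds (N0 b nu alpha : R) (h U : nat -> R) (T : Rbar) (M0 : nat) :
  1 < N0 -> 1 < b -> 0 < nu -> nonneg_seq h ->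
  (forall n, 0 <= U n) -> rapidly_decaying (freq N0 b) U ->
  (forall M u, (M0 <= M)%nat ->
     galerkin (freq N0 b) (dissip (freq N0 b) nu alpha) h M u ->
     forall t n, Ico0 T t -> u t n <= U n) ->
  exists u, nonneg_smooth_solution (freq N0 b) nu alpha h (Ico0 T) u.
Proof.
  intros HN0 Hb Hnu Hh HU0 HU Hbound.
  set (N := freq N0 b) in *. set (d := dissip N nu alpha) in *.
  assert (HNpos : forall n, 0 < N n) by (intros; apply freq_pos).
  assert (HNge : forall n, 0 <= N n) by (intros; left; apply HNpos).
  assert (Hd : forall n, 0 < d n) by (intros; apply Rmult_lt_0_compat; [exact Hnu|apply exp_pos]).
  assert (Hdge : forall n, 0 <= d n) by (intros; left; apply Hd).
  set (ug := fun M => proj1_sig (constructive_indefinite_description _ (galerkin_exists N d h M HNge Hd Hh))).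
  assert (Hug : forall M, galerkin N d h M (ug M))
    by (intros M; apply (proj2_sig (constructive_indefinite_description _ (galerkin_exists N d h M HNge Hd Hh)))).
  clearbody ug.
  assert (HugU : forall M t n, (M0 <= M)%nat -> Ico0 T t -> 0 <= ug M t n <= U n).
  { intros M t n HM Ht. split; [apply (gal_nonneg _ _ _ _ _ (Hug M)), Ht|].
    apply (Hbound M); auto. }
  destruct (rapidly_decaying_bounded N0 b U HN0 Hb HU HU0 0) as [B [HB HUB]].
  destruct (rapidly_decaying_bounded N0 b U HN0 Hb HU HU0 1) as [K [HK HUK]].
  (* The third power gives [N_M u_M <= C3 / N_M^2]. This bounds the squared difference of
     truncations by a multiple of [N_M^(-2)], hence the difference by a multiple of [1 / N_M]. *)
  destruct (rapidly_decaying_bounded N0 b U HN0 Hb HU HU0 3) as [C3 [HC3 HU3]].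
  fold N in HUB, HUK, HU3.
  assert (HUB' : forall n, U n <= B) by (intros n; specialize (HUB n); simpl in HUB; lra).
  assert (HugB : forall M t n, (M0 <= M)%nat -> Ico0 T t -> 0 <= ug M t n <= B).
  { intros M t n HM Ht. specialize (HugU M t n HM Ht). specialize (HUB' n). lra. }
  set (c := 2 * C3 * B * B).
  assert (Hc : 0 <= c) by (unfold c; repeat apply Rmult_le_pos; lra).
  (* The [1] is there to avoid a square root: [x <= (1 + x)^2] for [x >= 0]. *)
  set (A := fun t => 1 + c * t * exp (2 * K * t)).
  assert (HA : forall s t, 0 <= s <= t -> 0 < A s <= A t).
  { intros s t Hst. unfold A.
    assert (0 <= c * s) by (apply Rmult_le_pos; lra).
    assert (0 < exp (2 * K * s)) by apply exp_pos.
    assert (exp (2 * K * s) <= exp (2 * K * t)) by (apply exp_le, Rmult_le_compat_l; lra).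
    assert (0 <= c * s * exp (2 * K * s)) by (apply Rmult_le_pos; lra).
    assert (c * s <= c * t) by (apply Rmult_le_compat_l; lra).
    assert (c * s * exp (2 * K * s) <= c * t * exp (2 * K * t)) by (apply Rmult_le_compat; lra).
    lra. }
  assert (Hsub : forall s, Ico0 T s -> Ico0 p_infty s) by (intros s Hs; apply Ico0_infty, Hs).
  assert (Hsol : forall M m, (m <= M)%nat -> solves_upto N d T m (ug M)).
  { intros M m Hm n t Hn Ht. apply (has_deriv_sub p_infty T); [exact Hsub|].
    apply (gal_solves _ _ _ _ _ (Hug M)); [lia|auto]. }
  assert (Hcauchy : forall M M' n t, (M0 <= M)%nat -> (M <= M')%nat -> (n <= M)%nat -> Ico0 T t ->
            Rabs (ug M' t n - ug M t n) <= A t * / N M).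
  { intros M M' n t HM HM' Hn Ht.
    set (e := c * (/ N M) ^ 2).
    assert (HNi : 0 < / N M) by (apply Rinv_0_lt_compat, HNpos).
    assert (He : 0 <= e) by (unfold e; apply Rmult_le_pos; [exact Hc|apply pow2_ge_0]).
    assert (Hdiff : sum_f_R0 (fun n => (ug M' t n - ug M t n) ^ 2) M <= e * t * exp (2 * K * t)).
    { apply (difference_bound N d T); auto.
      - intros s m Hs. apply HugU; auto.
      - intros s m Hs. apply HugU; auto; lia.
      - intros m Hm. rewrite (gal_init _ _ _ _ _ (Hug M')), (gal_init _ _ _ _ _ (Hug M)) by lia. reflexivity.
      - intros s m Hs Hm. specialize (HUK m).
        assert (Hm' := HugU M s m HM (Ico0_le T s t Ht Hs)). specialize (HNpos m). nra.
      - intros s Hs. assert (HIs := Ico0_le T s t Ht Hs).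
        assert (Hw : forall m, Rabs (ug M' s m - ug M s m) <= B).
        { intros m. assert (E1 := HugB M s m HM HIs). assert (E2 := HugB M' s m ltac:(lia) HIs).
          apply Rabs_le. lra. }
        assert (H1 : 0 <= N M * ug M s M <= C3 * (/ N M) ^ 2).
        { assert (E := HugU M s M HM HIs). specialize (HU3 M). assert (HNM := HNpos M).
          split; [apply Rmult_le_pos; [lra|apply E]|].
          apply Rle_trans with (U M * N M); [nra|].
          replace (U M * N M) with (U M * N M ^ 3 * (/ N M) ^ 2) by (field; lra).
          apply Rmult_le_compat_r; [apply pow2_ge_0|exact HU3]. }
        replace (2 * N M * ug M s M * Rabs (ug M' s M - ug M s M) * Rabs (ug M' s (S M) - ug M s (S M)))
          with (2 * (N M * ug M s M) * (Rabs (ug M' s M - ug M s M) * Rabs (ug M' s (S M) - ug M s (S M)))) by ring.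
        replace e with (2 * (C3 * (/ N M) ^ 2) * (B * B)) by (unfold e, c; ring).
        apply Rmult_le_compat; [lra|apply Rmult_le_pos; apply Rabs_pos|lra|].
        apply Rmult_le_compat; [apply Rabs_pos|apply Rabs_pos|apply Hw|apply Hw]. }
    assert (Hn2 : (ug M' t n - ug M t n) ^ 2 <= (A t * / N M) ^ 2).
    { eapply Rle_trans; [apply (sum_ge_term (fun n => (ug M' t n - ug M t n) ^ 2) M n)|];
        [intros; apply pow2_ge_0|exact Hn|].
      eapply Rle_trans; [exact Hdiff|]. unfold e.
      replace (c * (/ N M) ^ 2 * t * exp (2 * K * t)) with ((/ N M) ^ 2 * (c * t * exp (2 * K * t))) by ring.
      replace ((A t * / N M) ^ 2) with ((/ N M) ^ 2 * (A t) ^ 2) by ring.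
      apply Rmult_le_compat_l; [apply pow2_ge_0|].
      assert (0 < A t <= A t) by (apply HA; destruct Ht; lra).
      unfold A in *. nra. }
    rewrite <- (Rabs_right (A t * / N M)).
    - apply Rsqr_le_abs_0. rewrite !Rsqr_pow2. exact Hn2.
    - apply Rle_ge, Rmult_le_pos; [|lra]. left. apply (HA t t). destruct Ht; lra. }
  set (x := fun t n => real (Lim_seq (fun M => ug M t n))).
  assert (Hxlim : forall t n, Ico0 T t -> is_lim_seq (fun M => ug M t n) (x t n) /\
            forall M, (max M0 n <= M)%nat -> Rabs (x t n - ug M t n) <= A t * / N M).
  { intros t n Ht. apply (cauchy_rate_limit (fun M => ug M t n) (fun M => A t * / N M) (max M0 n)).
    - replace (Finite 0) with (Rbar_mult (A t) 0) by (simpl; f_equal; ring).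
      apply is_lim_seq_scal_l, inv_freq_lim; assumption.
    - intros j k Hjk. apply Hcauchy; [lia|lia|lia|exact Ht]. }
  assert (HxU : forall t n, Ico0 T t -> 0 <= x t n <= U n).
  { intros t n Ht. destruct (Hxlim t n Ht) as [Hl _]. split.
    - refine (is_lim_seq_le_loc _ _ _ _ _ (is_lim_seq_const 0) Hl).
      exists M0. intros M HM. apply HugU; assumption.
    - refine (is_lim_seq_le_loc _ _ _ _ _ Hl (is_lim_seq_const (U n))).
      exists M0. intros M HM. apply HugU; assumption. }
  assert (HxB : forall t n, Ico0 T t -> 0 <= x t n <= B).
  { intros t n Ht. specialize (HxU t n Ht). specialize (HUB' n). lra. }
  assert (HD : forall n, exists D, 0 <= D /\ forall k, (k <= n)%nat -> 0 <= N k <= D).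
  { intros n. destruct (finite_upper_bound N n) as [D [HD0 HD]]. exists D. split; [exact HD0|].
    intros k Hk. split; [apply HNge|apply HD, Hk]. }
  (* The right-hand sides are bounded uniformly in the truncation, so each limiting mode is
     Lipschitz. This makes the limiting right-hand side continuous, as passing to the limit in the
     derivatives and the [C^1] requirement both demand. *)
  assert (Hxlip : forall n, exists Q, 0 <= Q /\ forall s t, Ico0 T s -> Ico0 T t ->
            Rabs (x t n - x s n) <= Q * Rabs (t - s)).
  { intros n. destruct (HD n) as [D [HD0 HDn]].
    exists (2 * (D * (B * B)) + d n * B). split.
    { specialize (Hdge n). assert (0 <= D * (B * B)) by (repeat apply Rmult_le_pos; lra).
      assert (0 <= d n * B) by (apply Rmult_le_pos; lra). lra. }
    assert (Hmono : forall s t, Ico0 T s -> Ico0 T t -> s <= t ->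
      Rabs (x t n - x s n) <= (2 * (D * (B * B)) + d n * B) * Rabs (t - s)).
    { intros s t Hs Ht Hst.
      assert (HL1 : is_lim_seq (fun M => Rabs (ug M t n - ug M s n)) (Rabs (x t n - x s n))).
      { apply (is_lim_seq_abs _ (Finite (x t n - x s n))).
        apply is_lim_seq_minus'; apply Hxlim; assumption. }
      refine (is_lim_seq_le_loc _ _ _ _ _ HL1 (is_lim_seq_const _)).
      exists (max M0 n). intros M HM.
      destruct (has_deriv_MVT T (fun s => ug M s n) (fun s => rhs N d (ug M s) n) s t) as [y [Hy ->]].
      - intros r Hr. apply (Hsol M M); [lia|lia|exact Hr].
      - destruct Hs; lra.
      - exact Ht.
      - rewrite Rabs_mult. apply Rmult_le_compat_r; [apply Rabs_pos|].
        apply rhs_bound; [exact HDn|split; [apply Hdge|lra]|].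
        intros k. apply HugB; [lia|]. apply (Ico0_le T y t Ht). destruct Hs; lra. }
    intros s t Hs Ht. destruct (Rle_lt_dec s t) as [Hle|Hlt].
    - apply Hmono; assumption.
    - rewrite <- (Rabs_Ropp (x t n - x s n)), <- (Rabs_Ropp (t - s)), !Ropp_minus_distr.
      apply Hmono; [assumption|assumption|lra]. }
  assert (Hrcont : forall n t, Ico0 T t -> forall eps, 0 < eps ->
    exists dl, 0 < dl /\ forall s, Ico0 T s -> Rabs (s - t) < dl ->
      Rabs (rhs N d (x s) n - rhs N d (x t) n) <= eps).
  { intros n t Ht eps Heps. destruct (HD n) as [D [HD0 HDn]].
    assert (HQ : exists Q, 0 <= Q /\ forall k, (k <= S n)%nat -> forall s, Ico0 T s ->
              Rabs (x s k - x t k) <= Q * Rabs (s - t)).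
    { generalize (S n). clear HDn. intros m. induction m as [|m [Q [HQ IH]]].
      - destruct (Hxlip 0%nat) as [Q [HQ HQl]]. exists Q. split; [exact HQ|].
        intros k Hk s Hs. replace k with 0%nat by lia. apply HQl; assumption.
      - destruct (Hxlip (S m)) as [Q' [HQ' HQl]]. exists (Q + Q'). split; [lra|].
        intros k Hk s Hs. assert (Hab := Rabs_pos (s - t)).
        destruct (Nat.eq_dec k (S m)) as [->|Hne].
        + specialize (HQl t s Ht Hs). nra.
        + specialize (IH k ltac:(lia) s Hs). nra. }
    destruct HQ as [Q [HQ HQk]].
    set (L := (4 * (D * B) + d n) * Q).
    assert (HL : 0 <= L).
    { unfold L. apply Rmult_le_pos; [|exact HQ]. specialize (Hdge n).
      assert (0 <= D * B) by (apply Rmult_le_pos; lra). lra. }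
    exists (eps / (L + 1)). split; [apply Rdiv_lt_0_compat; lra|].
    intros s Hs Hst.
    apply Rle_trans with ((4 * (D * B) + d n) * (Q * Rabs (s - t))).
    - apply rhs_lipschitz; [exact HDn|split; [apply Hdge|lra]|intros; apply HxB, Hs|intros; apply HxB, Ht|].
      intros k Hk. apply HQk; assumption.
    - rewrite <- Rmult_assoc. fold L.
      apply (Rmult_lt_compat_r (L + 1)) in Hst; [|lra].
      replace (eps / (L + 1) * (L + 1)) with eps in Hst by (field; lra).
      assert (Hab := Rabs_pos (s - t)). nra. }
  assert (Hderiv : forall n t, Ico0 T t -> has_deriv T (fun s => x s n) t (rhs N d (x t) n)).
  { intros n t Ht.
    apply (has_deriv_uniform_limit T (fun k s => ug k s n) (fun k s => rhs N d (ug k s) n)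
             (fun s => x s n) (fun s => rhs N d (x s) n)).
    - exact Ht.
    - exists n. intros k s Hk Hs. apply (Hsol k k); [lia|exact Hk|exact Hs].
    - intros s Hs. apply Hxlim, Hs.
    - intros t1 eps Ht1 Heps. destruct (HD n) as [D [HD0 HDn]].
      set (L := (4 * (D * B) + d n) * A t1).
      assert (Hlim : is_lim_seq (fun M => L * / N M) 0).
      { replace (Finite 0) with (Rbar_mult L 0) by (simpl; f_equal; ring).
        apply is_lim_seq_scal_l, inv_freq_lim; assumption. }
      apply is_lim_seq_Reals in Hlim. destruct (Hlim eps Heps) as [k0 Hk0].
      exists (max k0 (max M0 (S n))). intros k s Hk Hs.
      assert (HIs := Ico0_le T s t1 Ht1 Hs).
      specialize (Hk0 k ltac:(lia)). unfold Rdist in Hk0. rewrite Rminus_0_r in Hk0.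
      apply Rle_trans with ((4 * (D * B) + d n) * (A t1 * / N k)).
      + apply rhs_lipschitz; [exact HDn|split; [apply Hdge|lra]| | |].
        * intros m. apply HugB; [lia|exact HIs].
        * intros m. apply HxB, HIs.
        * intros m Hm. rewrite <- Rabs_Ropp, Ropp_minus_distr.
          eapply Rle_trans; [apply (Hxlim s m HIs); lia|].
          apply Rmult_le_compat_r; [left; apply Rinv_0_lt_compat, HNpos|apply HA; lra].
      + rewrite <- Rmult_assoc. fold L. left. eapply Rle_lt_trans; [apply Rle_abs|exact Hk0].
    - apply Hrcont, Ht. }
  exists x. split; [|split].
  - split.
    + intros t Ht. destruct (rapidly_decaying_Hs N0 b 0 U HN0 Hb (Rle_refl 0) HU) as [Kn HKn].
      destruct (HKn (x t)) as [Hex _]; [intros n; apply HxU, Ht|].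
      unfold in_Hs in Hex. unfold in_l2.
      apply (ex_series_ext (fun n => Rpower (freq N0 b n) (2 * 0) * x t n ^ 2)); [|exact Hex].
      intros n. rewrite Rmult_0_r, Rpower_O by apply freq_pos. apply Rmult_1_l.
    + intros n. exists (fun t => rhs N d (x t) n). intros t Ht. split; [|split].
      * exact (Hderiv n t Ht).
      * intros eps Heps. destruct (Hrcont n t Ht (eps / 2)) as [dl [Hdl Hc1]]; [lra|].
        exists dl. split; [exact Hdl|]. intros s [[Hs _] Hst].
        eapply Rle_lt_trans; [apply (Hc1 s Hs Hst)|]. lra.
      * unfold rhs, d, dissip. ring.
    + intros H0 n.
      assert (Hl := proj1 (Hxlim 0 n H0)).
      apply (is_lim_seq_unique) in Hl.
      assert (Hl2 : is_lim_seq (fun M => ug M 0 n) (h n)).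
      { apply (is_lim_seq_ext_loc (fun _ => h n)); [|apply is_lim_seq_const].
        exists n. intros M HM. symmetry. apply (gal_init _ _ _ _ _ (Hug M)), HM. }
      apply is_lim_seq_unique in Hl2. rewrite Hl in Hl2. injection Hl2. auto.
  - intros t Ht n. apply HxU, Ht.
  - intros t0 t1 H01 HI s Hs.
    destruct (rapidly_decaying_Hs N0 b s U HN0 Hb ltac:(lra) HU) as [Kn HKn].
    exists Kn. intros t Ht. apply HKn. intros n. apply HxU, HI, Ht.
Qed.

(** * Uniqueness, blow-up and local existence *)

Lemma finite_energy_solution_has_deriv (N : nat -> R) (nu alpha : R) (h : nat -> R) (T : Rbar) (u : R -> nat -> R) :
  finite_energy_solution N nu alpha h (Ico0 T) u ->
  forall M, solves_upto N (dissip N nu alpha) T M u.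
Proof.
  intros Hu M n t _ Ht. destruct (fes_eq _ _ _ _ _ _ Hu n) as [du Hdu].
  destruct (Hdu t Ht) as [HD [_ He]].
  apply (has_deriv_eq _ _ _ (du t)); [unfold rhs, dissip; lra|]. exact HD.
Qed.

Lemma series_ge_term (a : nat -> R) (n : nat) :
  (forall k, 0 <= a k) -> ex_series a -> sum_f_R0 a n <= Series a.
Proof.
  intros Ha [l Hl]. rewrite (is_series_unique _ _ Hl), <- sum_n_Reals.
  apply (is_lim_seq_incr_compare (sum_n a) l Hl).
  intros m. rewrite sum_Sn. unfold plus; simpl. specialize (Ha (S m)). lra.
Qed.

Lemma smooth_uniform_bound (N0 b : R) (I : R -> Prop) (u : R -> nat -> R) (t0 t1 s : R) :
  smooth_on (freq N0 b) I u -> nonneg_on I u ->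
  t0 <= t1 -> (forall t, t0 <= t <= t1 -> I t) -> 0 < s ->
  exists K, 0 <= K /\ forall t n, t0 <= t <= t1 -> u t n * Rpower (freq N0 b n) s <= K.
Proof.
  intros Hsm Hnn H01 HI Hs. destruct (Hsm t0 t1 H01 HI s Hs) as [K HK].
  exists (Rabs K). split; [apply Rabs_pos|]. intros t n Ht.
  destruct (HK t Ht) as [Hin Hnorm]. unfold in_Hs, Hs_norm in *.
  set (a := fun n => Rpower (freq N0 b n) (2 * s) * u t n ^ 2) in *.
  assert (Ha : forall k, 0 <= a k)
    by (intros k; apply Rmult_le_pos; [left; apply exp_pos|apply pow2_ge_0]).
  assert (HS : a n <= Series a).
  { eapply Rle_trans; [|apply (series_ge_term a n Ha Hin)].
    apply (sum_ge_term a n n); [intros; apply Ha|lia]. }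
  assert (Hz : 0 <= u t n * Rpower (freq N0 b n) s)
    by (apply Rmult_le_pos; [apply (Hnn t (HI t Ht))|left; apply exp_pos]).
  eapply Rle_trans; [|apply Rle_abs]. eapply Rle_trans; [|exact Hnorm].
  rewrite <- (sqrt_pow2 _ Hz). apply sqrt_le_1_alt.
  eapply Rle_trans; [|exact HS]. unfold a.
  replace (2 * s) with (s + s) by ring. rewrite Rpower_plus. right. ring.
Qed.

(** No decay in [n] is available here, yet the energy inequality holds at every level: for a
    non-negative solution the flux out of the last mode has a sign. *)
Lemma finite_energy_solution_bounded (N0 b nu alpha : R) (h : nat -> R) (T : Rbar) (v : R -> nat -> R) :
  0 < nu -> finite_energy_solution (freq N0 b) nu alpha h (Ico0 T) v -> nonneg_on (Ico0 T) v ->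
  exists B, forall t n, Ico0 T t -> 0 <= v t n <= B.
Proof.
  intros Hnu Hv Hnn. set (N := freq N0 b) in *.
  assert (Hd : forall n, 0 <= dissip N nu alpha n)
    by (intros n; apply Rmult_le_pos; [lra|left; apply exp_pos]).
  exists (1 + Series (fun n => v 0 n ^ 2)). intros t n Ht.
  assert (H0 : Ico0 T 0) by (apply (Ico0_le T 0 t Ht); destruct Ht; lra).
  assert (Hl2 := fes_l2 _ _ _ _ _ _ Hv 0 H0).
  assert (HE := energy_bound N (dissip N nu alpha) T n v t
    (fun k => Rlt_le _ _ (freq_pos N0 b k)) Hd (finite_energy_solution_has_deriv _ _ _ _ _ _ Hv n)
    (fun s k Hs => Hnn s Hs k) Ht).
  assert (Hser := series_ge_term (fun n => v 0 n ^ 2) n (fun k => pow2_ge_0 _) Hl2).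
  assert (Hterm : v t n ^ 2 <= sum_f_R0 (fun n => v t n ^ 2) n)
    by (apply (sum_ge_term (fun n => v t n ^ 2)); [intros; apply pow2_ge_0|lia]).
  set (E := Series (fun n => v 0 n ^ 2)) in *.
  assert (HE0 : 0 <= E) by (assert (0 <= v t n ^ 2) by apply pow2_ge_0; lra).
  split; [apply Hnn, Ht|].
  destruct (Rle_lt_dec (v t n) (1 + E)); [assumption|exfalso]. nra.
Qed.

(** The stability estimate is asymmetric: only [u] is multiplied by [N]. Smoothness of [u] kills the
    flux term as [M] grows, while [v] contributes just its energy bound. *)
Lemma weak_strong_uniqueness (N0 b nu alpha : R) (h : nat -> R) (T : Rbar) (u v : R -> nat -> R) :
  1 < N0 -> 1 < b -> 0 < nu ->
  nonneg_smooth_solution (freq N0 b) nu alpha h (Ico0 T) u ->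
  finite_energy_solution (freq N0 b) nu alpha h (Ico0 T) v -> nonneg_on (Ico0 T) v ->
  forall t, Ico0 T t -> forall n, v t n = u t n.
Proof.
  intros HN0 Hb Hnu [Hu [Hunn Husm]] Hv Hvnn t Ht n.
  set (N := freq N0 b) in *.
  assert (HNpos : forall n, 0 < N n) by (intros; apply freq_pos).
  destruct (finite_energy_solution_bounded N0 b nu alpha h T u Hnu Hu Hunn) as [Bu HBu].
  destruct (finite_energy_solution_bounded N0 b nu alpha h T v Hnu Hv Hvnn) as [Bv HBv].
  set (B := Rmax Bu Bv).
  assert (HBB : Bu <= B /\ Bv <= B) by (split; [apply Rmax_l|apply Rmax_r]).
  assert (HB : 0 <= B) by (specialize (HBu t n Ht); lra).
  assert (Ht0 : 0 <= t) by apply Ht.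
  assert (HI : forall s, 0 <= s <= t -> Ico0 T s) by (intros s Hs; apply (Ico0_le T s t Ht Hs)).
  (* The exponent [2] leaves [N_m u_m <= K / N_m], which serves both as the Lipschitz constant and
     as the vanishing flux. *)
  destruct (smooth_uniform_bound N0 b (Ico0 T) u 0 t 2 Husm Hunn Ht0 HI) as [K [HK HKu]]; [lra|].
  fold N in HKu.
  assert (HK2 : forall s m, 0 <= s <= t -> N m * u s m <= K * / N m).
  { intros s m Hs. specialize (HKu s m Hs). specialize (HNpos m).
    replace 2 with (INR 2) in HKu by (simpl; ring). rewrite Rpower_pow in HKu by exact HNpos.
    replace (N m * u s m) with (u s m * N m ^ 2 * / N m) by (field; lra).
    apply Rmult_le_compat_r; [left; apply Rinv_0_lt_compat|]; assumption. }
  assert (Hinv1 : forall m, / N m <= 1).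
  { intros m. rewrite <- Rinv_1. apply Rinv_le_contravar; [lra|apply freq_ge_1; assumption]. }
  set (c := 2 * K * (B * B) * t * exp (2 * K * t)).
  assert (HM : forall M, (n <= M)%nat -> (v t n - u t n) ^ 2 <= c * / N M).
  { intros M HnM.
    assert (HNi : 0 < / N M) by (apply Rinv_0_lt_compat, HNpos).
    set (e := 2 * (K * / N M) * (B * B)).
    assert (He : 0 <= e) by (unfold e; repeat apply Rmult_le_pos; lra).
    assert (Hdiff : sum_f_R0 (fun n => (v t n - u t n) ^ 2) M <= e * t * exp (2 * K * t)).
    { apply (difference_bound N (dissip N nu alpha) T).
      - intros m. left. apply HNpos.
      - intros m. apply Rmult_le_pos; [lra|left; apply exp_pos].
      - exact HK.
      - exact He.
      - apply (finite_energy_solution_has_deriv _ _ _ _ _ _ Hu).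
      - apply (finite_energy_solution_has_deriv _ _ _ _ _ _ Hv).
      - exact Ht.
      - intros s m Hs. apply Hunn, Hs.
      - intros s m Hs. apply Hvnn, Hs.
      - intros m _. assert (H0 : Ico0 T 0) by (apply HI; lra).
        rewrite (fes_init _ _ _ _ _ _ Hu H0), (fes_init _ _ _ _ _ _ Hv H0). reflexivity.
      - intros s m Hs _. specialize (HK2 s m Hs). specialize (Hinv1 m). specialize (HNpos m).
        assert (0 < / N m) by (apply Rinv_0_lt_compat, HNpos). nra.
      - intros s Hs.
        assert (Hw : forall m, Rabs (v s m - u s m) <= B).
        { intros m. assert (E1 := HBu s m (HI s Hs)). assert (E2 := HBv s m (HI s Hs)).
          apply Rabs_le. lra. }
        replace (2 * N M * u s M * Rabs (v s M - u s M) * Rabs (v s (S M) - u s (S M)))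
          with (2 * (N M * u s M) * (Rabs (v s M - u s M) * Rabs (v s (S M) - u s (S M)))) by ring.
        assert (0 <= N M * u s M) by (apply Rmult_le_pos; [left; apply HNpos|apply Hunn, HI, Hs]).
        specialize (HK2 s M Hs).
        apply Rmult_le_compat; [lra|apply Rmult_le_pos; apply Rabs_pos|lra|].
        apply Rmult_le_compat; [apply Rabs_pos|apply Rabs_pos|apply Hw|apply Hw]. }
    eapply Rle_trans; [apply (sum_ge_term (fun n => (v t n - u t n) ^ 2) M n)|];
      [intros; apply pow2_ge_0|exact HnM|].
    eapply Rle_trans; [exact Hdiff|]. unfold e, c. right. ring. }
  assert (Hlim : is_lim_seq (fun M => c * / N M) 0).
  { replace (Finite 0) with (Rbar_mult c 0) by (simpl; f_equal; ring).
    apply is_lim_seq_scal_l, inv_freq_lim; assumption. }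
  assert (H2 : Rbar_le ((v t n - u t n) ^ 2) 0).
  { refine (is_lim_seq_le_loc _ _ _ _ _ (is_lim_seq_const _) Hlim). exists n. exact HM. }
  simpl in H2. nra.
Qed.

Lemma weighted_sum_bounded (N0 b s : R) : 1 < N0 -> 1 < b -> 0 < s ->
  exists S, 0 < S /\ forall M, sum_f_R0 (fun n => 2 ^ n * Rpower (freq N0 b n) (- s)) M <= S.
Proof.
  (* With base [4] each term is at most [C 2^(-n)]. *)
  intros HN0 Hb Hs. destruct (geometric_le_Rpower_freq N0 b 4 s HN0 Hb) as [C [HC H]]; [lra|exact Hs|].
  exists (2 * C). split; [lra|]. intros M.
  assert (Hle : sum_f_R0 (fun n => 2 ^ n * Rpower (freq N0 b n) (- s)) M
                <= C * sum_f_R0 (fun n => (/ 2) ^ n) M).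
  { rewrite scal_sum. apply sum_Rle. intros n _. specialize (H n).
    rewrite Rpower_Ropp. set (P := Rpower (freq N0 b n) s) in *.
    assert (HP : 0 < P) by apply exp_pos.
    replace 4 with (2 * 2) in H by ring. rewrite Rpow_mult_distr in H. rewrite pow_inv.
    assert (H2 : 0 < 2 ^ n) by (apply pow_lt; lra).
    apply (Rmult_le_reg_r P); [exact HP|]. apply (Rmult_le_reg_r (2 ^ n)); [exact H2|].
    replace (2 ^ n * / P * P * 2 ^ n) with (2 ^ n * 2 ^ n) by (field; lra).
    replace (/ 2 ^ n * C * P * 2 ^ n) with (C * P) by (field; lra). exact H. }
  assert (Hg : sum_f_R0 (fun n => (/ 2) ^ n) M <= 2).
  { rewrite tech3 by lra. assert (0 < (/ 2) ^ S M) by (apply pow_lt; lra).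
    apply Rle_trans with (1 / (1 - / 2)); [|right; field].
    unfold Rdiv. apply Rmult_le_compat_r; [|lra]. left. apply Rinv_0_lt_compat. lra. }
  nra.
Qed.

Section CriticalScaling.
Variables (N0 b : R).
Hypothesis hb : 1 < b.
Let N := freq N0 b.

Definition crit_weight (n : nat) : R := Rpower (freq N0 b n) (1 / (b + 2)).
Let e := crit_weight.

Lemma crit_weight_pos (n : nat) : 0 < crit_weight n.
Proof. apply exp_pos. Qed.

(** This identity characterises the critical weight: in the variables [e_n u_n] both quadratic terms
    of mode [n] carry the same rate [e_n^2]. *)
Lemma freq_crit_weight (n : nat) : freq N0 b n = crit_weight n ^ 2 * crit_weight (S n).
Proof.
  unfold crit_weight. rewrite !Rpower_freq, freq_exp. simpl pow. rewrite Rmult_1_r, <- !exp_plus.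
  f_equal. field. lra.
Qed.

Lemma crit_weight_pow (n k : nat) : (/ crit_weight n) ^ k = Rpower (freq N0 b n) (- (INR k / (b + 2))).
Proof.
  rewrite pow_inv, Rpower_Ropp. f_equal. unfold crit_weight.
  rewrite <- Rpower_pow by apply exp_pos. rewrite Rpower_mult. f_equal. field. lra.
Qed.

Definition blowup_functional (u : nat -> R) (M : nat) : R :=
  sum_f_R0 (fun n => 2 ^ n * / crit_weight n * u n) M.

(** With [p_n = e_n u_n], the transfer out of mode [n] adds [2 * 2^n p_n^2] and removes
    [2^n p_n p_(n+1)]. Since [p p' <= p^2 / 2 + p'^2], the loss is absorbed with [sum 2^n p_n^2] to
    spare. The boundary terms account for the gain of mode [M + 1], which lies outside the sum. *)
Lemma blowup_functional_production (d u : nat -> R) (M : nat) :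
  sum_f_R0 (fun n => 2 ^ n * (e n * u n) ^ 2) M
  - 3 / 2 * 2 ^ M * (e M * u M) ^ 2 - 2 ^ M * (e M * u M) * (e (S M) * u (S M))
  <= sum_f_R0 (fun n => 2 ^ n * / e n * rhs N d u n) M
     + sum_f_R0 (fun n => 2 ^ n * / e n * (d n * u n)) M.
Proof.
  assert (Hout : forall n, 2 ^ n * / e n * (N n * u n * u (S n)) = 2 ^ n * (e n * u n) * (e (S n) * u (S n))).
  { intros n. unfold N. rewrite freq_crit_weight. fold e. field. apply Rgt_not_eq, crit_weight_pos. }
  assert (Hin : forall n, 2 ^ S n * / e (S n) * (N n * u n ^ 2) = 2 * (2 ^ n * (e n * u n) ^ 2)).
  { intros n. unfold N. rewrite freq_crit_weight. fold e. simpl (2 ^ S n). field. apply Rgt_not_eq, crit_weight_pos. }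
  induction M as [|M IH].
  - unfold sum_f_R0, rhs, incoming. specialize (Hout 0%nat).
    assert (0 <= (e 0%nat * u 0%nat) ^ 2) by apply pow2_ge_0. simpl (2 ^ 0) in *. nra.
  - rewrite !tech5. unfold rhs at 2. unfold incoming.
    specialize (Hin M). assert (HoM := Hout (S M)).
    assert (H2 : 0 < 2 ^ M) by (apply pow_lt; lra).
    set (p := e M * u M) in *. set (p' := e (S M) * u (S M)) in *.
    assert (Hq : 0 <= 2 ^ M * (/ 2 * p ^ 2 - p * p' + p' ^ 2)).
    { apply Rmult_le_pos; [lra|]. assert (0 <= (p - p') ^ 2) by apply pow2_ge_0.
      assert (0 <= p' ^ 2) by apply pow2_ge_0. lra. }
    rewrite <- (tech_pow_Rmult 2 M) in *. lra.
Qed.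

(** Half of the production [P] absorbs the damping by Young's inequality, written as
    [(e u) (e^(-2) d)]; the other half dominates [L^2] by Cauchy-Schwarz with weights
    [2^n e_n^(-4)]. *)
Lemma blowup_functional_growth (d u : nat -> R) (M : nat) (S0 C0 : R) :
  0 < S0 ->
  sum_f_R0 (fun n => 2 ^ n * (/ e n) ^ 4) M <= S0 ->
  sum_f_R0 (fun n => 2 ^ n * (/ e n) ^ 4 * d n ^ 2) M <= C0 ->
  blowup_functional u M ^ 2 / (2 * S0) - C0
  - 3 / 2 * 2 ^ M * (e M * u M) ^ 2 - 2 ^ M * (e M * u M) * (e (S M) * u (S M))
  <= sum_f_R0 (fun n => 2 ^ n * / e n * rhs N d u n) M.
Proof.
  intros HS0 HS HC. assert (HP := blowup_functional_production d u M).
  set (P := sum_f_R0 (fun n => 2 ^ n * (e n * u n) ^ 2) M) in *.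
  assert (H2 : forall n, 0 < 2 ^ n) by (intros; apply pow_lt; lra).
  assert (Hdis : sum_f_R0 (fun n => 2 ^ n * / e n * (d n * u n)) M <= / 2 * P + / 2 * C0).
  { apply Rle_trans with (/ 2 * P + / 2 * sum_f_R0 (fun n => 2 ^ n * (/ e n) ^ 4 * d n ^ 2) M); [|lra].
    unfold P. rewrite !scal_sum, <- sum_plus. apply sum_Rle. intros n _.
    assert (He := crit_weight_pos n). fold (e n) in He.
    assert (0 <= 2 ^ n * (e n * u n - (/ e n) ^ 2 * d n) ^ 2)
      by (apply Rmult_le_pos; [left; apply H2|apply pow2_ge_0]).
    replace (2 ^ n * / e n * (d n * u n)) with (2 ^ n * (e n * u n) * ((/ e n) ^ 2 * d n)) by (field; lra).
    nra. }
  assert (HL : blowup_functional u M ^ 2 / S0 <= P).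
  (* Cauchy-Schwarz by termwise squares: [mu = L / S0] maximises [2 mu L - mu^2 S0], with value
     [L^2 / S0]. *)
  { set (L := blowup_functional u M). set (mu := L / S0).
    assert (HLm : 2 * mu * L - mu ^ 2 * sum_f_R0 (fun n => 2 ^ n * (/ e n) ^ 4) M <= P).
    { unfold L, P, blowup_functional. fold e.
      rewrite !scal_sum, <- minus_sum. apply sum_Rle. intros n _.
      assert (He := crit_weight_pos n). fold (e n) in He.
      assert (0 <= 2 ^ n * (e n * u n - mu * (/ e n) ^ 2) ^ 2)
        by (apply Rmult_le_pos; [left; apply H2|apply pow2_ge_0]).
      replace (2 ^ n * / e n * u n) with (2 ^ n * (e n * u n) * (/ e n) ^ 2) by (field; lra).
      nra. }
    assert (Hmu : mu ^ 2 * sum_f_R0 (fun n => 2 ^ n * (/ e n) ^ 4) M <= mu ^ 2 * S0)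
      by (apply Rmult_le_compat_l; [apply pow2_ge_0|exact HS]).
    replace (L ^ 2 / S0) with (2 * mu * L - mu ^ 2 * S0) by (unfold mu; field; lra). lra. }
  replace (blowup_functional u M ^ 2 / (2 * S0)) with (/ 2 * (blowup_functional u M ^ 2 / S0)) by (field; lra).
  assert (HC0 : 0 <= C0).
  { eapply Rle_trans; [|exact HC]. apply sum_nonneg. intros n _.
    apply Rmult_le_pos; [|apply pow2_ge_0]. apply Rmult_le_pos; [left; apply H2|].
    apply pow_le. left. apply Rinv_0_lt_compat, crit_weight_pos. }
  lra.
Qed.
End CriticalScaling.

Lemma has_deriv_comp (T : Rbar) (f k : R -> R) (t a c : R) :
  has_deriv T f t a -> derivable_pt_lim k (f t) c -> has_deriv T (fun s => k (f s)) t (a * c).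
Proof.
  intros Hf Hk.
  assert (H := Dcomp (Ico0 T) no_cond (fun _ => a) (fun _ => c) f k t Hf
    (proj2 (derivable_pt_lim_D_in k (fun _ => c) (f t)) Hk)).
  apply (limit1_imp _ (D_x (Dgf (Ico0 T) no_cond f) t)); [|exact H].
  intros x [Hx Hne]. split; [split; [exact Hx|exact I]|exact Hne].
Qed.

Lemma sum_single_mode (c : R) (M : nat) :
  sum_f_R0 (fun n => match n with O => c | S _ => 0 end) M = c.
Proof. induction M as [|M IH]; simpl; [reflexivity|]. rewrite IH. ring. Qed.

(** The threshold [8 C < k L(0)^2] keeps [L] above [L(0) / 2], where [C <= k / 2 * L^2]. Then
    [L' >= k / 2 * L^2], so [1 / L + k t / 2] is nonincreasing, which is impossible past
    [t = 2 / (k L(0))]. *)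
Lemma riccati_blowup (T k C : R) (L L' : R -> R) :
  0 < k -> 0 < L 0 -> 0 <= C -> 8 * C < k * L 0 ^ 2 ->
  (forall s, Ico0 T s -> has_deriv T L s (L' s)) ->
  (forall s, Ico0 T s -> k * L s ^ 2 - C <= L' s) ->
  T <= 2 / (k * L 0).
Proof.
  intros Hk HL0 HC HCk HD HL.
  assert (HkL : 0 < k * L 0) by (apply Rmult_lt_0_compat; assumption).
  assert (Hpos : forall s, Ico0 T s -> 0 < L s - L 0 / 2).
  { intros s Hs.
    apply (strict_invariance T (fun _ s => L s - L 0 / 2) (fun _ s => L' s - 0) 0) with (i := 0%nat);
      [| | |exact Hs|lia].
    - intros _ r _ Hr. apply (has_deriv_minus _ L (fun _ => L 0 / 2)); [apply HD, Hr|apply has_deriv_const].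
    - intros _ _. lra.
    - intros r Hr _ _ _ E. specialize (HL r Hr). replace (L r) with (L 0 / 2) in HL by lra. nra. }
  apply Rnot_lt_le. intros Hlt. set (t := 2 / (k * L 0)) in *.
  assert (Ht : 0 < t) by (apply Rdiv_lt_0_compat; lra).
  assert (HIt : Ico0 T t) by (split; simpl; lra).
  assert (Hm : / L t + k / 2 * t <= / L 0 + k / 2 * 0).
  { apply (has_deriv_nonincreasing T (fun s => / L s + k / 2 * s)
      (fun s => L' s * (- / (L s) ^ 2) + k / 2 * 1) 0 t); [|lra|exact HIt|].
    - intros s Hs. specialize (Hpos s Hs).
      apply (has_deriv_plus T (fun s => / L s) (fun s => k / 2 * s)).
      + apply (has_deriv_comp T L Rinv); [apply HD, Hs|].
        apply is_derive_Reals. auto_derive; [lra|]. field. lra.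
      + apply (has_deriv_scal T (fun s => s)), has_deriv_id.
    - intros s Hs. assert (HIs := Ico0_le T s t HIt Hs).
      specialize (Hpos s HIs). specialize (HL s HIs).
      assert (HL2 : 0 < L s ^ 2) by (apply pow_lt; lra).
      assert (H0 : (L 0 / 2) ^ 2 <= L s ^ 2) by (apply pow_incr; lra).
      assert (H1 : k / 2 * L s ^ 2 <= L' s).
      { apply (Rmult_le_compat_l k) in H0; [|lra]. lra. }
      assert (H2 : k / 2 <= L' s * / L s ^ 2).
      { apply (Rmult_le_reg_r (L s ^ 2)); [exact HL2|].
        rewrite Rmult_assoc, Rinv_l by lra. lra. }
      lra. }
  assert (0 < / L t) by (apply Rinv_0_lt_compat; specialize (Hpos t HIt); lra).
  assert (k / 2 * t = / L 0) by (unfold t; field; lra). lra.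
Qed.

(** The bound [Tstar] does not involve the solution, hence it limits every smooth existence time of
    this datum. Putting all mass in mode [0] makes the initial functional equal to [L0] for every
    truncation level. *)
Lemma single_mode_blowup (N0 b nu alpha : R) :
  1 < N0 -> 1 < b -> 0 <= alpha < 1 / (b + 2) ->
  exists X Tstar, 0 < X /\ forall T : R, 0 < T ->
    (exists u, nonneg_smooth_solution (freq N0 b) nu alpha
       (fun n => match n with O => X | S _ => 0 end) (Ico0 T) u) ->
    T <= Tstar.
Proof.
  intros HN0 Hb Ha. set (N := freq N0 b). set (d := dissip N nu alpha).
  set (e := crit_weight N0 b).
  assert (Hb2 : 0 < b + 2) by lra.
  assert (Hg : 0 < 1 / (b + 2)) by (apply Rdiv_lt_0_compat; lra).
  assert (Hepos : forall n, 0 < e n) by (intros; apply crit_weight_pos).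
  destruct (weighted_sum_bounded N0 b (4 / (b + 2)) HN0 Hb) as [S0 [HS0 HS]];
    [apply Rdiv_lt_0_compat; lra|].
  (* Here [alpha < 1 / (b + 2)] enters: [e_n^(-4) d_n^2 = nu^2 N_n^(4 alpha - 4 / (b + 2))] must be
     summable against [2^n]. *)
  destruct (weighted_sum_bounded N0 b (4 / (b + 2) - 4 * alpha) HN0 Hb) as [S1 [HS1 HS']].
  { replace (4 / (b + 2)) with (4 * (1 / (b + 2))) by (field; lra). lra. }
  assert (Hsum0 : forall M, sum_f_R0 (fun n => 2 ^ n * (/ e n) ^ 4) M <= S0).
  { intros M. eapply Rle_trans; [|apply (HS M)]. right. apply sum_eq. intros n _.
    unfold e. rewrite crit_weight_pow by lra. do 2 f_equal. simpl. field. lra. }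
  set (C0 := nu ^ 2 * S1).
  assert (Hsum1 : forall M, sum_f_R0 (fun n => 2 ^ n * (/ e n) ^ 4 * d n ^ 2) M <= C0).
  { intros M. unfold C0. eapply Rle_trans; [|apply Rmult_le_compat_l; [apply pow2_ge_0|apply (HS' M)]].
    right. rewrite scal_sum. apply sum_eq. intros n _.
    unfold e. rewrite crit_weight_pow by lra. unfold d, dissip, N.
    replace (- (4 / (b + 2) - 4 * alpha)) with (- (INR 4 / (b + 2)) + (2 * alpha + 2 * alpha)) by (simpl; field; lra).
    rewrite !Rpower_plus. ring. }
  set (C := C0 + 1).
  assert (HC : 0 < C) by (unfold C, C0; assert (0 <= nu ^ 2 * S1) by (apply Rmult_le_pos; [apply pow2_ge_0|lra]); lra).
  set (k := / (2 * S0)).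
  assert (Hk : 0 < k) by (apply Rinv_0_lt_compat; lra).
  set (L0 := 1 + 8 * C / k).
  assert (HCk : 0 < 8 * C / k) by (apply Rdiv_lt_0_compat; lra).
  assert (HL0 : 8 * C < k * L0 ^ 2).
  { assert (k * (8 * C / k) = 8 * C) by (field; lra). unfold L0. nra. }
  exists (L0 * e 0%nat), (2 / (k * L0)). split; [apply Rmult_lt_0_compat; [unfold L0; lra|apply Hepos]|].
  intros T HT [u [Hu [Hnn Hsm]]].
  apply Rnot_lt_le. intros Hlt.
  (* A time past the Riccati deadline but strictly before [T], so that smoothness is uniform on the
     compact interval [[0, t]]. *)
  set (t := (2 / (k * L0) + T) / 2).
  assert (HkL : 0 < k * L0) by (apply Rmult_lt_0_compat; unfold L0; lra).
  assert (H2k : 0 < 2 / (k * L0)) by (apply Rdiv_lt_0_compat; lra).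
  assert (Ht : 2 / (k * L0) < t < T) by (unfold t; lra).
  assert (HI : forall s, 0 <= s <= t -> Ico0 T s) by (intros s Hs; split; simpl; lra).
  (* The part [1 / (b + 2)] produces [e_n u_n]; of the two further powers of [N_n], one beats [2^n]
     and one makes the boundary terms vanish. *)
  destruct (smooth_uniform_bound N0 b (Ico0 T) u 0 t (2 + 1 / (b + 2)) Hsm Hnn) as [K [HK HKu]];
    [lra|exact HI|lra|].
  assert (Hp : forall s n, 0 <= s <= t -> 0 <= e n * u s n /\ e n * u s n * N n ^ 2 <= K).
  { intros s n Hs. split; [apply Rmult_le_pos; [left; apply Hepos|apply Hnn, HI, Hs]|].
    specialize (HKu s n Hs). rewrite Rpower_plus in HKu.
    replace 2 with (INR 2) in HKu at 1 by (simpl; ring). rewrite Rpower_pow in HKu by apply freq_pos.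
    fold N in HKu. unfold e, crit_weight. fold N. lra. }
  destruct (inv_freq_le_geometric N0 b HN0 Hb) as [Cg [HCg HNg]]. fold N in HNg.
  assert (Hlim : is_lim_seq (fun n => 5 / 2 * Cg * K ^ 2 * / N n) 0).
  { replace (Finite 0) with (Rbar_mult (5 / 2 * Cg * K ^ 2) 0) by (simpl; f_equal; ring).
    apply is_lim_seq_scal_l, inv_freq_lim; assumption. }
  (* One level [M], valid on all of [[0, t]], at which the boundary terms, with coefficients [3 / 2]
     and [1], total at most [1]; this is the [1] added to [C0] in [C]. *)
  apply is_lim_seq_Reals in Hlim. destruct (Hlim 1 Rlt_0_1) as [M HM].
  specialize (HM M (le_n M)). unfold Rdist in HM. rewrite Rminus_0_r in HM.
  apply Rabs_def2 in HM.
  assert (Htail : forall s, 0 <= s <= t ->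
    3 / 2 * 2 ^ M * (e M * u s M) ^ 2 + 2 ^ M * (e M * u s M) * (e (S M) * u s (S M)) <= 1).
  { intros s Hs.
    assert (HN1 : forall n, 1 <= N n) by (intros; apply freq_ge_1; assumption).
    destruct (Hp s M Hs) as [Hp1 Hp2]. destruct (Hp s (S M) Hs) as [Hq1 Hq2].
    set (p := e M * u s M) in *. set (q := e (S M) * u s (S M)) in *.
    assert (HpK : p <= K).
    { assert (1 <= N M ^ 2) by (apply pow_R1_Rle, HN1). nra. }
    assert (HqK : q <= K).
    { assert (1 <= N (S M) ^ 2) by (apply pow_R1_Rle, HN1). nra. }
    assert (HNM := HN1 M).
    assert (H2 : 0 < 2 ^ M) by (apply pow_lt; lra).
    assert (H2N : 2 ^ M * p <= Cg * K * / N M).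
    { specialize (HNg M). rewrite pow_inv in HNg.
      assert (2 ^ M <= Cg * N M).
      { apply (Rmult_le_compat_r (N M)) in HNg; [|lra]. rewrite Rinv_l in HNg by lra.
        apply (Rmult_le_compat_r (2 ^ M)) in HNg; [|lra].
        replace (Cg * / 2 ^ M * N M * 2 ^ M) with (Cg * N M) in HNg by (field; lra). lra. }
      apply Rle_trans with (Cg * N M * p); [apply Rmult_le_compat_r; assumption|].
      replace (Cg * N M * p) with (Cg * (p * N M ^ 2) * / N M) by (field; lra).
      apply Rmult_le_compat_r; [left; apply Rinv_0_lt_compat; lra|].
      apply Rmult_le_compat_l; lra. }
    assert (H2p0 : 0 <= 2 ^ M * p) by (apply Rmult_le_pos; lra).
    assert (E1 : 2 ^ M * p * p <= Cg * K * / N M * K) by (apply Rmult_le_compat; lra).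
    assert (E2 : 2 ^ M * p * q <= Cg * K * / N M * K) by (apply Rmult_le_compat; lra).
    replace (3 / 2 * 2 ^ M * p ^ 2) with (3 / 2 * (2 ^ M * p * p)) by ring. lra. }
  assert (Hinit : blowup_functional N0 b (u 0) M = L0).
  { assert (H0 : Ico0 T 0) by (apply HI; lra). unfold blowup_functional. fold e.
    rewrite (sum_eq _ (fun n => match n with O => L0 | S _ => 0 end)).
    - apply sum_single_mode.
    - intros n _. rewrite (fes_init _ _ _ _ _ _ Hu H0). destruct n; [|ring].
      simpl (2 ^ 0). field. apply Rgt_not_eq, Hepos. }
  assert (Hric : t <= 2 / (k * blowup_functional N0 b (u 0) M)).
  { apply (riccati_blowup t k C (fun s => blowup_functional N0 b (u s) M)
      (fun s => sum_f_R0 (fun n => 2 ^ n * / e n * rhs N d (u s) n) M)).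
    - exact Hk.
    - rewrite Hinit. unfold L0. lra.
    - lra.
    - rewrite Hinit. exact HL0.
    - intros s [Hs1 Hs2]. simpl in Hs2.
      apply (has_deriv_sum t (fun n s => 2 ^ n * / e n * u s n)). intros n _.
      apply (has_deriv_scal t (fun s => u s n)). apply (has_deriv_sub T).
      + intros r [Hr1 Hr2]. simpl in Hr2. apply HI. lra.
      + apply (finite_energy_solution_has_deriv _ _ _ _ _ _ Hu n); [lia|apply HI; lra].
    - intros s [Hs1 Hs2]. simpl in Hs2.
      eapply Rle_trans; [|apply (blowup_functional_growth N0 b Hb d (u s) M S0 C0); auto].
      specialize (Htail s ltac:(lra)). unfold k, C. fold e. unfold Rdiv in *. lra. }
  rewrite Hinit in Hric. lra.
Qed.

(** In logarithms, [2^n] times a negative constant competes with [s ln N0 b^n], and [(b / 2)^n]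
    tends to [0]. The finitely many [n] before domination are covered by the value at [n0]. *)
Lemma double_exponential_decay (N0 b th s : R) (k0 : nat) :
  1 < N0 -> 1 < b < 2 -> 0 < th < 1 -> 0 < s ->
  exists C, 0 <= C /\ forall n, (k0 <= n)%nat -> th ^ (2 ^ (n - k0)) * Rpower (freq N0 b n) s <= C.
Proof.
  intros HN0 Hb Hth Hs.
  assert (Hl : 0 < ln N0) by (rewrite <- ln_1; apply ln_increasing; lra).
  assert (Hlth : ln th < 0) by (rewrite <- ln_1; apply ln_increasing; lra).
  set (q := - ln th * (/ 2) ^ k0).
  assert (Hq : 0 < q) by (apply Rmult_lt_0_compat; [lra|apply pow_lt; lra]).
  assert (Hsl : 0 < s * ln N0) by (apply Rmult_lt_0_compat; assumption).
  assert (Hlim : is_lim_seq (fun n => (b / 2) ^ n) 0)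
    by (apply is_lim_seq_geom; rewrite Rabs_right; lra).
  apply is_lim_seq_Reals in Hlim. destruct (Hlim (q / (s * ln N0))) as [n0 Hn0].
  { apply Rdiv_lt_0_compat; assumption. }
  exists (exp (s * ln N0 * b ^ n0)). split; [left; apply exp_pos|].
  intros n Hn. rewrite Rpower_freq, <- (Rpower_pow (2 ^ (n - k0))) by lra.
  unfold Rpower. rewrite <- exp_plus. apply exp_le.
  rewrite pow_INR. replace (INR 2) with 2 by (simpl; ring).
  assert (Hpow : 2 ^ (n - k0) = 2 ^ n * (/ 2) ^ k0).
  { replace n with (n - k0 + k0)%nat at 2 by lia. rewrite pow_add, pow_inv.
    field. apply pow_nonzero. lra. }
  rewrite Hpow. replace (2 ^ n * (/ 2) ^ k0 * ln th) with (- q * 2 ^ n) by (unfold q; ring).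
  assert (H2n : 0 < 2 ^ n) by (apply pow_lt; lra).
  destruct (le_lt_dec n0 n) as [Hle|Hlt].
  - specialize (Hn0 n Hle). unfold Rdist in Hn0. rewrite Rminus_0_r in Hn0.
    apply Rabs_def2 in Hn0. destruct Hn0 as [Hn0 _].
    unfold Rdiv in Hn0 at 1. rewrite Rpow_mult_distr, pow_inv in Hn0.
    assert (b ^ n * (s * ln N0) < q * 2 ^ n).
    { apply (Rmult_lt_compat_r (2 ^ n * (s * ln N0))) in Hn0; [|apply Rmult_lt_0_compat; assumption].
      replace (b ^ n * / 2 ^ n * (2 ^ n * (s * ln N0))) with (b ^ n * (s * ln N0)) in Hn0 by (field; lra).
      replace (q / (s * ln N0) * (2 ^ n * (s * ln N0))) with (q * 2 ^ n) in Hn0 by (field; lra).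
      exact Hn0. }
    assert (0 < s * ln N0 * b ^ n0) by (apply Rmult_lt_0_compat; [assumption|apply pow_lt; lra]). lra.
  - assert (b ^ n <= b ^ n0) by (apply Rle_pow; [lra|lia]).
    assert (0 < q * 2 ^ n) by (apply Rmult_lt_0_compat; assumption).
    assert (s * ln N0 * b ^ n <= s * ln N0 * b ^ n0) by (apply Rmult_le_compat_l; lra). lra.
Qed.

(** Without outflow and damping, mode [n + 1] grows over a time [T] to at most [T N_n U_n^2] if mode
    [n] stays below [U_n]. A rapidly decaying solution of [U_(n+1) = T N_n U_n^2] with [U_0 = X] is
    therefore a majorant. *)
Lemma local_existence (N0 b nu alpha X : R) :
  1 < N0 -> 1 < b < 2 -> 0 < nu -> 0 < X ->
  exists T : R, 0 < T /\
    exists u, nonneg_smooth_solution (freq N0 b) nu alpha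
      (fun n => match n with O => X | S _ => 0 end) (Ico0 T) u.
Proof.
  intros HN0 Hb Hnu HX. set (N := freq N0 b).
  set (h := fun n : nat => match n with O => X | S _ => 0 end).
  (* Matching powers of [N_n] in the recursion for [U] requires [p b = 2 p - 1]. The factor
     [(/ 2) ^ (2 ^ n)] is reproduced by squaring, and [T] is then fixed by [U_0 = X]. *)
  set (p := 1 / (2 - b)).
  assert (Hp : p * (2 - b) = 1) by (unfold p; field; lra).
  set (T := Rpower (N 0%nat) (- p) / (2 * X)).
  assert (HT : 0 < T) by (apply Rdiv_lt_0_compat; [apply exp_pos|lra]).
  set (U := fun n => / T * Rpower (N n) (- p) * (/ 2) ^ (2 ^ n)).
  assert (HiT : 0 < / T) by (apply Rinv_0_lt_compat, HT).
  assert (HU0 : forall n, 0 <= U n).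
  { intros n. apply Rmult_le_pos; [apply Rmult_le_pos; [lra|left; apply exp_pos]|apply pow_le; lra]. }
  assert (HUinit : U 0%nat = X).
  { unfold U, T. simpl (2 ^ 0)%nat. assert (0 < Rpower (N 0%nat) (- p)) by apply exp_pos. simpl pow. field. lra. }
  assert (HUS : forall n, U (S n) = T * (N n * U n ^ 2)).
  { intros n. unfold U.
    assert (Hr : Rpower (N (S n)) (- p) = N n * (Rpower (N n) (- p)) ^ 2).
    { unfold N. rewrite !Rpower_freq, freq_exp. simpl pow. rewrite Rmult_1_r, <- !exp_plus. f_equal.
      replace (- p * (b * b ^ n * ln N0)) with (- (p * b) * (b ^ n * ln N0)) by ring.
      replace (p * b) with (2 * p - 1) by lra. ring. }
    rewrite Hr. replace (2 ^ S n)%nat with (2 ^ n + 2 ^ n)%nat by (simpl; lia).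
    rewrite pow_add. field. lra. }
  exists T. split; [exact HT|].
  apply (smooth_solution_of_galerkin_bounds N0 b nu alpha h U T 0).
  - exact HN0.
  - lra.
  - exact Hnu.
  - intros n. unfold h. destruct n; lra.
  - exact HU0.
  - intros s Hs. destruct (double_exponential_decay N0 b (/ 2) s 0 HN0 Hb) as [C [HC HCn]]; [lra|exact Hs|].
    exists (/ T * C). split; [apply Rmult_le_pos; lra|]. intros n. specialize (HCn n ltac:(lia)).
    rewrite Nat.sub_0_r in HCn. unfold U. fold N in HCn.
    assert (Hle : Rpower (N n) (- p) <= 1).
    { unfold N. rewrite Rpower_freq, <- exp_0. apply exp_le.
      assert (0 < p) by (apply Rdiv_lt_0_compat; lra).
      assert (0 <= b ^ n * ln N0).
      { apply Rmult_le_pos; [apply pow_le; lra|]. rewrite <- ln_1. left. apply ln_increasing; lra. }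
      nra. }
    assert (H0 : 0 <= (/ 2) ^ 2 ^ n * Rpower (N n) s) by (apply Rmult_le_pos; [apply pow_le; lra|left; apply exp_pos]).
    rewrite !Rmult_assoc. apply Rmult_le_compat_l; [lra|].
    eapply Rle_trans; [apply Rmult_le_compat_r; [exact H0|exact Hle]|]. rewrite Rmult_1_l. exact HCn.
  - intros M u _ Hu. fold N in Hu. set (d := dissip N nu alpha) in *.
    assert (HN : forall n, 0 <= N n) by (intros; left; apply freq_pos).
    assert (Hd : forall n, 0 <= d n) by (intros; apply Rmult_le_pos; [lra|left; apply exp_pos]).
    assert (Hsub : forall s, Ico0 T s -> Ico0 p_infty s) by (intros s Hs; apply Ico0_infty, Hs).
    intros t n; revert t. induction n as [|n IH]; intros t Ht.
    + rewrite HUinit.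
      assert (HE := energy_bound N d p_infty M u t HN Hd (gal_solves _ _ _ _ _ Hu)
        (fun s m Hs => gal_nonneg _ _ _ _ _ Hu s m (proj1 Hs)) (Hsub t Ht)).
      assert (Hsum : sum_f_R0 (fun n => u 0 n ^ 2) M = X ^ 2).
      { rewrite (sum_eq _ (fun n => match n with O => X ^ 2 | S _ => 0 end)).
        - apply sum_single_mode.
        - intros n Hn. rewrite (gal_init _ _ _ _ _ Hu) by exact Hn. unfold h. destruct n; ring. }
      assert (Hterm : u t 0%nat ^ 2 <= sum_f_R0 (fun n => u t n ^ 2) M)
        by (apply (sum_ge_term (fun n => u t n ^ 2)); [intros; apply pow2_ge_0|lia]).
      destruct (Rle_lt_dec (u t 0%nat) X); [assumption|exfalso]. nra.
    + destruct (le_lt_dec (S n) M) as [HM|HM].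
      2:{ rewrite (gal_zero _ _ _ _ _ Hu) by (auto; apply Ht). apply HU0. }
      assert (Hm : u t (S n) - N n * U n ^ 2 * t <= u 0 (S n) - N n * U n ^ 2 * 0).
      { apply (has_deriv_nonincreasing T (fun s => u s (S n) - N n * U n ^ 2 * s)
          (fun s => rhs N d (u s) (S n) - N n * U n ^ 2 * 1) 0 t).
        - intros s Hs. apply (has_deriv_minus T (fun s => u s (S n)) (fun s => N n * U n ^ 2 * s)).
          + apply (has_deriv_sub p_infty); [exact Hsub|]. apply (gal_solves _ _ _ _ _ Hu); [exact HM|apply Hsub, Hs].
          + apply (has_deriv_scal T (fun s => s)), has_deriv_id.
        - split; [lra|apply Ht].
        - exact Ht.
        - intros s Hs. assert (HIs := Ico0_le T s t Ht Hs). specialize (IH s HIs).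
          assert (Hnn : forall m, 0 <= u s m) by (intros m; apply (gal_nonneg _ _ _ _ _ Hu); lra).
          unfold rhs, incoming.
          assert (0 <= N (S n) * u s (S n) * u s (S (S n))) by (repeat apply Rmult_le_pos; auto).
          assert (0 <= d (S n) * u s (S n)) by (apply Rmult_le_pos; auto).
          assert (N n * u s n ^ 2 <= N n * U n ^ 2).
          { apply Rmult_le_compat_l; [apply HN|]. apply pow_incr. split; [apply Hnn|exact IH]. }
          lra. }
      rewrite (gal_init _ _ _ _ _ Hu) in Hm by exact HM. simpl in Hm.
      rewrite HUS. destruct Ht as [Ht0 HtT]. simpl in HtT.
      assert (0 <= N n * U n ^ 2) by (apply Rmult_le_pos; [apply HN|apply pow2_ge_0]).
      simpl pow in *. nra.
Qed.

(** * Barriers in the critical scaling *)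

(** Here [l], [l'] are the rates [e_n^2], [e_(n+1)^2], and [x_], [x], [y], [z] are the consecutive
    amplitudes from [a_(n-1)] on. With [dl = A - x], slope [4] and [Q >= A] give
    [y' >= l' (P + 2 A dl)], while [x' <= 7 l A dl]. The ratio [20] wins because [4 * 7 < 20 * 2];
    at [dl = 0] strictness comes from [P > 0]. *)
Lemma lower_barrier_tight (l l' A_ A A2 k k' B x_ x y z : R) :
  0 < l -> 20 * l <= l' -> 0 < A -> k <= 2 * A -> A <= A2 + k' ->
  A_ ^ 2 < A * (B + k) -> B * (A2 + k') < A ^ 2 ->
  0 <= x_ <= A_ -> x <= A -> 0 <= y -> z <= A2 ->
  y - B + 4 * (A - x) = 0 ->
  0 < l' * (x ^ 2 - y * z - k' * y) - 4 * (l * (x_ ^ 2 - x * y - k * x)).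
Proof.
  intros Hl Hl' HA Hk HQ Hi Hii Hx_ Hx Hy Hz E.
  set (Q := A2 + k') in *. set (dl := A - x).
  assert (Hdl : 0 <= dl) by (unfold dl; lra).
  assert (Ey : y = B - 4 * dl) by (unfold dl; lra).
  assert (Ex : x = A - dl) by (unfold dl; ring).
  assert (HBA : B <= A).
  { destruct (Rle_lt_dec B A); [assumption|exfalso].
    assert (A * A <= B * Q) by (apply Rmult_le_compat; lra). simpl in Hii. lra. }
  set (P := A ^ 2 - B * Q) in *. assert (HP : 0 < P) by (unfold P; lra).
  assert (HAdl : 0 <= A * dl) by (apply Rmult_le_pos; lra).
  assert (H1 : P + 2 * (A * dl) <= x ^ 2 - y * z - k' * y).
  { assert (y * z <= y * A2) by (apply Rmult_le_compat_l; assumption).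
    assert (E1 : x ^ 2 - y * A2 - k' * y = P + dl * (4 * Q - 2 * A) + dl ^ 2)
      by (unfold P; rewrite Ex, Ey; unfold Q; ring).
    assert (dl * (2 * A) <= dl * (4 * Q - 2 * A)) by (apply Rmult_le_compat_l; lra).
    assert (0 <= dl ^ 2) by apply pow2_ge_0. lra. }
  assert (H2 : x_ ^ 2 - x * y - k * x <= 7 * (A * dl)).
  { assert (x_ ^ 2 <= A_ ^ 2) by (apply pow_incr; lra).
    assert (E2 : A * (B + k) - x * y - k * x = dl * (B + k + 4 * A) - 4 * dl ^ 2)
      by (rewrite Ex, Ey; ring).
    assert (dl * (B + k + 4 * A) <= dl * (7 * A)) by (apply Rmult_le_compat_l; lra).
    assert (0 <= dl ^ 2) by apply pow2_ge_0. lra. }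
  assert (H3 : 20 * l * (P + 2 * (A * dl)) <= l' * (x ^ 2 - y * z - k' * y))
    by (apply Rmult_le_compat; lra).
  assert (H4 : l * (x_ ^ 2 - x * y - k * x) <= l * (7 * (A * dl))) by (apply Rmult_le_compat_l; lra).
  assert (0 < l * P) by (apply Rmult_lt_0_compat; assumption).
  assert (0 <= l * (A * dl)) by (apply Rmult_le_pos; lra). lra.
Qed.

(** The two requirements say [A_^2 / A - k < B < A^2 / Q]; the witness is the midpoint of this
    interval. *)
Lemma barrier_constant (A_ A Q k : R) :
  0 < A -> 0 < Q -> A_ ^ 2 < A * (A ^ 2 / Q + k) ->
  exists B, A_ ^ 2 < A * (B + k) /\ B * Q < A ^ 2.
Proof.
  intros HA HQ H. exists ((A_ ^ 2 / A - k + A ^ 2 / Q) / 2).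
  assert (H1 : A_ ^ 2 / A < A ^ 2 / Q + k).
  { apply (Rmult_lt_reg_r A); [exact HA|].
    replace (A_ ^ 2 / A * A) with (A_ ^ 2) by (field; lra). lra. }
  split.
  - replace (A_ ^ 2) with (A * (A_ ^ 2 / A)) at 1 by (field; lra).
    apply Rmult_lt_compat_l; lra.
  - replace (A ^ 2) with (A ^ 2 / Q * Q) at 2 by (field; lra).
    apply Rmult_lt_compat_r; lra.
Qed.

Section Barrier.
Variables (N0 b : R) (d h A kap : nat -> R) (n0 n2 M : nat) (u : R -> nat -> R).
Hypothesis hb : 1 < b.
Let e := crit_weight N0 b.
Hypothesis Hu : galerkin (freq N0 b) d h M u.
Hypothesis Hd : forall n, d n = kap n * e n ^ 2.
Hypothesis Hkap : forall n, 0 < kap n.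
Hypothesis HA : forall n, 0 < A n.
Hypothesis Hn0 : (1 <= n0)%nat.
Hypothesis HM : (n2 < M)%nat.
Hypothesis Hlow : forall n t, (n < n0)%nat -> 0 <= t -> e n * u t n < A n.
Hypothesis Hinit : forall n, e n * h n <= A n / 2.
Hypothesis Hmid : forall n, (n0 <= S n)%nat -> (S n <= n2)%nat ->
  kap (S n) <= 2 * A (S n) /\
  A (S n) <= A (S (S (S n))) + kap (S (S n)) /\
  A n ^ 2 < A (S n) * (A (S n) ^ 2 / (A (S (S (S n))) + kap (S (S n))) + kap (S n)) /\
  20 * e (S n) ^ 2 <= e (S (S n)) ^ 2.
Hypothesis Hhigh : forall n, (n2 <= n)%nat -> A n ^ 2 < A (S n) * kap (S n).

Lemma crit_weight_rhs (x : nat -> R) (n : nat) :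
  e (S n) * rhs (freq N0 b) d x (S n) =
  e (S n) ^ 2 * ((e n * x n) ^ 2 - (e (S n) * x (S n)) * (e (S (S n)) * x (S (S n)))
                 - kap (S n) * (e (S n) * x (S n))).
Proof. unfold rhs, incoming. rewrite !freq_crit_weight, Hd by exact hb. fold e. ring. Qed.

(** On the face [a_n = A_n] with [n0 <= n <= n2] the lower barrier forces [a_(n+1) >= B_n], so
    outflow beats inflow; above [n2] damping suffices, and below [n0] the face is never reached by
    [Hlow]. Lower barriers reach up to [n = n2], and [n2 < M] keeps the bounded mode [n + 1] inside
    the truncation. *)
Lemma galerkin_barrier (n : nat) (t : R) : (n <= M)%nat -> 0 <= t -> e n * u t n < A n.
Proof.
  assert (He : forall n, 0 < e n) by (intros; apply crit_weight_pos).
  assert (He2 : forall n, 0 < e n ^ 2) by (intros; apply pow_lt, He).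
  assert (HB : forall m, exists B, (n0 <= S m)%nat -> (S m <= n2)%nat ->
     A m ^ 2 < A (S m) * (B + kap (S m)) /\
     B * (A (S (S (S m))) + kap (S (S m))) < A (S m) ^ 2).
  { intros m. destruct (le_dec n0 (S m)) as [H1|H1]; [|exists 0; intros; contradiction].
    destruct (le_dec (S m) n2) as [H2|H2]; [|exists 0; intros; contradiction].
    destruct (Hmid m H1 H2) as [_ [_ [H3 _]]].
    destruct (barrier_constant (A m) (A (S m)) (A (S (S (S m))) + kap (S (S m))) (kap (S m))) as [B HB].
    - apply HA.
    - specialize (HA (S (S (S m)))). specialize (Hkap (S (S m))). lra.
    - exact H3.
    - exists B. intros _ _. exact HB. }
  set (Bf := fun m => proj1_sig (constructive_indefinite_description _ (HB m))).
  assert (HBf : forall m, (n0 <= S m)%nat -> (S m <= n2)%nat ->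
     A m ^ 2 < A (S m) * (Bf m + kap (S m)) /\
     Bf m * (A (S (S (S m))) + kap (S (S m))) < A (S m) ^ 2)
    by (intros m; exact (proj2_sig (constructive_indefinite_description _ (HB m)))).
  clearbody Bf. clear HB.
  (* Indices without a lower barrier carry the constant constraint [1], whose face is never met. *)
  set (fl := fun m => if le_dec n0 (S m) then if le_dec (S m) n2 then true else false else false).
  assert (Hfl : forall m, fl m = true -> (n0 <= S m <= n2)%nat).
  { intros m. unfold fl. destruct (le_dec n0 (S m)); [|discriminate].
    destruct (le_dec (S m) n2); [lia|discriminate]. }
  assert (Hfl' : forall m, (n0 <= S m <= n2)%nat -> fl m = true).
  { intros m Hm. unfold fl. destruct (le_dec n0 (S m)); [|lia]. destruct (le_dec (S m) n2); [reflexivity|lia]. }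
  clearbody fl.
  intros Hn Ht. apply Rlt_0_minus.
  apply (strict_invariance2 p_infty
    (fun n s => A n - e n * u s n)
    (fun n s => 0 - e n * rhs (freq N0 b) d (u s) n)
    (fun m s => if fl m then e (S (S m)) * u s (S (S m)) - Bf m + 4 * (A (S m) - e (S m) * u s (S m)) else 1)
    (fun m s => if fl m then e (S (S m)) * rhs (freq N0 b) d (u s) (S (S m)) - 0
                 + 4 * (0 - e (S m) * rhs (freq N0 b) d (u s) (S m)) else 0) M);
    [| | | | |apply Ico0_infty, Ht|exact Hn]; clear n t Hn Ht.
  - intros n s Hn Hs. apply (has_deriv_minus _ (fun _ => A n) (fun s => e n * u s n)); [apply has_deriv_const|].
    apply (has_deriv_scal _ (fun s => u s n)), (gal_solves _ _ _ _ _ Hu); assumption.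
  - intros m s Hm Hs. destruct (fl m) eqn:Ef; [|apply has_deriv_const]. apply Hfl in Ef.
    assert (HDV : forall n, (n <= M)%nat -> has_deriv p_infty (fun s => e n * u s n) s (e n * rhs (freq N0 b) d (u s) n))
      by (intros n Hn; apply (has_deriv_scal _ (fun s => u s n)), (gal_solves _ _ _ _ _ Hu); assumption).
    apply (has_deriv_plus _ (fun s => e (S (S m)) * u s (S (S m)) - Bf m) (fun s => 4 * (A (S m) - e (S m) * u s (S m)))).
    + apply (has_deriv_minus _ (fun s => e (S (S m)) * u s (S (S m))) (fun _ => Bf m)); [apply HDV; lia|apply has_deriv_const].
    + apply (has_deriv_scal _ (fun s => A (S m) - e (S m) * u s (S m))).
      apply (has_deriv_minus _ (fun _ => A (S m)) (fun s => e (S m) * u s (S m))); [apply has_deriv_const|apply HDV; lia].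
  - intros n Hn. rewrite (gal_init _ _ _ _ _ Hu) by exact Hn.
    specialize (Hinit n). specialize (HA n). lra.
  (* Initially [a <= A / 2], so [4 * (A - a)] is at least [2 A], which exceeds [B <= A]: the lower
     barrier holds whatever the non-negative value of the next mode. *)
  - intros m Hm. destruct (fl m) eqn:Ef; [|lra]. apply Hfl in Ef.
    rewrite !(gal_init _ _ _ _ _ Hu) by lia.
    destruct (HBf m) as [_ HB2]; [lia|lia|]. destruct (Hmid m) as [_ [HQ _]]; [lia|lia|].
    assert (HAm := HA (S m)). assert (Hi1 := Hinit (S m)).
    assert (Hnn : 0 <= u 0 (S (S m))) by (apply (gal_nonneg _ _ _ _ _ Hu); lra).
    rewrite (gal_init _ _ _ _ _ Hu) in Hnn by lia.
    assert (0 <= e (S (S m)) * h (S (S m))) by (apply Rmult_le_pos; [left; apply He|exact Hnn]).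
    assert (HBA : Bf m <= A (S m)).
    { destruct (Rle_lt_dec (Bf m) (A (S m))); [assumption|exfalso].
      assert (A (S m) * A (S m) <= Bf m * (A (S (S (S m))) + kap (S (S m))))
        by (apply Rmult_le_compat; lra). simpl in HB2. lra. }
    lra.
  - intros s Hs Hg Hh j Hj. assert (Hs0 : 0 <= s) by apply Hs.
    assert (Hp0 : forall n, 0 <= e n * u s n)
      by (intros n; apply Rmult_le_pos; [left; apply He|apply (gal_nonneg _ _ _ _ _ Hu), Hs0]).
    (* Needed at every index: the face of a lower barrier involves mode [m + 3], which can be
       [M + 1]. *)
    assert (HpA : forall n, e n * u s n <= A n).
    { intros n. destruct (le_lt_dec n M) as [Hn|Hn]; [specialize (Hg n Hn); lra|].
      rewrite (gal_zero _ _ _ _ _ Hu) by assumption. specialize (HA n). lra. }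
    split.
    + intros E. destruct (le_lt_dec n0 j) as [Hj0|Hj0]; [|specialize (Hlow j s Hj0 Hs0); lra].
      destruct j as [|m]; [lia|]. rewrite crit_weight_rhs.
      assert (Ep : e (S m) * u s (S m) = A (S m)) by lra. rewrite Ep.
      assert (Hp := HpA m). assert (Hp' := Hp0 m).
      assert (Hpm : (e m * u s m) ^ 2 <= A m ^ 2) by (apply pow_incr; lra).
      set (y := e (S (S m)) * u s (S (S m))) in *.
      assert (Hy : 0 <= y) by apply Hp0.
      assert (HAm := HA (S m)).
      assert (Hneg : (e m * u s m) ^ 2 - A (S m) * y - kap (S m) * A (S m) < 0).
      { destruct (le_lt_dec (S m) n2) as [Hm2|Hm2].
        - destruct (HBf m Hj0 Hm2) as [HB1 _].
          specialize (Hh m ltac:(lia)). rewrite Hfl' in Hh by lia. rewrite Ep in Hh. fold y in Hh.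
          assert (A (S m) * Bf m <= A (S m) * y) by (apply Rmult_le_compat_l; lra). lra.
        - specialize (Hhigh m ltac:(lia)).
          assert (0 <= A (S m) * y) by (apply Rmult_le_pos; lra). lra. }
      specialize (He2 (S m)). nra.
    + destruct (fl j) eqn:Ef; [|lra]. apply Hfl in Ef. intros E.
      rewrite !crit_weight_rhs.
      destruct (HBf j) as [HB1 HB2]; [lia|lia|]. destruct (Hmid j) as [H1 [H2 [_ H4]]]; [lia|lia|].
      assert (HT := lower_barrier_tight (e (S j) ^ 2) (e (S (S j)) ^ 2) (A j) (A (S j)) (A (S (S (S j))))
        (kap (S j)) (kap (S (S j))) (Bf j) (e j * u s j) (e (S j) * u s (S j))
        (e (S (S j)) * u s (S (S j))) (e (S (S (S j))) * u s (S (S (S j))))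
        (He2 (S j)) H4 (HA (S j)) H1 H2 HB1 HB2 (conj (Hp0 j) (HpA j)) (HpA (S j))
        (Hp0 (S (S j))) (HpA (S (S (S j)))) E).
      lra.
Qed.
End Barrier.

Lemma damped_upper_bound (f g : R -> R) (l P k m : R) :
  0 <= l -> P <= k * m -> 0 <= k -> f 0 <= m ->
  (forall t, 0 <= t -> has_deriv p_infty f t (g t)) ->
  (forall t, 0 <= t -> g t <= l * (P - k * f t)) ->
  forall t, 0 <= t -> f t <= m.
Proof.
  intros Hl HP Hk H0 HD Hg t Ht.
  assert (H : 0 <= m - f t); [|lra].
  apply (has_deriv_nonneg p_infty (fun t => m - f t) (fun t => 0 - g t)).
  - intros s Hs. apply (has_deriv_minus _ (fun _ => m) f); [apply has_deriv_const|apply HD, Hs].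
  - lra.
  - intros s Hs Hneg. specialize (Hg s (proj1 Hs)).
    assert (k * m <= k * f s) by (apply Rmult_le_compat_l; lra).
    assert (l * (P - k * f s) <= 0) by nra. lra.
  - apply Ico0_infty, Ht.
Qed.

(** [2 ^ triangular k] is the product of the ratios [2^1, ..., 2^k] between consecutive amplitudes
    in [subcritical_barrier]. *)
Fixpoint triangular (n : nat) : nat :=
  match n with O => O | S m => (triangular m + S m)%nat end.

Lemma triangular_le_square (n : nat) : (triangular n <= n * n)%nat.
Proof. induction n as [|n IH]; simpl; lia. Qed.

Lemma freq_dominates_triangular (N0 b s K : R) : 1 < N0 -> 1 < b -> 0 < s ->
  exists n', forall n, (n' <= n)%nat -> K * 2 ^ triangular n <= Rpower (freq N0 b n) s.
Proof.
  intros HN0 Hb Hs.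
  assert (Hl : 0 < ln N0) by (rewrite <- ln_1; apply ln_increasing; lra).
  assert (Hl2 : 0 < ln 2) by (rewrite <- ln_1; apply ln_increasing; lra).
  assert (Hsl : 0 < s * ln N0) by (apply Rmult_lt_0_compat; assumption).
  destruct (pow_dominates_square b Hb (2 * ln 2 / (s * ln N0))) as [C [HC HCn]].
  destruct (INR_unbounded (Rabs K * exp (s * ln N0 * C))) as [n' Hn'].
  exists n'. intros n Hn.
  (* Of the two factors, one bounds [2 ^ triangular n]; the other is at least [n] and absorbs the
     constants. *)
  assert (H1 : 2 ^ (n * n) * 2 ^ (n * n) <= exp (s * ln N0 * C) * Rpower (freq N0 b n) s).
  { rewrite <- pow_add, <- Rpower_pow by lra. rewrite Rpower_freq, <- exp_plus. unfold Rpower.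
    apply exp_le. specialize (HCn n).
    apply (Rmult_le_compat_l (s * ln N0)) in HCn; [|lra].
    replace (s * ln N0 * (2 * ln 2 / (s * ln N0) * INR n ^ 2)) with (2 * ln 2 * INR n ^ 2) in HCn
      by (field; split; apply Rgt_not_eq; assumption).
    rewrite plus_INR, mult_INR. simpl pow in HCn. lra. }
  assert (H2 : INR n <= 2 ^ (n * n)).
  { apply Rle_trans with (2 ^ n).
    - assert (H := poly n 1 Rlt_0_1). replace (1 + 1) with 2 in H by ring. lra.
    - apply Rle_pow; [lra|]. destruct n; simpl; lia. }
  assert (H3 : INR n' <= INR n) by (apply le_INR, Hn).
  assert (HE : 0 < exp (s * ln N0 * C)) by apply exp_pos.
  assert (HP : 0 < Rpower (freq N0 b n) s) by apply exp_pos.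
  assert (HK : K <= Rabs K) by apply Rle_abs. assert (HK0 : 0 <= Rabs K) by apply Rabs_pos.
  assert (Htri : 0 < 2 ^ triangular n <= 2 ^ (n * n)).
  { split; [apply pow_lt; lra|apply Rle_pow; [lra|apply triangular_le_square]]. }
  set (W := 2 ^ (n * n)) in *. set (Ex := exp (s * ln N0 * C)) in *.
  assert (HKW : Rabs K * Ex <= W) by lra.
  assert (H4 : Rabs K * Ex * W <= W * W) by (apply Rmult_le_compat_r; lra).
  assert (H5 : Rabs K * W <= Rpower (freq N0 b n) s).
  { apply (Rmult_le_reg_l Ex); [exact HE|]. lra. }
  assert (H6 : K * 2 ^ triangular n <= Rabs K * 2 ^ triangular n) by (apply Rmult_le_compat_r; lra).
  assert (H7 : Rabs K * 2 ^ triangular n <= Rabs K * W) by (apply Rmult_le_compat_l; lra). lra.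
Qed.

Lemma freq_eventually_large (N0 b s K : R) : 1 < N0 -> 1 < b -> 0 < s ->
  exists n', forall n, (n' <= n)%nat -> K <= Rpower (freq N0 b n) s.
Proof.
  intros HN0 Hb Hs. destruct (freq_dominates_triangular N0 b s (Rabs K) HN0 Hb Hs) as [n' H].
  exists n'. intros n Hn. eapply Rle_trans; [|apply H, Hn].
  assert (1 <= 2 ^ triangular n) by (apply pow_R1_Rle; lra).
  assert (K <= Rabs K) by apply Rle_abs. assert (0 <= Rabs K) by apply Rabs_pos. nra.
Qed.

(* [e n * E] is the a priori bound from the energy: modes below [n0], where the time scales are not
   yet separated enough, are only controlled by it, so [A] has to be large there. *)
Record barrier (e kap a0 : nat -> R) (E : R) (n0 n2 : nat) (A : nat -> R) : Prop := {
  bar_pos : forall n, 0 < A n;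
  bar_n0 : (1 <= n0)%nat;
  bar_low : forall n, (n < n0)%nat -> e n * E < A n;
  bar_init : forall n, a0 n <= A n / 2;
  bar_mid : forall n, (n0 <= S n)%nat -> (S n <= n2)%nat ->
    kap (S n) <= 2 * A (S n) /\
    A (S n) <= A (S (S (S n))) + kap (S (S n)) /\
    A n ^ 2 < A (S n) * (A (S n) ^ 2 / (A (S (S (S n))) + kap (S (S n))) + kap (S n));
  bar_const : forall n, (n2 <= n)%nat -> A n = A n2;
  bar_high : forall n, (n2 < n)%nat -> 2 * A n2 <= kap n
}.

(* [A] decreases geometrically from a large constant to [nu / 2]; the gain per step allowed by
   [bar_mid] is bounded below as long as [A] stays bounded. *)
Lemma critical_barrier (e a0 : nat -> R) (nu E : R) (n0 : nat) :
  0 < nu -> (1 <= n0)%nat ->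
  (exists C, forall n, a0 n <= C) ->
  (exists n1, forall n, (n1 <= n)%nat -> a0 n <= nu / 4) ->
  exists n2 A, barrier e (fun _ => nu) a0 E n0 n2 A.
Proof.
  intros Hnu Hn0 [Ch HCh] [n1' Hn1'].
  set (n1 := max n0 n1').
  destruct (finite_upper_bound (fun n => e n * E) n0) as [D [HD HDn]].
  set (A0 := nu + D + 2 * Rabs Ch + 1).
  assert (HCh0 : 0 <= Rabs Ch) by apply Rabs_pos. assert (HCh1 : Ch <= Rabs Ch) by apply Rle_abs.
  assert (HA0 : nu < A0 /\ D < A0 /\ 2 * Ch <= A0) by (unfold A0; lra).
  (* For equal amplitudes [x], the last condition of [bar_mid] times [(x + nu) / x] reads
     [x (x + nu) < x (x + nu) + nu^2]. The choice [(q^2 - 1) A0 (A0 + nu) = nu^2 / 2] spends half of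
     the surplus on a ratio [q] per step, for every [x <= A0]. *)
  set (q2 := 1 + nu ^ 2 / (2 * A0 * (A0 + nu))).
  assert (Hden : 0 < 2 * A0 * (A0 + nu)) by (apply Rmult_lt_0_compat; lra).
  assert (Hnu2 : 0 < nu ^ 2) by (apply pow_lt; lra).
  assert (Hq2 : 1 < q2) by (unfold q2; assert (0 < nu ^ 2 / (2 * A0 * (A0 + nu))) by (apply Rdiv_lt_0_compat; lra); lra).
  set (q := sqrt q2).
  assert (Hqq : q * q = q2) by (apply sqrt_sqrt; lra).
  assert (Hq : 1 < q) by (rewrite <- sqrt_1; apply sqrt_lt_1_alt; lra).
  assert (HqA : (q * q - 1) * (A0 * (A0 + nu)) = nu ^ 2 / 2) by (rewrite Hqq; unfold q2; field; lra).
  assert (Hqpow : forall j, 0 < q ^ j) by (intros; apply pow_lt; lra).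
  (* By truncated subtraction [G] is constant up to [n1], where the data and the energy bound still
     call for the large value; beyond, the data are at most [nu / 4]. *)
  set (G := fun n => A0 / q ^ (n - n1)).
  assert (HG : forall n, G (S n) <= G n /\ G n <= q * G (S n)).
  { intros n. unfold G. destruct (le_lt_dec n1 n) as [Hle|Hlt].
    - replace (S n - n1)%nat with (S (n - n1)) by lia. simpl pow.
      assert (Hp := Hqpow (n - n1)%nat).
      assert (Hpos : 0 < A0 / q ^ (n - n1)) by (apply Rdiv_lt_0_compat; lra).
      replace (A0 / (q * q ^ (n - n1))) with (/ q * (A0 / q ^ (n - n1))) by (field; lra).
      assert (/ q < 1) by (rewrite <- Rinv_1; apply Rinv_lt_contravar; lra).
      split; [nra|]. right. field. lra.
    - replace (S n - n1)%nat with 0%nat by lia. replace (n - n1)%nat with 0%nat by lia.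
      simpl pow. unfold Rdiv. rewrite Rinv_1. split; [lra|]. nra. }
  (* The floor is forced from both sides: [bar_mid] asks for [nu <= 2 A], [bar_high] for [2 A <= nu]
     on the plateau. *)
  set (A := fun n => Rmax (nu / 2) (G n)).
  assert (HA1 : forall n, nu / 2 <= A n) by (intros; apply Rmax_l).
  assert (HA2 : forall n, A (S n) <= A n).
  { intros n. unfold A. apply Rle_max_compat_l, HG. }
  assert (HA3 : forall n, A n <= q * A (S n)).
  { intros n. destruct (HG n) as [_ H]. specialize (HA1 (S n)).
    assert (G (S n) <= A (S n)) by apply Rmax_r.
    apply Rmax_lub; [nra|]. eapply Rle_trans; [exact H|]. apply Rmult_le_compat_l; lra. }
  assert (HG0 : forall n, (n <= n1)%nat -> G n = A0).
  { intros n Hn. unfold G. replace (n - n1)%nat with 0%nat by lia. simpl. field. }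
  assert (HAle : forall n, A n <= A0).
  { intros n. unfold A. apply Rmax_lub; [lra|]. induction n as [|n IH].
    - rewrite HG0 by lia. lra.
    - destruct (HG n). lra. }
  assert (Hlim : exists n2, (n1 <= n2)%nat /\ forall n, (n2 <= n)%nat -> G n <= nu / 2).
  { destruct (Pow_x_infinity q (ltac:(rewrite Rabs_right; lra)) (2 * A0 / nu)) as [j Hj].
    exists (n1 + j)%nat. split; [lia|]. intros n Hn. unfold G.
    specialize (Hj (n - n1)%nat ltac:(lia)). rewrite Rabs_right in Hj by (apply Rle_ge; left; apply Hqpow).
    apply (Rmult_le_reg_r (q ^ (n - n1))); [apply Hqpow|].
    unfold Rdiv at 1. rewrite Rmult_assoc, Rinv_l, Rmult_1_r by (apply Rgt_not_eq, Hqpow).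
    apply Rge_le in Hj. apply (Rmult_le_compat_l (nu / 2)) in Hj; [|lra].
    replace (nu / 2 * (2 * A0 / nu)) with A0 in Hj by (field; lra). exact Hj. }
  destruct Hlim as [n2 [Hn12 Hn2]].
  assert (HAn2 : forall n, (n2 <= n)%nat -> A n = nu / 2).
  { intros n Hn. unfold A. apply Rmax_left, Hn2, Hn. }
  exists n2, A. split.
  - intros n. specialize (HA1 n). lra.
  - exact Hn0.
  - intros n Hn. apply Rle_lt_trans with D; [apply HDn; lia|].
    apply Rlt_le_trans with (G n); [rewrite HG0 by lia; lra|apply Rmax_r].
  - intros n. destruct (le_lt_dec n1 n) as [Hle|Hlt].
    + specialize (Hn1' n ltac:(lia)). specialize (HA1 n). lra.
    + assert (G n <= A n) by apply Rmax_r. rewrite HG0 in H by lia. specialize (HCh n). lra.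
  - intros n _ _. specialize (HA2 (S n)) as H2. specialize (HA2 (S (S n))) as H3.
    assert (H1 := HA3 n). assert (H4 := HA3 (S n)). assert (H5 := HA3 (S (S n))).
    assert (H6 := HAle (S n)). assert (H7 := HA1 (S n)). assert (H8 := HA1 (S (S (S n)))).
    assert (H9 := HA1 n).
    set (x := A (S n)) in *. set (z := A (S (S (S n)))) in *. set (y := A n) in *.
    assert (Hqx : (q * q - 1) * (x * (x + nu)) <= nu ^ 2 / 2).
    { rewrite <- HqA. apply Rmult_le_compat_l; [nra|]. apply Rmult_le_compat; lra. }
    assert (Hxz : x <= q * q * z).
    { apply Rle_trans with (q * A (S (S n))); [exact H4|].
      rewrite Rmult_assoc. apply Rmult_le_compat_l; lra. }
    split; [lra|]. split.
    + assert (z <= x) by lra.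
      assert ((q * q - 1) * z <= (q * q - 1) * x) by (apply Rmult_le_compat_l; [nra|lra]).
      assert ((q * q - 1) * x * nu <= nu ^ 2 / 2).
      { assert (0 <= (q * q - 1) * (x * x)) by (apply Rmult_le_pos; nra). nra. }
      assert ((q * q - 1) * x <= nu) by nra. lra.
    + assert (Hy2 : y ^ 2 <= q * q * x ^ 2).
      { replace (q * q * x ^ 2) with ((q * x) ^ 2) by ring. apply pow_incr. lra. }
      eapply Rle_lt_trans; [exact Hy2|].
      assert (Hz : x ^ 2 / (x + nu) <= x ^ 2 / (z + nu)).
      { apply Rmult_le_compat_l; [apply pow2_ge_0|]. apply Rinv_le_contravar; lra. }
      apply Rlt_le_trans with (x * (x ^ 2 / (x + nu) + nu)); [|apply Rmult_le_compat_l; lra].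
      replace (q * q * x ^ 2) with (x * (q * q * x)) by ring.
      apply Rmult_lt_compat_l; [lra|].
      apply (Rmult_lt_reg_r (x + nu)); [lra|].
      replace ((x ^ 2 / (x + nu) + nu) * (x + nu)) with (x * (x + nu) + nu ^ 2) by (field; lra).
      lra.
  - intros n Hn. rewrite !HAn2 by lia. reflexivity.
  - intros n _. rewrite HAn2 by lia. lra.
Qed.

(* [kap] jumps from far below to above the amplitudes at [n1], and the modes just below [n1] then lose
   their drain.  Letting [A] increase towards [n1] with decreasing ratios [2^(n1-n+1)] leaves enough
   room: [A_(n-1)^2 A_(n+2) < A_n^3]. *)
Lemma subcritical_barrier (e kap a0 : nat -> R) (E : R) (n0 : nat) :
  (1 <= n0)%nat -> (forall n, 0 < kap n) -> (forall n, kap n <= kap (S n)) ->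
  (exists C, forall n, a0 n <= C) ->
  (forall K, exists n1, (n0 <= n1)%nat /\ (K + kap n1) * 2 ^ triangular n1 <= kap (S n1) / 2) ->
  exists n2 A, barrier e kap a0 E n0 n2 A.
Proof.
  intros Hn0 Hkap Hmono [Ch HCh] Hlarge.
  destruct (finite_upper_bound (fun n => e n * E) n0) as [D [HD HDn]].
  assert (HCh0 : 0 <= Rabs Ch) by apply Rabs_pos. assert (HCh1 : Ch <= Rabs Ch) by apply Rle_abs.
  destruct (Hlarge (D + 2 * Rabs Ch + 1)) as [n1 [Hn01 Hn1]].
  set (V := kap (S n1) / 2) in *.
  assert (HV : 0 < V) by (unfold V; specialize (Hkap (S n1)); lra).
  assert (H2 : forall j, 0 < 2 ^ j) by (intros; apply pow_lt; lra).
  assert (Hkm : forall n m, (n <= m)%nat -> kap n <= kap m).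
  { intros n m Hnm. induction Hnm as [|m Hnm IH]; [lra|]. specialize (Hmono m). lra. }
  (* [V] is the highest plateau allowed by [bar_high]. By [Hn1], the descent to mode [0] still ends
     above the data, the energy bound and [kap n1]. *)
  set (A := fun n => V * / 2 ^ triangular (n1 - n)).
  assert (HA : forall n, 0 < A n).
  { intros n. apply Rmult_lt_0_compat; [exact HV|apply Rinv_0_lt_compat, H2]. }
  assert (HAS : forall n, A n <= A (S n)).
  { intros n. unfold A. apply Rmult_le_compat_l; [lra|]. apply Rinv_le_contravar; [apply H2|].
    apply Rle_pow; [lra|]. destruct (le_lt_dec n1 n) as [Hle|Hlt].
    - replace (n1 - S n)%nat with 0%nat by lia. simpl; lia.
    - replace (n1 - n)%nat with (S (n1 - S n)) by lia. simpl; lia. }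
  assert (HAV : forall n, (n1 <= n)%nat -> A n = V).
  { intros n Hn. unfold A. replace (n1 - n)%nat with 0%nat by lia. simpl. field. }
  assert (HAr : forall n, D + 2 * Rabs Ch + 1 + kap n1 <= A n).
  { intros n. apply Rle_trans with (A 0%nat).
    - unfold A. rewrite Nat.sub_0_r. specialize (H2 (triangular n1)).
      apply (Rmult_le_reg_r (2 ^ triangular n1)); [exact H2|].
      rewrite Rmult_assoc, Rinv_l by lra. lra.
    - induction n as [|n IH]; [lra|]. specialize (HAS n). lra. }
  exists n1, A. split.
  - exact HA.
  - exact Hn0.
  - intros n Hn. specialize (HDn n ltac:(lia)). specialize (HAr n). specialize (Hkap n1). simpl in HDn. lra.
  - intros n. specialize (HAr n). specialize (Hkap n1). specialize (HCh n). lra.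
  - intros n Hn Hn'.
    assert (Hk1 : kap (S n) <= kap n1) by (apply Hkm; lia).
    assert (HArn := HAr (S n)). assert (HA1 := HA (S n)).
    assert (HS1 := HAS (S n)). assert (HS2 := HAS (S (S n))).
    assert (Hk2 := Hkap (S (S n))). assert (Hk3 := Hkap (S n)).
    split; [lra|]. split; [lra|].
    assert (Hcube : A n ^ 2 * (A (S (S (S n))) + kap (S (S n))) < A (S n) ^ 3).
    (* At the jump [A_(n1-1) = V / 2] and [kap (S n1) = 2 V], so the claim is [3 / 4 V^3 < V^3].
       Below it, [kap] is at most [kap n1 <= A (S n)] and at most doubles the bound [x p^2] on
       [A_(n+3)]; the ratio [2 p] of [A (S n)] to [A n] leaves a factor [/ 2]. *)
    { destruct (Nat.eq_dec (S n) n1) as [Heq|Hne].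
      - rewrite (HAV (S (S (S n)))), (HAV (S n)) by lia.
        assert (HAn : A n = V / 2).
        { unfold A. replace (n1 - n)%nat with 1%nat by lia. simpl. field. }
        rewrite HAn, Heq. replace (kap (S n1)) with (2 * V) by (unfold V; field).
        assert (0 < V ^ 3) by (apply pow_lt, HV).
        replace ((V / 2) ^ 2 * (V + 2 * V)) with (3 / 4 * V ^ 3) by field. lra.
      - assert (Hk4 : kap (S (S n)) <= A (S n)).
        { apply Rle_trans with (kap n1); [apply Hkm; lia|lra]. }
        set (j := (n1 - S (S n))%nat).
        assert (HAn : A n = A (S n) * / (2 * 2 ^ S j)).
        { unfold A. replace (n1 - n)%nat with (S (S j)) by (unfold j; lia).
          replace (n1 - S n)%nat with (S j) by (unfold j; lia).
          change (triangular (S (S j))) with (triangular (S j) + S (S j))%nat.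
          generalize (triangular (S j)). intros i. rewrite pow_add, <- !tech_pow_Rmult.
          assert (Hi := H2 i). assert (Hj := H2 j). field. lra. }
        assert (HA3 : A (S (S (S n))) <= A (S n) * (2 ^ S j * 2 ^ S j)).
        { unfold A. replace (n1 - S n)%nat with (S j) by (unfold j; lia).
          replace (n1 - S (S (S n)))%nat with (j - 1)%nat by (unfold j; lia).
          rewrite Rmult_assoc. apply Rmult_le_compat_l; [lra|].
          change (triangular (S j)) with (triangular j + S j)%nat. rewrite pow_add.
          assert (Ht : 2 ^ triangular j <= 2 ^ triangular (j - 1) * 2 ^ S j).
          { rewrite <- pow_add. apply Rle_pow; [lra|]. destruct j; simpl; [lia|]. rewrite Nat.sub_0_r. lia. }
          apply (Rmult_le_reg_r (2 ^ triangular (j - 1))); [apply H2|].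
          rewrite Rinv_l by (apply Rgt_not_eq, H2).
          replace (/ (2 ^ triangular j * 2 ^ S j) * (2 ^ S j * 2 ^ S j) * 2 ^ triangular (j - 1))
            with ((2 ^ triangular (j - 1) * 2 ^ S j) * / 2 ^ triangular j)
            by (field; split; apply Rgt_not_eq, H2).
          apply (Rmult_le_reg_r (2 ^ triangular j)); [apply H2|].
          rewrite Rmult_assoc, Rinv_l by (apply Rgt_not_eq, H2). lra. }
        rewrite HAn. set (x := A (S n)) in *. set (p := 2 ^ S j) in *.
        assert (Hp : 1 <= p) by (apply pow_R1_Rle; lra).
        assert (Hpp : 1 <= p * p) by nra.
        assert (HQ : A (S (S (S n))) + kap (S (S n)) <= x * (2 * (p * p))) by nra.
        assert (Hc : 0 <= (x * / (2 * p)) ^ 2) by apply pow2_ge_0.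
        apply (Rmult_le_compat_l _ _ _ Hc) in HQ.
        replace ((x * / (2 * p)) ^ 2 * (x * (2 * (p * p)))) with (/ 2 * x ^ 3) in HQ by (field; lra).
        assert (0 < x ^ 3) by (apply pow_lt; assumption). lra. }
    set (Q := A (S (S (S n))) + kap (S (S n))) in *.
    assert (HQ : 0 < Q) by (unfold Q; specialize (HA (S (S (S n)))); lra).
    apply Rlt_le_trans with (A (S n) * (A (S n) ^ 2 / Q)).
    + apply (Rmult_lt_reg_r Q); [exact HQ|].
      replace (A (S n) * (A (S n) ^ 2 / Q) * Q) with (A (S n) ^ 3) by (field; lra). exact Hcube.
    + apply Rmult_le_compat_l; lra.
  - intros n Hn. rewrite !HAV by lia. reflexivity.
  - intros n Hn. rewrite HAV by lia. unfold V.
    assert (kap (S n1) <= kap n) by (apply Hkm; lia). lra.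
Qed.

(** * Global regularity *)

(** Both entries of the bound [max (N_n^(-s), 2^(-2^j))] are stable under squaring: the second
    exactly, the first because [N_(n+1) = N_n^b] with [b < 2] gives [N_n^(-2 s) <= N_(n+1)^(-s)]. *)
Lemma rapidly_decaying_of_squaring (N0 b s : R) (y a : nat -> R) (n2 : nat) :
  1 < N0 -> 1 < b < 2 -> 0 < s -> rapidly_decaying (freq N0 b) a ->
  (forall n, (n2 <= n)%nat -> 0 <= y n <= / 2) ->
  (forall n, (n2 <= n)%nat -> y (S n) <= Rmax (a (S n)) (y n ^ 2)) ->
  exists C, 0 <= C /\ forall n, (n2 <= n)%nat -> y n * Rpower (freq N0 b n) s <= C.
Proof.
  intros HN0 Hb Hs Ha Hy HyS. set (N := freq N0 b) in *.
  assert (HR : forall n r, 0 < Rpower (N n) r) by (intros; apply exp_pos).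
  assert (HRinv : forall n, Rpower (N n) (- s) * Rpower (N n) s = 1).
  { intros n. rewrite Rpower_Ropp. apply Rinv_l, Rgt_not_eq, HR. }
  (* One extra power absorbs the constant, giving [a_n <= N_n^(-s)] eventually; a prefactor would be
     squared at each step. *)
  destruct (Ha (s + 1)) as [C1 [HC1 HC1n]]; [lra|].
  destruct (freq_eventually_large N0 b 1 C1 HN0) as [n' Hn']; [lra|lra|]. fold N in Hn'.
  set (n3 := max n2 n').
  assert (Han : forall n, (n3 <= n)%nat -> a n <= Rpower (N n) (- s)).
  { intros n Hn. specialize (HC1n n). specialize (Hn' n ltac:(lia)).
    rewrite Rpower_plus in HC1n. assert (H1 := HR n s). assert (H2 := HR n 1).
    apply (Rmult_le_reg_r (Rpower (N n) s * Rpower (N n) 1)); [apply Rmult_lt_0_compat; assumption|].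
    rewrite <- (Rmult_assoc (Rpower (N n) (- s))), HRinv. lra. }
  destruct (double_exponential_decay N0 b (/ 2) s n3 HN0 Hb) as [C2 [HC2 HC2n]]; [lra|exact Hs|].
  fold N in HC2n.
  assert (Hmain : forall j, y (n3 + j)%nat <= Rmax (Rpower (N (n3 + j)%nat) (- s)) ((/ 2) ^ (2 ^ j))).
  { induction j as [|j IH].
    - rewrite Nat.add_0_r. eapply Rle_trans; [|apply Rmax_r]. simpl. rewrite Rmult_1_r. apply Hy. lia.
    - replace (n3 + S j)%nat with (S (n3 + j)) by lia.
      eapply Rle_trans; [apply HyS; lia|]. apply Rmax_lub.
      + eapply Rle_trans; [|apply Rmax_l]. apply Han. lia.
      + assert (Hy0 := Hy (n3 + j)%nat ltac:(lia)).
        set (n := (n3 + j)%nat) in *.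
        assert (HS : Rpower (N n) (- s) ^ 2 <= Rpower (N (S n)) (- s)).
        { unfold N. rewrite !Rpower_freq. simpl pow. rewrite Rmult_1_r, <- exp_plus. apply exp_le.
          assert (0 <= s * (b ^ n * ln N0)).
          { repeat apply Rmult_le_pos; [lra|apply pow_le; lra|].
            rewrite <- ln_1. left. apply ln_increasing; lra. }
          nra. }
        assert (HD : ((/ 2) ^ 2 ^ j) ^ 2 = (/ 2) ^ 2 ^ S j).
        { rewrite <- pow_mult. f_equal. simpl. lia. }
        destruct (Rle_lt_dec (Rpower (N n) (- s)) ((/ 2) ^ 2 ^ j)) as [Hc|Hc].
        * rewrite Rmax_right in IH by exact Hc. eapply Rle_trans; [|apply Rmax_r].
          rewrite <- HD. apply pow_incr. lra.
        * rewrite Rmax_left in IH by (left; exact Hc). eapply Rle_trans; [|apply Rmax_l].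
          eapply Rle_trans; [|exact HS]. apply pow_incr. lra. }
  destruct (finite_upper_bound (fun n => y n * Rpower (N n) s) n3) as [C3 [HC3 HC3n]].
  exists (1 + C2 + C3). split; [lra|]. intros n Hn.
  destruct (le_lt_dec n3 n) as [Hle|Hlt].
  - specialize (Hmain (n - n3)%nat). replace (n3 + (n - n3))%nat with n in Hmain by lia.
    specialize (HC2n n Hle).
    apply Rle_trans with (Rmax (Rpower (N n) (- s)) ((/ 2) ^ 2 ^ (n - n3)) * Rpower (N n) s).
    + apply Rmult_le_compat_r; [left; apply HR|exact Hmain].
    + unfold Rmax. destruct Rle_dec.
      * set (w := (/ 2) ^ 2 ^ (n - n3) * Rpower (N n) s) in *. lra.
      * rewrite HRinv. lra.
  - specialize (HC3n n ltac:(lia)). simpl in HC3n. lra.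
Qed.

(** The damping recursion for [e_n u_n / K], with [k] counted from [n2]; the start [/ 2] is the
    barrier bound, since [K] is twice the plateau value. *)
Fixpoint squaring_majorant (a : nat -> R) (k : nat) : R :=
  match k with O => / 2 | S k => Rmax (a (S k)) (squaring_majorant a k ^ 2) end.

Lemma squaring_majorant_bounds (a : nat -> R) :
  (forall k, a k <= / 2) -> forall k, 0 <= squaring_majorant a k <= / 2.
Proof.
  intros Ha. induction k as [|k IH]; simpl squaring_majorant; [lra|]. split.
  - eapply Rle_trans; [apply pow2_ge_0|apply Rmax_r].
  - apply Rmax_lub; [apply Ha|]. nra.
Qed.

Lemma crit_weight_sqr (N0 b : R) (n : nat) : 1 < b ->
  crit_weight N0 b n ^ 2 = Rpower (freq N0 b n) (2 / (b + 2)).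
Proof.
  intros Hb. unfold crit_weight. simpl pow. rewrite Rmult_1_r, <- Rpower_plus. f_equal. field. lra.
Qed.

Lemma crit_weight_ratio (N0 b : R) (n : nat) : 1 < b ->
  crit_weight N0 b (S n) = crit_weight N0 b n * Rpower (freq N0 b n) ((b - 1) / (b + 2)).
Proof.
  intros Hb. unfold crit_weight. rewrite !Rpower_freq, <- exp_plus. f_equal. simpl pow. field. lra.
Qed.

(** Above the threshold, [kappa_(n+1) / kappa_n = N_n^(s (b - 1))] outgrows [2 ^ triangular n], so
    one jump of the damping is large enough to build on; at the threshold [kappa] is the constant
    [nu]. *)
Lemma barrier_exists (N0 b nu alpha E : R) (a0 : nat -> R) (n0 : nat) :
  1 < N0 -> 1 < b < 2 -> 0 < nu -> 1 / (b + 2) <= alpha -> (1 <= n0)%nat ->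
  rapidly_decaying (freq N0 b) a0 ->
  (forall n, 0 <= a0 n) ->
  exists n2 A, barrier (crit_weight N0 b)
    (fun n => nu * Rpower (freq N0 b n) (2 * alpha - 2 / (b + 2))) a0 E n0 n2 A.
Proof.
  intros HN0 Hb Hnu Halpha Hn0 Ha0 Ha0pos.
  destruct (rapidly_decaying_bounded N0 b a0 HN0 ltac:(lra) Ha0 Ha0pos 0) as [C [_ HC]].
  assert (HCb : exists C, forall n, a0 n <= C).
  { exists C. intros n. specialize (HC n). simpl in HC. lra. }
  assert (H2g : 2 / (b + 2) = 2 * (1 / (b + 2))) by (field; lra).
  destruct (Rle_lt_or_eq_dec _ _ Halpha) as [Hlt|Heq].
  - set (s := 2 * alpha - 2 / (b + 2)). assert (Hs : 0 < s) by (unfold s; lra).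
    assert (HNs : forall n, 1 <= Rpower (freq N0 b n) s).
    { intros n. apply one_le_Rpower_freq; lra. }
    assert (HkS : forall n, nu * Rpower (freq N0 b (S n)) s =
              nu * Rpower (freq N0 b n) s * Rpower (freq N0 b n) (s * (b - 1))).
    { intros n. rewrite Rmult_assoc, <- Rpower_plus. f_equal. rewrite !Rpower_freq. f_equal.
      simpl pow. ring. }
    apply subcritical_barrier; [exact Hn0| | |exact HCb|].
    + intros n. apply Rmult_lt_0_compat; [exact Hnu|apply exp_pos].
    + intros n. rewrite HkS. specialize (HNs n).
      assert (1 <= Rpower (freq N0 b n) (s * (b - 1)))
        by (apply one_le_Rpower_freq; [lra|lra|apply Rmult_le_pos; lra]).
      assert (0 < nu * Rpower (freq N0 b n) s) by (apply Rmult_lt_0_compat; lra). nra.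
    + intros K.
      destruct (freq_dominates_triangular N0 b (s * (b - 1)) (2 * (Rabs K / nu + 1))) as [n' Hn'];
        [lra|lra|apply Rmult_lt_0_compat; lra|].
      exists (max n0 n'). split; [lia|]. specialize (Hn' (max n0 n') ltac:(lia)).
      set (n := max n0 n') in *. rewrite HkS.
      specialize (HNs n). set (P := Rpower (freq N0 b n) s) in *.
      set (W := Rpower (freq N0 b n) (s * (b - 1))) in *.
      assert (HnuP : nu <= nu * P) by nra.
      assert (H2 : 0 < 2 ^ triangular n) by (apply pow_lt; lra).
      assert (HK : K + nu * P <= (Rabs K / nu + 1) * (nu * P)).
      { assert (K <= Rabs K) by apply Rle_abs. assert (0 <= Rabs K) by apply Rabs_pos.
        replace ((Rabs K / nu + 1) * (nu * P)) with (Rabs K * P + nu * P) by (field; lra).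
        assert (Rabs K * 1 <= Rabs K * P) by (apply Rmult_le_compat_l; lra). lra. }
      apply Rle_trans with ((Rabs K / nu + 1) * (nu * P) * 2 ^ triangular n);
        [apply Rmult_le_compat_r; lra|].
      apply (Rmult_le_compat_l (nu * P)) in Hn'; [|lra]. lra.
  - replace (fun n => nu * Rpower (freq N0 b n) (2 * alpha - 2 / (b + 2))) with (fun _ : nat => nu).
    + apply critical_barrier; [exact Hnu|exact Hn0|exact HCb|].
      destruct (rapidly_decaying_bounded N0 b a0 HN0 ltac:(lra) Ha0 Ha0pos 1) as [C1 [HC1 HC1n]].
      assert (Hlim := inv_freq_lim N0 b HN0 ltac:(lra)).
      apply is_lim_seq_Reals in Hlim. destruct (Hlim (nu / 4 / (C1 + 1))) as [n1 Hn1].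
      { apply Rdiv_lt_0_compat; lra. }
      exists n1. intros n Hn. specialize (Hn1 n Hn). unfold Rdist in Hn1. rewrite Rminus_0_r in Hn1.
      apply Rabs_def2 in Hn1. destruct Hn1 as [Hn1 _].
      specialize (HC1n n). rewrite pow_1 in HC1n. assert (HN := freq_pos N0 b n).
      assert (Hi : 0 < / freq N0 b n) by (apply Rinv_0_lt_compat, HN).
      apply Rle_trans with (C1 * / freq N0 b n).
      * apply (Rmult_le_reg_r (freq N0 b n)); [exact HN|]. rewrite Rmult_assoc, Rinv_l by lra. lra.
      * apply (Rmult_lt_compat_r (C1 + 1)) in Hn1; [|lra].
        replace (nu / 4 / (C1 + 1) * (C1 + 1)) with (nu / 4) in Hn1 by (field; lra). lra.
    + apply functional_extensionality. intros n.
      replace (2 * alpha - 2 / (b + 2)) with 0 by lra. rewrite Rpower_O by apply freq_pos. ring.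
Qed.

Lemma global_smooth_solution (N0 b nu alpha : R) (h : nat -> R) :
  1 < N0 -> 1 < b < 2 -> 0 < nu -> 1 / (b + 2) <= alpha ->
  nonneg_seq h -> rapidly_decaying (freq N0 b) h ->
  exists u, nonneg_smooth_solution (freq N0 b) nu alpha h (Ico0 p_infty) u.
Proof.
  intros HN0 Hb Hnu Halpha Hh Hrd.
  set (N := freq N0 b) in *. set (e := crit_weight N0 b). set (d := dissip N nu alpha).
  set (kap := fun n => nu * Rpower (N n) (2 * alpha - 2 / (b + 2))).
  assert (Hkap : forall n, 0 < kap n) by (intros; apply Rmult_lt_0_compat; [exact Hnu|apply exp_pos]).
  assert (He : forall n, 0 < e n) by (intros; apply crit_weight_pos).
  assert (Hg : 0 < 1 / (b + 2)) by (apply Rdiv_lt_0_compat; lra).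
  assert (He1 : forall n, 1 <= e n).
  { intros n. apply one_le_Rpower_freq; lra. }
  assert (HeI : forall n, 0 < / e n <= 1).
  { intros n. split; [apply Rinv_0_lt_compat, He|]. rewrite <- Rinv_1.
    apply Rinv_le_contravar; [lra|apply He1]. }
  assert (Hdk : forall n, d n = kap n * e n ^ 2).
  { intros n. unfold d, dissip, kap, e. rewrite crit_weight_sqr by lra.
    unfold N. rewrite Rmult_assoc, <- Rpower_plus. do 2 f_equal. ring. }
  assert (Hh0 : forall n, 0 <= e n * h n) by (intros n; apply Rmult_le_pos; [left; apply He|apply Hh]).
  assert (Hehrd : rapidly_decaying N (fun n => e n * h n)).
  { intros s Hs. destruct (Hrd (s + 1 / (b + 2))) as [C [HC HCn]]; [lra|]. exists C. split; [exact HC|].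
    intros n. specialize (HCn n). rewrite Rpower_plus in HCn. unfold e, crit_weight. fold N. lra. }
  assert (Hl2 : ex_series (fun n => h n ^ 2)).
  { destruct (rapidly_decaying_Hs N0 b 0 h HN0 ltac:(lra) (Rle_refl 0) Hrd) as [K HK].
    destruct (HK h) as [Hex _]; [intros n; split; [apply Hh|lra]|]. unfold in_Hs in Hex.
    apply (ex_series_ext (fun n => Rpower (freq N0 b n) (2 * 0) * h n ^ 2)); [|exact Hex].
    intros n. rewrite Rmult_0_r, Rpower_O by apply freq_pos. apply Rmult_1_l. }
  (* The energy bound [u^2 <= E - 1] implies [u <= E]. *)
  set (E := 1 + Series (fun n => h n ^ 2)).
  (* From here on [e_(n+1) >= 5 e_n], so the rates [e_n^2] grow by [25], above the required [20]. *)
  destruct (freq_eventually_large N0 b ((b - 1) / (b + 2)) 5 HN0) as [n0' Hn0'];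
    [lra|apply Rdiv_lt_0_compat; lra|].
  set (n0 := S n0').
  destruct (barrier_exists N0 b nu alpha E (fun n => e n * h n) n0 HN0 Hb Hnu Halpha) as [n2 [A HA]];
    [unfold n0; lia|exact Hehrd|exact Hh0|].
  fold N e kap in HA.
  assert (HApos := bar_pos _ _ _ _ _ _ _ HA).
  (* Beyond [n2] one has [K <= kap n] and [e_n u_n <= K / 2]. The damped bound [(K z)^2 / kap] is
     then at most [K z^2], which is the squaring recursion for [z]. *)
  set (K := 2 * A n2). assert (HK : 0 < K) by (unfold K; specialize (HApos n2); lra).
  set (a := fun k => e (n2 + k)%nat * h (n2 + k)%nat / K).
  assert (Ha : forall k, a k <= / 2).
  { intros k. unfold a. assert (Hi := bar_init _ _ _ _ _ _ _ HA (n2 + k)%nat).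
    rewrite (bar_const _ _ _ _ _ _ _ HA) in Hi by lia. simpl in Hi.
    apply (Rmult_le_reg_r K); [exact HK|]. unfold Rdiv. rewrite Rmult_assoc, Rinv_l, Rmult_1_r by lra.
    unfold K in *. lra. }
  set (z := squaring_majorant a).
  assert (Hz : forall k, 0 <= z k <= / 2) by (apply squaring_majorant_bounds, Ha).
  set (U := fun n => if le_lt_dec n2 n then K * z (n - n2)%nat * / e n else A n * / e n).
  apply (smooth_solution_of_galerkin_bounds N0 b nu alpha h U p_infty (S n2)).
  - exact HN0.
  - lra.
  - exact Hnu.
  - exact Hh.
  - intros n. unfold U. destruct (HeI n). destruct (le_lt_dec n2 n).
    + apply Rmult_le_pos; [apply Rmult_le_pos; [lra|apply Hz]|lra].
    + apply Rmult_le_pos; [left; apply HApos|lra].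
  - intros s Hs.
    destruct (rapidly_decaying_of_squaring N0 b s (fun n => z (n - n2)%nat) (fun n => e n * h n / K) n2)
      as [C [HC HCn]]; [exact HN0|exact Hb|exact Hs| | | |].
    + intros r Hr. destruct (Hehrd r Hr) as [Cr [HCr HCrn]]. exists (Cr / K).
      split; [apply Rmult_le_pos; [lra|left; apply Rinv_0_lt_compat, HK]|].
      intros n. specialize (HCrn n). fold N. unfold Rdiv.
      rewrite Rmult_assoc, (Rmult_comm (/ K)), <- Rmult_assoc.
      apply Rmult_le_compat_r; [left; apply Rinv_0_lt_compat, HK|exact HCrn].
    + intros n _. apply Hz.
    + intros n Hn. replace (S n - n2)%nat with (S (n - n2)) by lia. right.
      unfold z at 1. simpl squaring_majorant. fold z. unfold a.
      replace (n2 + S (n - n2))%nat with (S n) by lia. reflexivity.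
    + destruct (finite_upper_bound (fun n => A n * Rpower (N n) s) n2) as [C' [HC' HC'n]].
      exists (K * C + C'). split; [assert (0 <= K * C) by (apply Rmult_le_pos; lra); lra|].
      intros n. assert (HP : 0 < Rpower (freq N0 b n) s) by apply exp_pos.
      assert (HKC : 0 <= K * C) by (apply Rmult_le_pos; lra).
      destruct (HeI n) as [Hi0 Hi1].
      assert (Hdrop : forall x, 0 <= x -> x * / e n <= x) by (intros x Hx; nra).
      unfold U. fold N in HP |- *. destruct (le_lt_dec n2 n) as [Hn|Hn].
      * apply Rle_trans with (K * z (n - n2)%nat * Rpower (N n) s).
        -- apply Rmult_le_compat_r; [lra|]. apply Hdrop, Rmult_le_pos; [lra|apply Hz].
        -- specialize (HCn n Hn). simpl in HCn. fold N in HCn. rewrite Rmult_assoc.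
           apply (Rmult_le_compat_l K) in HCn; lra.
      * apply Rle_trans with (A n * Rpower (N n) s).
        -- apply Rmult_le_compat_r; [lra|]. apply Hdrop. left; apply HApos.
        -- specialize (HC'n n ltac:(lia)). simpl in HC'n. lra.
  - intros M u HM Hu t n Ht. fold N d in Hu. assert (Ht0 : 0 <= t) by apply Ht.
    assert (HNge : forall n, 0 <= N n) by (intros; left; apply freq_pos).
    assert (Hdge : forall n, 0 <= d n) by (intros m; left; apply Rmult_lt_0_compat; [exact Hnu|apply exp_pos]).
    assert (Hnn : forall t n, 0 <= t -> 0 <= u t n) by (apply (gal_nonneg _ _ _ _ _ Hu)).
    assert (HuE : forall t n, 0 <= t -> u t n <= E).
    { intros r m Hr. assert (HS : 0 <= Series (fun n => h n ^ 2)).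
      { eapply Rle_trans; [|apply (series_ge_term (fun n => h n ^ 2) 0); [intros; apply pow2_ge_0|exact Hl2]].
        apply pow2_ge_0. }
      destruct (le_lt_dec m M) as [Hm|Hm].
      2:{ rewrite (gal_zero _ _ _ _ _ Hu) by assumption. unfold E. lra. }
      assert (HE := energy_bound N d p_infty M u r HNge Hdge (gal_solves _ _ _ _ _ Hu)
        (fun s k Hs => Hnn s k (proj1 Hs)) (proj2 (Ico0_infty r) Hr)).
      rewrite (sum_eq (fun n => u 0 n ^ 2) (fun n => h n ^ 2)) in HE
        by (intros k Hk; rewrite (gal_init _ _ _ _ _ Hu) by exact Hk; reflexivity).
      assert (HSer := series_ge_term (fun n => h n ^ 2) M (fun k => pow2_ge_0 _) Hl2).
      assert (Hterm : u r m ^ 2 <= sum_f_R0 (fun n => u r n ^ 2) M)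
        by (apply (sum_ge_term (fun n => u r n ^ 2)); [intros; apply pow2_ge_0|exact Hm]).
      destruct (Rle_lt_dec (u r m) E); [assumption|exfalso]. unfold E in *. nra. }
    assert (Hbar : forall t n, 0 <= t -> e n * u t n <= A n).
    { intros r m Hr. destruct (le_lt_dec m M) as [Hm|Hm].
      2:{ rewrite (gal_zero _ _ _ _ _ Hu), Rmult_0_r by assumption. left. apply HApos. }
      left. apply (galerkin_barrier N0 b d h A kap n0 n2 M u); try assumption.
      - lra.
      - unfold n0. lia.
      - intros k s Hk Hs. eapply Rle_lt_trans; [|apply (bar_low _ _ _ _ _ _ _ HA k Hk)].
        apply Rmult_le_compat_l; [left; apply He|apply HuE, Hs].
      - apply (bar_init _ _ _ _ _ _ _ HA).
      - intros k Hk1 Hk2. destruct (bar_mid _ _ _ _ _ _ _ HA k Hk1 Hk2) as [B1 [B2 B3]].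
        split; [exact B1|]. split; [exact B2|]. split; [exact B3|].
        rewrite (crit_weight_ratio N0 b (S k)) by lra.
        specialize (Hn0' (S k) ltac:(unfold n0 in Hk1; lia)).
        set (q := Rpower (freq N0 b (S k)) ((b - 1) / (b + 2))) in *.
        rewrite Rpow_mult_distr. rewrite (Rmult_comm 20).
        apply Rmult_le_compat_l; [apply pow2_ge_0|]. nra.
      - intros k Hk. rewrite (bar_const _ _ _ _ _ _ _ HA (S k)), (bar_const _ _ _ _ _ _ _ HA k) by lia.
        assert (Hb2 := bar_high _ _ _ _ _ _ _ HA (S k) ltac:(lia)). simpl in Hb2.
        specialize (HApos n2). nra. }
    assert (Hdec : forall k t, 0 <= t -> e (n2 + k)%nat * u t (n2 + k)%nat <= K * z k).
    { induction k as [|k IH]; intros r Hr.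
      - rewrite Nat.add_0_r. unfold z; simpl. unfold K.
        replace (2 * A n2 * / 2) with (A n2) by field. apply Hbar, Hr.
      - replace (n2 + S k)%nat with (S (n2 + k)) by lia.
        assert (HzS : z (S k) = Rmax (a (S k)) (z k ^ 2)) by reflexivity.
        destruct (le_lt_dec (S (n2 + k)) M) as [Hm|Hm].
        2:{ rewrite (gal_zero _ _ _ _ _ Hu), Rmult_0_r by assumption.
            apply Rmult_le_pos; [lra|apply Hz]. }
        assert (HKk : K <= kap (S (n2 + k))) by (apply (bar_high _ _ _ _ _ _ _ HA); lia).
        apply (damped_upper_bound (fun s => e (S (n2 + k)) * u s (S (n2 + k)))
          (fun s => e (S (n2 + k)) * rhs N d (u s) (S (n2 + k)))
          (e (S (n2 + k)) ^ 2) ((K * z k) ^ 2) (kap (S (n2 + k)))).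
        + apply pow2_ge_0.
        + assert (Hzk : z k ^ 2 <= z (S k)) by (rewrite HzS; apply Rmax_r).
          apply Rle_trans with (K * (K * z (S k))).
          * replace ((K * z k) ^ 2) with (K * (K * z k ^ 2)) by ring.
            apply Rmult_le_compat_l; [lra|]. apply Rmult_le_compat_l; lra.
          * apply Rmult_le_compat_r; [apply Rmult_le_pos; [lra|apply Hz]|exact HKk].
        + left. apply Hkap.
        + rewrite (gal_init _ _ _ _ _ Hu) by exact Hm.
          apply Rle_trans with (K * a (S k)).
          * unfold a. replace (n2 + S k)%nat with (S (n2 + k)) by lia. right. field. lra.
          * apply Rmult_le_compat_l; [lra|]. rewrite HzS. apply Rmax_l.
        + intros s Hs. apply (has_deriv_scal _ (fun s => u s (S (n2 + k)))).
          apply (gal_solves _ _ _ _ _ Hu); [exact Hm|apply Ico0_infty, Hs].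
        + intros s Hs. unfold e, N. rewrite (crit_weight_rhs N0 b d kap) by (lra || exact Hdk). fold e.
          specialize (IH s Hs).
          apply Rmult_le_compat_l; [apply pow2_ge_0|].
          assert ((e (n2 + k)%nat * u s (n2 + k)%nat) ^ 2 <= (K * z k) ^ 2).
          { apply pow_incr. split; [|exact IH]. apply Rmult_le_pos; [left; apply He|apply Hnn, Hs]. }
          assert (0 <= e (S (n2 + k)) * u s (S (n2 + k)) * (e (S (S (n2 + k))) * u s (S (S (n2 + k)))))
            by (repeat apply Rmult_le_pos; first [left; apply He|apply Hnn, Hs]).
          lra.
        + exact Hr. }
    apply (Rmult_le_reg_l (e n)); [apply He|].
    unfold U. destruct (le_lt_dec n2 n) as [Hn|Hn].
    + specialize (Hdec (n - n2)%nat t Ht0). replace (n2 + (n - n2))%nat with n in Hdec by lia.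
      replace (e n * (K * z (n - n2)%nat * / e n)) with (K * z (n - n2)%nat)
        by (field; apply Rgt_not_eq, He).
      exact Hdec.
    + replace (e n * (A n * / e n)) with (A n) by (field; apply Rgt_not_eq, He).
      apply Hbar, Ht0.
Qed.

(** Finiteness has two sides: blow-up bounds the existence times, and local existence supplies one,
    since the supremum of the empty set is [m_infty]. *)
Lemma Tmax_finite_single_mode (N0 b nu alpha : R) :
  1 < N0 -> 1 < b < 2 -> 0 < nu -> 0 <= alpha < 1 / (b + 2) ->
  exists h, nonneg_seq h /\ finitely_supported h /\ is_finite (Tmax (freq N0 b) nu alpha h).
Proof.
  intros HN0 Hb Hnu Ha.
  destruct (single_mode_blowup N0 b nu alpha HN0 ltac:(lra) Ha) as [X [Ts [HX HTs]]].
  destruct (local_existence N0 b nu alpha X HN0 Hb Hnu HX) as [T0 [HT0 Hloc]].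
  exists (fun n => match n with O => X | S _ => 0 end). split; [|split].
  - intros n. destruct n; lra.
  - exists 1%nat. intros n Hn. destruct n; [lia|reflexivity].
  - unfold Tmax. destruct (Lub_Rbar_correct (fun T => 0 < T /\ exists u, nonneg_smooth_solution
      (freq N0 b) nu alpha (fun n => match n with O => X | S _ => 0 end) (Ico0 T) u)) as [Hub Hlub].
    set (l := Lub_Rbar _) in *.
    assert (H1 : Rbar_le T0 l) by (apply Hub; split; assumption).
    assert (H2 : Rbar_le l Ts) by (apply Hlub; intros T [HT Hex]; apply HTs; assumption).
    apply is_finite_correct. destruct l as [l| |]; [exists l; reflexivity|contradiction|contradiction].
Qed.

Lemma Tmax_of_global_solution (N : nat -> R) (nu alpha : R) (h : nat -> R) (u : R -> nat -> R) :
  nonneg_smooth_solution N nu alpha h (Ico0 p_infty) u -> Tmax N nu alpha h = p_infty.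
Proof.
  intros [Hu [Hnn Hsm]]. unfold Tmax.
  destruct (Lub_Rbar_correct (fun T => 0 < T /\ exists u, nonneg_smooth_solution N nu alpha h (Ico0 T) u))
    as [Hub _].
  set (l := Lub_Rbar _) in *.
  assert (Hall : forall T : R, 0 < T -> Rbar_le T l).
  { intros T HT. apply Hub. split; [exact HT|]. exists u.
    assert (Hsub : forall t, Ico0 T t -> Ico0 p_infty t) by (intros t Ht; apply Ico0_infty, Ht).
    split; [|split].
    - split.
      + intros t Ht. apply (fes_l2 _ _ _ _ _ _ Hu), Hsub, Ht.
      + intros n. destruct (fes_eq _ _ _ _ _ _ Hu n) as [du Hdu]. exists du. intros t Ht.
        destruct (Hdu t (Hsub t Ht)) as [H1 [H2 H3]].
        assert (HD : forall x, D_x (Ico0 T) t x -> D_x (Ico0 p_infty) t x)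
          by (intros x [Hx Hne]; split; [apply Hsub, Hx|exact Hne]).
        split; [|split; [|exact H3]]; [exact (limit1_imp _ _ _ _ _ HD H1)|exact (limit1_imp _ _ _ _ _ HD H2)].
      + intros H0. apply (fes_init _ _ _ _ _ _ Hu), Hsub, H0.
    - intros t Ht. apply Hnn, Hsub, Ht.
    - intros t0 t1 H01 HI. apply Hsm; [exact H01|]. intros t Ht. apply Hsub, HI, Ht. }
  destruct l as [l| |]; [|reflexivity|].
  - assert (H := Hall (Rabs l + 1)). assert (0 <= Rabs l) by apply Rabs_pos.
    assert (l <= Rabs l) by apply Rle_abs. specialize (H ltac:(lra)). simpl in H. lra.
  - assert (H := Hall 1 Rlt_0_1). contradiction.
Qed.

Lemma finitely_supported_in_Hinf (N h : nat -> R) : finitely_supported h -> in_Hinf N h.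
Proof.
  intros [M HM] s _. unfold in_Hs.
  apply (ex_series_incr_n _ M).
  apply (ex_series_ext (fun _ => 0)).
  - intros n. rewrite HM by lia. rewrite (pow_i 2) by lia. symmetry. apply Rmult_0_r.
  - exists 0. change (is_lim_seq (sum_n (fun _ => 0)) 0).
    apply (is_lim_seq_ext (fun _ => 0)); [|apply is_lim_seq_const].
    intros n. rewrite sum_n_const, Rmult_0_r. reflexivity.
Qed.

Theorem theorem1p1 (N0 b nu : R) (hN0 : 1 < N0) (hb : 1 < b < 2) (hnu : 0 < nu) :
  (forall alpha : R, 1 / (b + 2) <= alpha ->
     forall h : nat -> R, nonneg_seq h -> in_Hinf (freq N0 b) h ->
     exists u : R -> nat -> R,
       (finite_energy_solution (freq N0 b) nu alpha h (Ico0 p_infty) u /\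
        nonneg_on (Ico0 p_infty) u) /\
       (forall v : R -> nat -> R,
          finite_energy_solution (freq N0 b) nu alpha h (Ico0 p_infty) v ->
          nonneg_on (Ico0 p_infty) v ->
          forall t : R, Ico0 p_infty t -> forall n : nat, v t n = u t n) /\
       smooth_on (freq N0 b) (Ico0 p_infty) u) /\
  (forall alpha : R, 0 <= alpha < 1 / (b + 2) ->
     exists h : nat -> R, nonneg_seq h /\ finitely_supported h /\
       is_finite (Tmax (freq N0 b) nu alpha h)) /\
  (forall alpha : R, 0 <= alpha ->
     (global_regularity (freq N0 b) nu alpha <-> 1 / (b + 2) <= alpha)).
Proof.
  split; [|split].
  - intros alpha Ha h Hh Hinf.
    destruct (global_smooth_solution N0 b nu alpha h) as [u Hu]; auto.
    { apply in_Hinf_rapidly_decaying; assumption. }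
    exists u. assert (Hu' := Hu). destruct Hu' as [H1 [H2 H3]]. split; [split; assumption|].
    split; [|exact H3]. intros v Hv Hvn.
    apply (weak_strong_uniqueness N0 b nu alpha h p_infty u v); auto; lra.
  - intros alpha Ha. apply Tmax_finite_single_mode; assumption.
  - intros alpha Ha0. split.
    (* The blow-up datum is finitely supported, hence admissible; a global smooth solution from it
       would make its [Tmax] infinite. *)
    + intros Hreg. apply Rnot_lt_le. intros Hlt.
      destruct (Tmax_finite_single_mode N0 b nu alpha hN0 hb hnu (conj Ha0 Hlt)) as [h [Hh [Hfs Hfin]]].
      destruct (Hreg h Hh) as [u Hu]; [apply finitely_supported_in_Hinf, Hfs|].
      rewrite (Tmax_of_global_solution _ _ _ _ _ Hu) in Hfin. discriminate.
    + intros Ha h Hh Hinf. apply global_smooth_solution; auto.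
      apply in_Hinf_rapidly_decaying; assumption.
Qed.
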